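(* Let $\mathcal{M}$ be the operator on $\mathcal{A}_\infty(U)^{\oplus k}$ defined by $(\mathcal{M}\mathbf{w})_i(z)=\sum_{j=1}^k p_{ij}\,w_j(\widehat{M}_j z)$ for $1\le i\le k$, $\mathbf{w}=(w_1,\dots,w_k)$. Then: (a) $\mathcal{M}$ is a bounded operator with $\|\mathcal{M}\|=1$; (b) the function $\mathbf{1}^{\oplus k}:=\mathbf{1}\oplus\cdots\oplus\mathbf{1}\in\mathcal{A}_\infty(U)^{\oplus k}$ is the unique eigenfunction of $\mathcal{M}$ corresponding to the eigenvalue $1$; (c) the spectrum of $\mathcal{M}$ contains the single isolated eigenvalue $1$ (of algebraic multiplicity $1$), with the rest of the spectrum contained in a closed subset of $\{z\in\mathbb{C}:|z|<1\}$; (d) there exist unique bounded linear functionals $\nu_1,\dots,\nu_k$ on $\mathcal{A}_\infty(U)$ such that $\|\nu_i\|=1$ for each $1\le i\le k$, and such that $\mathcal{M}'\nu=\nu$, where $\mathcal{M}'$ denotes the dual operator of $\mathcal{M}$, $\nu=\oplus_{i=1}^k q_i\nu_i$ (that is, $\nu(\mathbf{w})=\sum_{i=1}^k q_i\nu_i(w_i)$), and $\mathbf{q}=(q_1,\dots,q_k)$ is the stationary distribution for $P$; (e) for functions $w_1,\dots,w_k\in\mathcal{A}_\infty(U)$, denoting $\mathbf{w}=(w_1,\dots,w_k)$, we have $$\mathcal{M}^n\mathbf{w}\to (\nu_1(w_1),\dots,\nu_k(w_k))\quad\text{as } n\to\infty,$$ in the topology induced by the supremum norm, where $\nu_1,\dots,\nu_k$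 are the linear functionals given in (d). Moreover, when $\mathcal{M}$ is regarded as acting, by the same formula, on $\mathcal{C}(\overline{V},\mathbb{R})^{\oplus k}$, then: (f) there exist $k$ unique probability measures $\nu_1^*,\dots,\nu_k^*$ on $\overline{V}$ such that $$\int\mathcal{M}\mathbf{f}\,\mathrm{d}\nu^*=\int\mathbf{f}\,\mathrm{d}\nu^*,\qquad \mathbf{f}=(f_1,\dots,f_k)\in\mathcal{C}(\overline{V},\mathbb{R})^{\oplus k},$$ where $\nu^*=\oplus_{i=1}^k q_i\nu_i^*$ (that is, $\int\mathbf{f}\,\mathrm{d}\nu^*=\sum_{i=1}^k q_i\int f_i\,\mathrm{d}\nu_i^*$) and $\mathbf{q}$ is the stationary distribution for $P$; (g) for any $\mathbf{f}=(f_1,\dots,f_k)\in\mathcal{C}(\overline{V},\mathbb{R})^{\oplus k}$, $$\mathcal{M}^n\mathbf{f}\to\left(\int f_1\,\mathrm{d}\nu_1^*,\dots,\int f_k\,\mathrm{d}\nu_k^*\right)\quad\text{as } n\to\infty,$$ in the topology induced by the supremum norm, where $\nu_1^*,\dots,\nu_k^*$ are the probability measures given in (f).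
   Context: Let $d\ge 2$, $k\ge1$, let $M_1,\dots,M_k\in GL(d,\mathbb{R})$ be matrices with all entries strictly positive, let $P=(p_{ij})_{1\le i,j\le k}$ be a stochastic matrix with all entries strictly positive, and let $\mathbf{q}=(q_1,\dots,q_k)$ be the stationary distribution of $P$ ($\mathbf{q}P=\mathbf{q}$, $\sum_i q_i=1$). Put $C_+^{d-1}=\{(1,z_2,\dots,z_d): z_i\in\mathbb{C},\ \operatorname{Re} z_i>0\}$, identified with an open subset of $\mathbb{C}^{d-1}$ by dropping the first coordinate. For a positive matrix $M$, $\widehat{M}(z)=Mz/(Mz)_1$, where $(Mz)_1$ is the first entry of $Mz$. Throughout, $U\subset C_+^{d-1}$ is a fixed bounded, nonempty, connected open set such that $V:=\operatorname{Re} U=\{\operatorname{Re} z:z\in U\}$ is a connected open subset of $\{(1,x_2,\dots,x_d):x_i\in\mathbb{R},\ x_i>0\}$ contained in $U$, and such that for each $i$: $\overline{\widehat{M}_i(U)}\subseteq U$, $\widehat{M}_i|_U$ is complex analytic, $\overline{\widehat{M}_i(V)}\subseteq V$, and $\widehat{M}_i|_V$ is real analytic (such sets exist). $\mathcal{A}_\infty(U)$ is the Banach space of complex analytic functions on $U$ with continuous extension to $\partial U$, with the supremum norm $\|w\|=\sup_{z\in U}|w(z)|$. $\mathcal{A}_\infty(U)^{\oplus k}$ is the direct sum of $k$ copies of it, with norm $\|\mathbf{w}\|=\sum_{i=1}^k q_i\|w_i\|$. $\mathcal{C}(\overline{V},\mathbb{R})$ is the space of continuous real functions on $\overline{V}$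 with the supremum norm, and $\mathcal{C}(\overline{V},\mathbb{R})^{\oplus k}$ is the direct sum of $k$ copies, with norm $|\mathbf{f}|_\infty=\sum_i q_i\sup_{\overline V}|f_i|$. $\mathbf{1}$ is the constant function $1$.
   Formalization: In (e),(g) the limit is the constant vector with all entries Σ q_i ν_i(w_i) (resp. Σ q_i∫f_i dν_i* ), as the printed limit fails for k≥2 at w=(1,0,…,0); in (d) the ν_i are unique up to a common unimodular constant, and unique given ν_i(1)=1, since −ν_i also qualify. *)

(* Defs.v *)
From HB Require Import structures.
From mathcomp Require Import all_boot all_order all_algebra.
From mathcomp Require Import complex.
From mathcomp Require Import all_classical all_reals all_analysis.

Set Implicit Arguments.
Unset Strict Implicit.
Unset Printing Implicit Defensive.

Import Order.TTheory GRing.Theory Num.Theory.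
Import numFieldNormedType.Exports.

Local Open Scope classical_set_scope.
Local Open Scope ring_scope.
Local Open Scope complex_scope.

(* The usual topology and norm of the complex plane, as a normed module over
   itself. *)
HB.instance Definition _ (R : realType) := NormedModule.copy R[i] R[i]^o.

(* The real-valued modulus; `|z| lives in R[i]. *)
Notation normc := (@ComplexField.Normc.normc _).

(* Points are row vectors: with d = 1 + n, 'rV[K]_n is K^(d-1), that is, the
   points (1, z_2, ..., z_d) with their first coordinate dropped. *)

Section Analytic.
Variables (K : numFieldType) (n : nat).
Implicit Types (a : ('I_n -> nat) -> K) (h z : 'rV[K]_n).

Definition monomial_term a h N (al : {ffun 'I_n -> 'I_N}) : K :=
  a (fun i => al i : nat) * \prod_i h 0 i ^+ al i.

(* f is near z the sum of an absolutely convergent power series: the sums are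
   taken over the boxes {0, ..., N-1}^n of multi-indices, which exhaust nat^n. *)
Definition analytic_at (f : 'rV[K]_n -> K) z : Prop :=
  exists a (r : K), 0 < r /\
    forall h, (forall i, `|h 0 i| < r) ->
      (exists B : K, forall N,
        \sum_(al : {ffun 'I_n -> 'I_N}) `|monomial_term a h al| <= B) /\
      ((fun N => \sum_(al : {ffun 'I_n -> 'I_N}) monomial_term a h al) @ \oo
         --> f (z + h)).

Definition analytic_on (D : set 'rV[K]_n) (f : 'rV[K]_n -> K) : Prop :=
  forall z, D z -> analytic_at f z.

Definition analytic_map_on m (D : set 'rV[K]_n) (F : 'rV[K]_n -> 'rV[K]_m) :
    Prop :=
  forall j, analytic_on D (fun z => F z 0 j).

Lemma analytic_at_cst (c : K) z : analytic_at (fun=> c) z.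
Proof.
pose a (al : 'I_n -> nat) : K := if [forall i, al i == 0%N] then c else 0.
have zero0 N (h : 'rV[K]_n) :
    \sum_(al : {ffun 'I_n -> 'I_N.+1}) monomial_term a h al = c.
  rewrite (bigD1 [ffun=> ord0]) //= big1 ?addr0; last first.
    move=> al al0; rewrite /monomial_term /a ifF ?mul0r//.
    apply: contraNF al0 => /forallP al0.
    by apply/eqP/ffunP => i; rewrite ffunE; apply/val_inj/eqP/al0.
  rewrite /monomial_term /a ifT; last by apply/forallP => i; rewrite ffunE.
  by rewrite big1 ?mulr1// => i _; rewrite ffunE expr0.
have norm0 N (h : 'rV[K]_n) :
    \sum_(al : {ffun 'I_n -> 'I_N.+1}) `|monomial_term a h al| = `|c|.
  rewrite (bigD1 [ffun=> ord0]) //= big1 ?addr0; last first.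
    move=> al al0; rewrite /monomial_term /a ifF ?mul0r ?normr0//.
    apply: contraNF al0 => /forallP al0.
    by apply/eqP/ffunP => i; rewrite ffunE; apply/val_inj/eqP/al0.
  rewrite /monomial_term /a ifT; last by apply/forallP => i; rewrite ffunE.
  by rewrite big1 ?mulr1// => i _; rewrite ffunE expr0.
exists a, 1; split=> // h _; split.
  exists (`|c| + \sum_(al : {ffun 'I_n -> 'I_0}) `|monomial_term a h al|).
  by move=> [|N]; [rewrite lerDr | rewrite norm0 lerDl sumr_ge0].
rewrite -cvg_shiftS /=.
rewrite (_ : (fun N => _) = fun=> c); first exact: cvg_cst.
by apply/funext => N; exact: zero0.
Qed.

Lemma analytic_atZD (c : K) f g z :
  analytic_at f z -> analytic_at g z -> analytic_at (c *: f + g) z.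
Proof.
move=> [a [r [r0 fa]]] [b [s [s0 gb]]].
have rs : r >=< s by apply: real_comparable; exact: gtr0_real.
exists (fun al => c * a al + b al), (Num.min r s); split.
  by rewrite comparable_lt_min// r0.
move=> h hrs.
have hr i : `|h 0 i| < r by have := hrs i; rewrite comparable_lt_min// => /andP[].
have hs i : `|h 0 i| < s by have := hrs i; rewrite comparable_lt_min// => /andP[].
have [[A hA] cf] := fa _ hr; have [[B hB] cg] := gb _ hs.
have E N (al : {ffun 'I_n -> 'I_N}) :
    monomial_term (fun al => c * a al + b al) h al
    = c * monomial_term a h al + monomial_term b h al.
  by rewrite /monomial_term mulrDl mulrA.
split.
  exists (`|c| * A + B) => N.
  apply: (@le_trans _ _ (\sum_(al : {ffun 'I_n -> 'I_N})
     (`|c| * `|monomial_term a h al| + `|monomial_term b h al|))).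
    by apply: ler_sum => al _; rewrite E -normrM ler_normD.
  by rewrite big_split /= -mulr_sumr lerD ?ler_wpM2l ?hA ?hB.
rewrite (_ : (fun N => _) = fun N =>
    c * (\sum_(al : {ffun 'I_n -> 'I_N}) monomial_term a h al) +
    \sum_(al : {ffun 'I_n -> 'I_N}) monomial_term b h al).
  by apply: cvgD => //; apply: cvgMr.
apply/funext => N; rewrite mulr_sumr -big_split.
by apply: eq_bigr => al _; exact: E.
Qed.

Lemma near_analytic_at f g z :
  (\forall y \near z, f y = g y) -> analytic_at f z -> analytic_at g z.
Proof.
move=> /nbhs_ballP[e /= e0 fg] [a [r [r0 fa]]].
have re : r >=< e by apply: real_comparable; exact: gtr0_real.
exists a, (Num.min r e); split; first by rewrite comparable_lt_min// r0.
move=> h hre.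
have hr i : `|h 0 i| < r by have := hre i; rewrite comparable_lt_min// => /andP[].
have he i : `|h 0 i| < e by have := hre i; rewrite comparable_lt_min// => /andP[].
have [fB cf] := fa _ hr; split=> //; rewrite -fg//.
by split=> // i j; rewrite ord1 /ball /= !mxE opprD addrA subrr add0r normrN.
Qed.

End Analytic.

Section Projective_action.
Variables (K : fieldType) (n : nat).

(* The vector (1, z_2, ..., z_d). *)
Definition affine (z : 'rV[K]_n) : 'cV[K]_(1 + n) := col_mx 1%:M z^T.

Definition hat (M : 'M[K]_(1 + n)) (z : 'rV[K]_n) : 'rV[K]_n :=
  \row_j ((M *m affine z) (rshift 1 j) 0 / (M *m affine z) (lshift n 0) 0).

(* w |-> (sum_j p_ij w_j o m_j)_i *)
Definition transfer k (p : 'M[K]_k) (m : 'I_k -> 'rV[K]_n -> 'rV[K]_n)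
    (w : 'I_k -> 'rV[K]_n -> K) : 'I_k -> 'rV[K]_n -> K :=
  fun i z => \sum_j p i j * w j (m j z).

End Projective_action.

Section Complexification.
Variable R : realType.

Definition cmx m n (A : 'M[R]_(m, n)) : 'M[R[i]]_(m, n) :=
  map_mx (real_complex R) A.

Definition remx m n (A : 'M[R[i]]_(m, n)) : 'M[R]_(m, n) :=
  map_mx (@complex.Re R) A.

End Complexification.

Section A_infinity.
Variables (R : realType) (n : nat) (U : set 'rV[R[i]]_n).

(* A function on U is represented by its extension by 0 outside U, so that
   Leibniz equality is equality on U. *)
Definition Ainf_pred : {pred ('rV[R[i]]_n -> R[i])} := fun w =>
  `[< [/\ (forall z, ~ U z -> w z = 0), analytic_on U w &
        exists2 g : 'rV[R[i]]_n -> R[i],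
          {within closure U, continuous g} & forall z, U z -> g z = w z] >].

Record Ainf := MkAinf {
  Ainf_val :> 'rV[R[i]]_n -> R[i];
  Ainf_valP : Ainf_val \in Ainf_pred }.

HB.instance Definition _ := [isSub for Ainf_val].
HB.instance Definition _ := [Choice of Ainf by <:].

Lemma Ainf_submod_closed : GRing.submod_closed Ainf_pred.
Proof.
split=> [|c u v /asboolP[u0 ua [g cg gu]] /asboolP[v0 va [f cf fv]]].
  apply/asboolP; split=> // [z _|]; first exact: (@analytic_at_cst _ _ 0).
  by exists (fun=> 0) => // x; exact: cvg_cst.
apply/asboolP; split=> [z Uz|z Uz|].
- rewrite (_ : _ z = c *: u z + v z)// u0// v0//.
  by rewrite scaler0 addr0.
- by apply: analytic_atZD; [exact: ua|exact: va].
- exists (c *: g + f).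
    by move=> x; apply: cvgD; [apply: cvgZr; exact: cg|exact: cf].
  by move=> z Uz; rewrite (_ : _ z = c *: g z + f z)// gu// fv.
Qed.

HB.instance Definition _ :=
  GRing.isSubmodClosed.Build R[i] ('rV[R[i]]_n -> R[i]) Ainf_pred
    Ainf_submod_closed.
HB.instance Definition _ := [SubChoice_isSubLmodule of Ainf by <:].

Definition Acst_fun (c : R[i]) : 'rV[R[i]]_n -> R[i] :=
  fun z => if `[< U z >] then c else 0.

Lemma Acst_subproof (oU : open U) c : Acst_fun c \in Ainf_pred.
Proof.
apply/asboolP; split=> [z Uz|z Uz|].
- by rewrite /Acst_fun asboolF.
- apply: near_analytic_at (analytic_at_cst c z).
  near=> y; rewrite /Acst_fun asboolT//.
  by near: y; exact: open_nbhs_nbhs.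
- exists (fun=> c); first by move=> x; exact: cvg_cst.
  by move=> z Uz; rewrite /Acst_fun asboolT.
Unshelve. all: by end_near. Qed.

Definition Acst (oU : open U) (c : R[i]) : Ainf := MkAinf (Acst_subproof oU c).

Definition normA (w : Ainf) : R := sup [set normc (w z) | z in U].

End A_infinity.
Arguments normA {R n} U w.

Section Operators.
Variables (R : realType) (E F : lmodType R[i]) (nE : E -> R) (nF : F -> R).

Definition bounded_op (T : E -> F) : Prop :=
  exists c : R, forall x, nF (T x) <= c * nE x.

(* Meaningful for bounded operators only: sup is real-valued. *)
Definition opnorm (T : E -> F) : R :=
  sup [set nF (T x) | x in [set x | nE x <= 1]].

End Operators.

Section Spectral.
Variables (R : realType) (E : lmodType R[i]) (nE : E -> R) (T : E -> E).

Definition shift_op (l : R[i]) (x : E) : E := T x - l *: x.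

Definition resolvent_set : set R[i] :=
  [set l | exists S : {linear E -> E},
    [/\ bounded_op nE nE S, cancel S (shift_op l) & cancel (shift_op l) S]].

Definition spectrum : set R[i] := ~` resolvent_set.

Definition eigenfunction (l : R[i]) (x : E) : Prop := x <> 0 /\ T x = l *: x.

(* The generalised eigenspace, the union over N of ker (T - l)^N, has a basis
   with m elements. *)
Definition algebraic_multiplicity (l : R[i]) (m : nat) : Prop :=
  exists b : 'I_m -> E,
    (forall c : 'I_m -> R[i], \sum_i c i *: b i = 0 -> forall i, c i = 0) /\
    (forall x, (exists N, iter N (shift_op l) x = 0) <->
               (exists c : 'I_m -> R[i], x = \sum_i c i *: b i)).

Definition dual_op (phi : E -> R[i]) : E -> R[i] := phi \o T.

End Spectral.

Section Direct_sums.
Variables (R : realType) (n k : nat) (q : 'rV[R]_k).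

Definition Ainfk (U : set 'rV[R[i]]_n) := {ffun 'I_k -> Ainf U}.

Definition normAk U (w : Ainfk U) : R := \sum_i q 0 i * normA U (w i).

Definition functional_norm1 (U : set 'rV[R[i]]_n) (phi : Ainf U -> R[i]) : Prop :=
  bounded_op (normA U) normc phi /\ opnorm (normA U) normc phi = 1.

Definition cst_vec U (oU : open U) (c : R[i]) : Ainfk U := [ffun=> Acst oU c].

Definition nu_sum U (nu : 'I_k -> {scalar Ainf U}) (w : Ainfk U) : R[i] :=
  \sum_i (q 0 i)%:C * nu i (w i).

(* Elements of C(clV, R)^k, for a closed set clV, are represented by tuples of
   total functions of which only the values on clV matter. *)
Definition Ck (clV : set 'rV[R]_n) (f : 'I_k -> 'rV[R]_n -> R) : Prop :=
  forall i, {within clV, continuous (f i)}.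

Definition normCk (clV : set 'rV[R]_n) (f : 'I_k -> 'rV[R]_n -> R) : R :=
  \sum_i q 0 i * sup [set `|f i x| | x in clV].

(* R^n with its Borel sigma-algebra. *)
Definition borel_rV := g_sigma_algebraType (@open 'rV[R]_n).

(* Probability measures on a closed set clV, as Borel probability measures on
   R^n that give full mass to clV. *)
Definition prob_on (clV : set 'rV[R]_n) (mu : 'I_k -> probability borel_rV R) :
    Prop :=
  forall i, mu i clV = 1%E.

Definition int_sum (clV : set 'rV[R]_n) (mu : 'I_k -> probability borel_rV R)
    (f : 'I_k -> 'rV[R]_n -> R) : R :=
  \sum_i q 0 i * (\int[mu i]_(x in clV) f i x)%R.

End Direct_sums.
Arguments normAk {R n k} q U w.

Section Data.
Variable R : realType.

Definition stochastic k (P : 'M[R]_k) : Prop :=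
  (forall i j, 0 <= P i j) /\ forall i, \sum_j P i j = 1.

Definition stationary k (P : 'M[R]_k) (q : 'rV[R]_k) : Prop :=
  [/\ forall i, 0 <= q 0 i, \sum_i q 0 i = 1 & q *m P = q].

Definition positive_mx m n (A : 'M[R]_(m, n)) : Prop := forall i j, 0 < A i j.

End Data.

(* Main.v *)
(* Positive matrices contract the spread of quotients of entries, so long
   products of the maps hat M_i shrink U uniformly. By a Schwarz lemma this
   halves the oscillation of every analytic function after enough steps, with
   no bound on derivatives; together with the Doeblin condition p_ij > 0 some
   power of the operator contracts the total oscillation of (w_1, ..., w_k),
   over points and indices, by a factor < 1. Hence M^n w converges to a
   constant nu(w), which gives (a), (b), (d) and (e). For the spectrum, M^N -
   l^N = (M - l) S, so it suffices to invert M^N - l^N on ker nu by a Neumann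
   series when |l|^N exceeds the contraction factor. The sum is analytic
   because, by compactness, all the compositions of w with products of the
   maps are uniform limits of polynomials on one and the same polydisc.

   On the closure of V the same oscillation estimate, from uniform
   continuity, proves (g) and the uniqueness in (f). No Riesz representation
   is needed for existence: nu*_i is the law of lim hat M_i hat M_b hat M_c
   ... v0 where i, b, c, ... is a path of the time-reversed chain q_b p_ba /
   q_a, realised on [0, 1[ with Lebesgue measure by nested subdivisions. *)

From Pilot Require Import Defs.
From HB Require Import structures.
From mathcomp Require Import all_boot all_order all_algebra.
From mathcomp Require Import separable cyclic cyclotomic.
From mathcomp Require Import complex.
From mathcomp Require Import all_classical all_reals all_analysis.
From mathcomp Require Import ring lra.

Set Implicit Arguments.
Unset Strict Implicit.
Unset Printing Implicit Defensive.

Import Order.TTheory GRing.Theory Num.Theory.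
Import numFieldNormedType.Exports.
Import ComplexField.Normc Pilot.Defs.

Local Open Scope classical_set_scope.
Local Open Scope ring_scope.
Local Open Scope complex_scope.

(** * Moduli and uniform approximation by polynomials *)

(** Analyticity is given by convergent power series, but every argument runs through a substitute:
    being, on some polydisc, a uniform limit of polynomials. [unif_poly_analytic] and
    [analytic_unif_poly] show that locally the two notions agree; Cauchy's estimates come from
    averages over roots of unity in place of integrals. Uniform limits stay in this class only while
    the polydisc is fixed, which is why the Neumann series requires one polydisc for all words.

    The Schwarz lemma bounds the square of the increment by [D ^+ 2 * normc t]: it studies the
    quotient of a squared increment by [t], whose value at the origin is 0. At t = 1/4 the resulting
    square root is the factor 1/2.

    The halving holds after a number of steps that does not depend on the function. This uniformity
    gives a contraction, hence a spectral gap. For merely continuous functions on the closure of V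
    the number of steps depends on the modulus of continuity, which is enough for convergence but
    gives no rate. *)

Section ModulusFacts.
Variable R : realType.
Local Notation C := R[i].
Implicit Types (x y z : C).

Lemma normc_ge0 z : 0 <= normc z.
Proof. by case: z => a b; exact: sqrtr_ge0. Qed.

Lemma normrcE z : `|z| = (normc z)%:C.
Proof. by rewrite normc_def; case: z. Qed.

Lemma normcD x y : normc (x + y) <= normc x + normc y.
Proof. exact: le_normcD. Qed.

Lemma normcNE x : normc (- x) = normc x.
Proof. exact: normcN. Qed.

Lemma normcB x y : normc (x - y) = normc (y - x).
Proof. by rewrite -normcNE opprB. Qed.

Lemma normc_real (a : R) : normc a%:C = `|a|.
Proof. by rewrite /= expr0n /= addr0 sqrtr_sqr. Qed.

Lemma normcX x k : normc (x ^+ k) = normc x ^+ k.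
Proof. by elim: k => [|k IH]; rewrite ?expr0 ?normc1// !exprS normcM IH. Qed.

Lemma normc_nat k : normc (k%:R : C) = k%:R.
Proof. by rewrite -(rmorph_nat (real_complex R)) normc_real ger0_norm. Qed.

Lemma normc_prod (I : Type) (s : seq I) (P : pred I) (F : I -> C) :
  normc (\prod_(i <- s | P i) F i) = \prod_(i <- s | P i) normc (F i).
Proof. by apply: (big_morph _ (@normcM R)); exact: normc1. Qed.

Lemma normc_sum (I : Type) (s : seq I) (P : pred I) (F : I -> C) :
  normc (\sum_(i <- s | P i) F i) <= \sum_(i <- s | P i) normc (F i).
Proof.
elim/big_ind2 : _ => //; first by rewrite normc0.
by move=> x1 x2 y1 y2 h1 h2; apply: le_trans (normcD _ _) (lerD h1 h2).
Qed.

Lemma normc_dist3 x y z : normc (x - z) <= normc (x - y) + normc (y - z).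
Proof. by rewrite -[X in normc X <= _](subrKA y) normcD. Qed.

Lemma normc_lerB x y : normc x - normc y <= normc (x - y).
Proof. by rewrite lerBlDr; apply: le_trans (normcD _ _); rewrite subrK. Qed.

Lemma normc_gt0 x : (0 < normc x) = (x != 0).
Proof.
rewrite lt_def normc_ge0 andbT; congr (~~ _).
by apply/eqP/eqP => [/eq0_normc//|->]; rewrite normc0.
Qed.

Lemma normRe_le x : `|complex.Re x| <= normc x.
Proof.
case: x => a b /=; rewrite -(sqrtr_sqr a) ler_sqrt ?lerDl ?sqr_ge0//.
by rewrite addr_ge0 ?sqr_ge0.
Qed.

Lemma normIm_le x : `|complex.Im x| <= normc x.
Proof.
case: x => a b /=; rewrite -(sqrtr_sqr b) ler_sqrt ?lerDr ?sqr_ge0//.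
by rewrite addr_ge0 ?sqr_ge0.
Qed.

Lemma normc_le_ReIm x : normc x <= `|complex.Re x| + `|complex.Im x|.
Proof.
case: x => a b; rewrite [X in normc X](complexE (a +i* b)).
apply: le_trans (normcD _ _) _; rewrite normcM normc_real normc_real /=.
by rewrite expr0n /= add0r expr1n sqrtr1 mul1r.
Qed.

Lemma normc_lt_eps0 x : (forall e : R, 0 < e -> normc x <= e) -> x = 0.
Proof.
move=> h; apply: (@eq0_normc R); apply/eqP; rewrite eq_le normc_ge0 andbT.
by apply/ler_addgt0Pr => e e0; rewrite add0r h.
Qed.

Lemma gt0_complexP (e : C) : 0 < e -> exists2 r : R, 0 < r & e = r%:C.
Proof.
move=> e0; have : e \is Num.real by exact: gtr0_real.
move/RRe_real => E; exists (complex.Re e); last by rewrite E.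
by move: e0; rewrite -E ltcR.
Qed.

Lemma nbhs_complexP z (A : set C) :
  nbhs z A <-> exists2 r : R, 0 < r & forall y, normc (y - z) < r -> A y.
Proof.
split.
- move=> /nbhs_ballP[e /= /gt0_complexP[r r0 ->] h]; exists r => // y yz.
  by apply: h; rewrite -ball_normE /= normrcE ltcR normcB.
- move=> [r r0 h]; apply/nbhs_ballP; exists r%:C; first by rewrite /= ltcR.
  move=> y; rewrite -ball_normE /= normrcE ltcR => yz.
  by apply: h; rewrite normcB.
Qed.

Definition cdist_lt n (r : R) (y z : 'rV[C]_n) :=
  forall i, normc (y 0 i - z 0 i) < r.

Lemma nbhs_rVcomplexP n (z : 'rV[C]_n) (A : set 'rV[C]_n) :
  nbhs z A <-> exists2 r : R, 0 < r & forall y : 'rV[C]_n, cdist_lt r y z -> A y.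
Proof.
split.
- move=> /nbhs_ballP[e /= /gt0_complexP[r r0 ->] h]; exists r => // y yz.
  apply: h; split; first by rewrite ltcR.
  by move=> i j; rewrite ord1 -ball_normE /= normrcE ltcR normcB; exact: yz.
- move=> [r r0 h]; apply/nbhs_ballP; exists r%:C; first by rewrite /= ltcR.
  move=> y [_ yz]; apply: h => i.
  by have := yz 0 i; rewrite -ball_normE /= normrcE ltcR normcB.
Qed.

Lemma nbhs_rVP n (z : 'rV[R]_n) (A : set 'rV[R]_n) :
  nbhs z A <-> exists2 r : R, 0 < r &
    forall y : 'rV[R]_n, (forall i, `|y 0 i - z 0 i| < r) -> A y.
Proof.
split.
- move=> /nbhs_ballP[e /= e0 h]; exists e => // y yz.
  apply: h; split=> // i j.
  by rewrite ord1 -ball_normE /= distrC; exact: yz.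
- move=> [r r0 h]; apply/nbhs_ballP; exists r => //.
  move=> y [_ yz]; apply: h => i.
  by have := yz 0 i; rewrite -ball_normE /= distrC.
Qed.

Lemma complex_lim (u : nat -> C) :
  (forall e : R, 0 < e -> exists N, forall p m, (N <= p)%N -> (N <= m)%N ->
     normc (u p - u m) < e) ->
  exists l, forall e : R, 0 < e -> exists N, forall m, (N <= m)%N ->
     normc (u m - l) < e.
Proof.
move=> cu.
have key (f : C -> R) : (forall x y, `|f x - f y| <= normc (x - y)) ->
    exists l, forall e : R, 0 < e -> exists N, forall m, (N <= m)%N ->
     `|f (u m) - l| < e.
  move=> fle; have /cauchy_cvgP cf : cauchy ((f \o u) @ \oo).
    apply/cauchy_exP => e e0; have [N hN] := cu _ e0.
    exists (f (u N)); exists N => // m /= Nm.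
    by rewrite -ball_normE /=; apply: le_lt_trans (fle _ _) (hN _ _ _ _).
  exists (lim ((f \o u) @ \oo)) => e e0.
  have /cvgrPdist_lt /(_ _ e0)[N _ hN] := cf.
  by exists N => m Nm; rewrite distrC; exact: hN.
have [a ha] := key (@complex.Re R) (fun x y => le_trans
  (ltac:(by rewrite raddfB) : _ <= `|complex.Re (x - y)|) (normRe_le _)).
have [b hb] := key (@complex.Im R) (fun x y => le_trans
  (ltac:(by rewrite raddfB) : _ <= `|complex.Im (x - y)|) (normIm_le _)).
exists (a +i* b) => e e0.
have [|N1 h1] := ha (e / 2); first by rewrite divr_gt0.
have [|N2 h2] := hb (e / 2); first by rewrite divr_gt0.
exists (maxn N1 N2) => m; rewrite geq_max => /andP[m1 m2].
apply: le_lt_trans (normc_le_ReIm _) _; rewrite [e]splitr.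
apply: ltrD; rewrite raddfB /=; [exact: h1|exact: h2].
Qed.

End ModulusFacts.

Section PolynomialFunctions.
Variables (R : realType).
Local Notation C := R[i].

(** The algebra generated by the constants and an abstract family [x] of functions. The family is a
    parameter so that the same closure lemmas serve the coordinates of C^n and the identity of C. *)
Inductive polyfun (X I : Type) (x : I -> X -> C) : (X -> C) -> Prop :=
| polyfun_cst c : polyfun x (fun=> c)
| polyfun_coord i : polyfun x (x i)
| polyfun_add f g : polyfun x f -> polyfun x g -> polyfun x (fun t => f t + g t)
| polyfun_mul f g : polyfun x f -> polyfun x g -> polyfun x (fun t => f t * g t).

(** The uniform closure of that algebra on [D]. Sums, products, suitable inverses and uniform limits
    stay in it without shrinking [D]. *)
Definition unif_poly (X I : Type) (x : I -> X -> C) (D : set X) (f : X -> C) :=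
  forall e : R, 0 < e -> exists2 p, polyfun x p &
    forall t, D t -> normc (f t - p t) <= e.

Definition bounded_fun_on (X : Type) (D : set X) (f : X -> C) :=
  exists B : R, forall t, D t -> normc (f t) <= B.

Section Generic.
Variables (X I : Type) (x : I -> X -> C) (D : set X).
Hypothesis x_bounded : forall i, bounded_fun_on D (x i).

Lemma polyfun_bounded p : polyfun x p -> bounded_fun_on D p.
Proof.
elim=> [c|i|f g _ [Bf hf] _ [Bg hg]|f g _ [Bf hf] _ [Bg hg]].
- by exists (normc c).
- exact: x_bounded.
- by exists (Bf + Bg) => t Dt; apply: le_trans (normcD _ _) (lerD (hf _ Dt) (hg _ Dt)).
- by exists (Bf * Bg) => t Dt; rewrite normcM ler_pM ?normc_ge0 ?hf ?hg.
Qed.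

Lemma unif_poly_bounded f : unif_poly x D f -> bounded_fun_on D f.
Proof.
move=> /(_ 1 ltr01)[p /polyfun_bounded[B hB] hp].
exists (1 + B) => t Dt; rewrite -[f t](subrK (p t)).
by apply: le_trans (normcD _ _) (lerD (hp _ Dt) (hB _ Dt)).
Qed.

Lemma polyfun_unif_poly p : polyfun x p -> unif_poly x D p.
Proof. by move=> pp e e0; exists p => // t _; rewrite subrr normc0 ltW. Qed.

Lemma unif_poly_eq f g : (forall t, D t -> f t = g t) ->
  unif_poly x D f -> unif_poly x D g.
Proof.
move=> fg uf e /uf[p pp hp]; exists p => // t Dt.
by rewrite -fg ?hp.
Qed.

Lemma unif_poly_add f g : unif_poly x D f -> unif_poly x D g ->
  unif_poly x D (fun t => f t + g t).
Proof.
move=> uf ug e e0; have e2 : 0 < e / 2 by rewrite divr_gt0.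
have [p pp hp] := uf _ e2; have [q pq hq] := ug _ e2.
exists (fun t => p t + q t) => [|t Dt]; first exact: polyfun_add.
have -> : f t + g t - (p t + q t) = (f t - p t) + (g t - q t) by ring.
by rewrite [e]splitr; apply: le_trans (normcD _ _) (lerD (hp _ Dt) (hq _ Dt)).
Qed.

Lemma unif_poly_mul f g : unif_poly x D f -> unif_poly x D g ->
  unif_poly x D (fun t => f t * g t).
Proof.
move=> uf ug e e0.
have [Bf hBf] := unif_poly_bounded uf; have [Bg hBg] := unif_poly_bounded ug.
(* [K] bounds both [g] and the approximant [p] of [f]; the latter since [d] is at most 1. *)
pose K := `|Bf| + `|Bg| + 1.
have K0 : 0 < K by rewrite ltr_wpDl// addr_ge0.
pose d := Num.min 1 (e / (2 * K)).
have d0 : 0 < d by rewrite lt_min ltr01 divr_gt0// mulr_gt0.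
have d1 : d <= 1 by rewrite ge_min lexx.
have dK : d * K <= e / 2.
  have : d <= e / (2 * K) by rewrite ge_min lexx orbT.
  by rewrite -(ler_pM2r K0) => /le_trans; apply; rewrite invfM mulrA divfK// gt_eqF.
have [p pp hp] := uf _ d0; have [q pq hq] := ug _ d0.
exists (fun t => p t * q t) => [|t Dt]; first exact: polyfun_mul.
have -> : f t * g t - p t * q t = (f t - p t) * g t + p t * (g t - q t) by ring.
apply: le_trans (normcD _ _) _; rewrite !normcM [e]splitr.
have hf := hBf _ Dt; have hg := hBg _ Dt; have hpt := hp _ Dt; have hqt := hq _ Dt.
have pK : normc (p t) <= K.
  rewrite -[p t](subrK (f t)); apply: le_trans (normcD _ _) _.
  rewrite normcB addrC; apply: lerD; last exact: le_trans hpt d1.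
  by move: hf (ler_norm Bf) (normr_ge0 Bg); lra.
have gK : normc (g t) <= K.
  by move: hg (ler_norm Bg) (normr_ge0 Bf); rewrite /K; lra.
apply: lerD; apply: le_trans dK.
  by rewrite ler_pM ?normc_ge0.
by rewrite mulrC ler_pM ?normc_ge0.
Qed.

Lemma unif_poly_cst c : unif_poly x D (fun=> c).
Proof. exact/polyfun_unif_poly/polyfun_cst. Qed.

Lemma unif_poly_sum (J : Type) (s : seq J) (P : pred J) (F : J -> X -> C) :
  (forall j, unif_poly x D (F j)) ->
  unif_poly x D (fun t => \sum_(j <- s | P j) F j t).
Proof.
move=> uF; elim: s => [|j s IH].
  by apply: unif_poly_eq (unif_poly_cst 0) => t _; rewrite big_nil.
have [Pj|Pj] := boolP (P j).
  by apply: unif_poly_eq (unif_poly_add (uF j) IH) => t _; rewrite big_cons Pj.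
by apply: unif_poly_eq IH => t _; rewrite big_cons (negbTE Pj).
Qed.

Lemma unif_poly_exp f m : unif_poly x D f -> unif_poly x D (fun t => f t ^+ m).
Proof.
move=> uf; elim: m => [|m IH].
  by apply: unif_poly_eq (unif_poly_cst 1) => t _; rewrite expr0.
by apply: unif_poly_eq (unif_poly_mul uf IH) => t _; rewrite exprS.
Qed.

Lemma unif_poly_lim f :
  (forall e : R, 0 < e -> exists2 g, unif_poly x D g &
     forall t, D t -> normc (f t - g t) <= e) -> unif_poly x D f.
Proof.
move=> h e e0; have e2 : 0 < e / 2 by rewrite divr_gt0.
have [g ug hg] := h _ e2; have [p pp hp] := ug _ e2.
exists p => // t Dt; apply: le_trans (normc_dist3 _ (g t) _) _.
by rewrite [e]splitr lerD ?hg ?hp.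
Qed.

(** Truncated geometric series: since [1 + g] has modulus at least 1/2, the remainder
    [(- g t) ^+ N / (1 + g t)] is at most 2 * 2^-N. *)
Lemma unif_poly_inv g : unif_poly x D g ->
  (forall t, D t -> normc (g t) <= 2^-1) -> unif_poly x D (fun t => (1 + g t)^-1).
Proof.
move=> ug g2; apply: unif_poly_lim => e e0.
have [N hN] : exists N, 2 * (2^-1) ^+ N <= e :> R.
  have /cvgrPdist_lt /(_ (e / 2)) := @cvg_expr R 2^-1 ltac:(by rewrite ger0_norm ?invr_ge0// invf_lt1 ?ltr1n).
  case=> [|N _ hN]; first by rewrite divr_gt0.
  exists N; have := hN N (leqnn N); rewrite /= sub0r normrN ger0_norm ?exprn_ge0 ?invr_ge0//.
  by rewrite ltr_pdivlMr// mulrC => /ltW.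
exists (fun t => \sum_(m < N) (- g t) ^+ m).
  apply: unif_poly_sum => m; apply: unif_poly_exp.
  apply: unif_poly_eq (unif_poly_mul (unif_poly_cst (-1)) ug) => t _.
  by rewrite mulN1r.
move=> t Dt; have gt := g2 _ Dt.
have n1 : 2^-1 <= normc (1 + g t).
  have := normc_lerB 1 (- g t); rewrite normcNE normc1 opprK.
  by apply: le_trans; rewrite lerBrDl; move: gt; lra.
have nz : 1 + g t != 0.
  by rewrite -normc_gt0; apply: lt_le_trans n1; rewrite invr_gt0.
have -> : (1 + g t)^-1 - \sum_(m < N) (- g t) ^+ m = (- g t) ^+ N / (1 + g t).
  apply: (mulfI nz); rewrite mulrBr mulfV// mulrCA divff// mulr1.
  have := subrX1 (- g t) N; rewrite -opprB -[X in _ = X * _]opprB mulNr => /oppr_inj.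
  by rewrite opprK => <-; rewrite opprB addrC subrK.
rewrite normcM normcV normcX normcNE; apply: le_trans hN; rewrite mulrC.
rewrite ler_pM ?invr_ge0 ?exprn_ge0 ?normc_ge0//.
  by rewrite -[leRHS]invrK lef_pV2 ?posrE ?invr_gt0// (lt_le_trans _ n1)// invr_gt0.
by rewrite lerXn2r ?nnegrE ?invr_ge0 ?normc_ge0.
Qed.

End Generic.

Lemma unif_poly_sub (X I : Type) (x : I -> X -> C) (D D' : set X) f :
  D `<=` D' -> unif_poly x D' f -> unif_poly x D f.
Proof.
move=> DD uf e /uf[p pp hp]; exists p => // t Dt; exact/hp/DD.
Qed.

Lemma unif_poly_comp (X I Y J : Type) (x : I -> X -> C) (y : J -> Y -> C)
    (D : set X) (E : set Y) (phi : X -> Y) f :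
  (forall i, bounded_fun_on D (x i)) ->
  (forall j, unif_poly x D (y j \o phi)) ->
  (forall t, D t -> E (phi t)) ->
  unif_poly y E f -> unif_poly x D (f \o phi).
Proof.
move=> xb uphi DE uf; apply: unif_poly_lim => e /uf[p pp hp].
exists (p \o phi); last by move=> t Dt; apply: hp; exact: DE.
elim: pp => [c|j|g h _ ug _ uh|g h _ ug _ uh].
- exact: unif_poly_cst.
- exact: uphi.
- exact: unif_poly_add ug uh.
- exact: unif_poly_mul ug uh.
Qed.

End PolynomialFunctions.

(** * Cauchy estimates and analyticity *)

Section CauchyEstimate.
Variables (R : realType) (n : nat).
Local Notation C := R[i].

Lemma primitive_root_exists N : (0 < N)%N -> exists z : C, N.-primitive_root z.
Proof.
move=> N0; have [r] := closed_field_poly_normal ('X^N - 1 : {poly C}).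
rewrite (monicP _) ?monicXnsubC// scale1r => E.
suff /hasP[z _ hz] : has N.-primitive_root r by exists z.
apply: has_prim_root => //.
- by apply/allP => z; rewrite -root_prod_XsubC -E.
- by rewrite -separable_prod_XsubC -E separable_Xn_sub_1// pnatr_eq0 -lt0n.
- by rewrite -ltnS -(size_prod_XsubC r id) -E size_XnsubC.
Qed.

Lemma normc_unity_root N (z : C) : (0 < N)%N -> z ^+ N = 1 -> normc z = 1.
Proof.
move=> N0 zN; apply/eqP.
by rewrite -(@pexpr_eq1 _ _ N) ?normc_ge0// -normcX zN normc1.
Qed.

Lemma sum_unity_root N (z : C) : z ^+ N = 1 ->
  \sum_(j < N) z ^+ j = if z == 1 then N%:R else 0.
Proof.
move=> zN; case: eqP => [->|/eqP z1].
  under eq_bigr do rewrite expr1n.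
  by rewrite sumr_const card_ord.
have : (z - 1) * \sum_(j < N) z ^+ j = 0 by rewrite -subrX1 zN subrr.
by move/eqP; rewrite mulf_eq0 subr_eq0 (negbTE z1) => /eqP.
Qed.

Definition coordf (i : 'I_n) (h : 'rV[C]_n) : C := h 0 i.

Definition monom (h : 'rV[C]_n) (al : 'I_n -> nat) : C := \prod_i h 0 i ^+ al i.

Definition monom_sum (s : seq (C * {ffun 'I_n -> nat})) (h : 'rV[C]_n) : C :=
  \sum_(m <- s) m.1 * monom h m.2.

Lemma polyfun_monom_sum p : polyfun coordf p -> exists s, p = monom_sum s.
Proof.
elim=> [c|i|f g _ [s ->] _ [s' ->]|f g _ [s ->] _ [s' ->]].
- exists [:: (c, [ffun=> 0%N])]; apply/funext => h.
  rewrite /monom_sum big_seq1 /monom big1 ?mulr1// => i _.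
  by rewrite ffunE expr0.
- exists [:: (1, [ffun j => (j == i) : nat])]; apply/funext => h.
  rewrite /monom_sum big_seq1 /monom mul1r (bigD1 i)//= ffunE eqxx expr1.
  by rewrite big1 ?mulr1// => j ji; rewrite ffunE (negbTE ji) expr0.
- by exists (s ++ s'); apply/funext => h; rewrite /monom_sum big_cat.
- pose mm (a b : C * {ffun 'I_n -> nat}) : C * {ffun 'I_n -> nat} :=
    (a.1 * b.1, [ffun i => (a.2 i + b.2 i)%N]).
  exists [seq mm a b | a <- s, b <- s'].
  apply/funext => h; rewrite /monom_sum big_allpairs_dep /= big_distrlr /=.
  apply: eq_bigr => a _; apply: eq_bigr => b _.
  rewrite mulrACA; congr (_ * _); rewrite /monom -big_split /=.
  by apply: eq_bigr => i _; rewrite ffunE exprD.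
Qed.

(** A list may repeat an exponent, so the coefficient collects all its occurrences. *)
Definition mcoef (s : seq (C * {ffun 'I_n -> nat})) (al : 'I_n -> nat) : C :=
  \sum_(m <- s | m.2 == finfun al) m.1.

Definition mdeg_lt N (s : seq (C * {ffun 'I_n -> nat})) :=
  forall m, m \in s -> forall i, (m.2 i < N)%N.

Lemma mdeg_ltP s : exists N, mdeg_lt N s.
Proof.
elim: s => [|m s [N hN]]; first by exists 0%N.
exists (N + (\max_i m.2 i).+1)%N => m'; rewrite in_cons => /orP[/eqP-> i|/hN h i].
  by rewrite addnS ltnS; apply: leq_trans (leq_bigmax i) (leq_addl _ _).
exact: leq_trans (h i) (leq_addr _ _).
Qed.

Lemma mdeg_ltW N N' s : (N <= N')%N -> mdeg_lt N s -> mdeg_lt N' s.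
Proof. by move=> NN h m ms i; exact: leq_trans (h m ms i) NN. Qed.

(** Passage from lists of monomials to the box sums of [analytic_at]: a box larger than all
    exponents sees the whole polynomial. *)
Lemma monom_sum_box s N h : mdeg_lt N s ->
  monom_sum s h = \sum_(al : {ffun 'I_n -> 'I_N}) monomial_term (mcoef s) h al.
Proof.
move=> sN; pose nat_of (al : {ffun 'I_n -> 'I_N}) : {ffun 'I_n -> nat} :=
  [ffun i => al i : nat].
transitivity (\sum_(al : {ffun 'I_n -> 'I_N})
    \sum_(m <- s) (if m.2 == nat_of al then m.1 * monom h m.2 else 0)).
  rewrite exchange_big /= /monom_sum big_seq [RHS]big_seq.
  apply: eq_bigr => m ms; rewrite -big_mkcond /=.
  pose a0 : {ffun 'I_n -> 'I_N} := [ffun i => Ordinal (sN m ms i)].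
  rewrite (big_pred1 a0)// => al; apply/eqP/eqP => [E|->].
    by apply/ffunP => i; rewrite ffunE; apply/val_inj; rewrite /= E ffunE.
  by apply/ffunP => i; rewrite !ffunE.
apply: eq_bigr => al _; rewrite -big_mkcond /= /monomial_term /mcoef mulr_suml.
have -> : [ffun i => al i : nat] = nat_of al by [].
apply: eq_bigr => m /eqP->; congr (_ * _).
by apply: eq_bigr => i _; rewrite ffunE.
Qed.

(* Averaging [p (rho * z^j)] against the characters [z^(- al . j)] of the group
   of [N]-th roots of unity isolates the coefficient of [al] as soon as [N]
   exceeds all exponents. *)
Lemma cauchy_estimate s (rho M : R) (al : 'I_n -> nat) : 0 < rho ->
  (forall h : 'rV[C]_n, (forall i, normc (h 0 i) <= rho) ->
     normc (monom_sum s h) <= M) ->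
  normc (mcoef s al) * \prod_i rho ^+ al i <= M.
Proof.
move=> rho0 hM; have [N1 sN1] := mdeg_ltP s.
pose N := (N1 + (\max_i al i).+1)%N.
have sN : mdeg_lt N s by apply: mdeg_ltW sN1; rewrite leq_addr.
have alN i : (al i < N)%N.
  by rewrite /N addnS ltnS; apply: leq_trans (leq_bigmax i) (leq_addl _ _).
have N0 : (0 < N)%N by rewrite /N addnS.
have [z zprim] := primitive_root_exists N0.
have zN := prim_expr_order zprim.
have nz := normc_unity_root N0 zN.
have z0 : z != 0 by rewrite -normc_gt0 nz.
pose pt (j : {ffun 'I_n -> 'I_N}) : 'rV[C]_n := \row_i (rho%:C * z ^+ j i).
pose ch (j : {ffun 'I_n -> 'I_N}) : C := \prod_i (z ^- al i) ^+ j i.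
have key : \sum_j monom_sum s (pt j) * ch j =
    (N ^ n)%:R * (mcoef s al * \prod_i (rho%:C ^+ al i)).
  transitivity (\sum_(m <- s) m.1 * \prod_i (rho%:C ^+ m.2 i) *
      (if m.2 == finfun al then (N ^ n)%:R else 0)).
    under eq_bigr do rewrite /monom_sum mulr_suml.
    rewrite exchange_big /= big_seq [RHS]big_seq; apply: eq_bigr => m ms.
    transitivity (m.1 * \prod_i (rho%:C ^+ m.2 i) *
        \sum_(j : {ffun 'I_n -> 'I_N}) \prod_i (z ^+ m.2 i * z ^- al i) ^+ j i).
      rewrite mulr_sumr; apply: eq_bigr => j _.
      rewrite /monom /ch -!mulrA; congr (_ * _); rewrite -!big_split /=.
      apply: eq_bigr => i _; rewrite mxE exprMn [in RHS]exprMn.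
      by rewrite -!(exprM z) [(j i * m.2 i)%N]mulnC mulrA.
    congr (_ * _).
    rewrite -(bigA_distr_bigA (fun i (j : 'I_N) => (z ^+ m.2 i * z ^- al i) ^+ j)) /=.
    have E i : \sum_(j < N) (z ^+ m.2 i * z ^- al i) ^+ j =
        if m.2 i == al i then N%:R else 0.
      rewrite sum_unity_root; last first.
        by rewrite exprMn -exprVn -!exprM ![(_ * N)%N]mulnC !exprM exprVn zN invr1 !expr1n mulr1.
      congr (if _ then _ else _); apply/eqP/eqP => [|->]; last first.
        by rewrite mulfV// expf_neq0.
      move/(congr1 (fun t => t * z ^+ al i)); rewrite mul1r mulfVK ?expf_neq0//.
      move/eqP; rewrite (eq_prim_root_expr zprim) => /eqP.
      by rewrite !modn_small//; exact: sN.
    under eq_bigr do rewrite E.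
    case: eqP => [->|ne].
      under eq_bigr do rewrite ffunE eqxx.
      by rewrite prodr_const card_ord natrX.
    have [i hi] : exists i, m.2 i != al i.
      apply/not_existsP => h; apply: ne; apply/ffunP => i; rewrite ffunE.
      by apply/eqP/negPn/negP; exact: h.
    by rewrite (bigD1 i)//= (negbTE hi) mul0r.
  rewrite mulrC /mcoef !mulr_suml [RHS]big_mkcond /=.
  apply: eq_bigr => m _; case: eqP => [->|_]; last by rewrite mulr0.
  by congr (_ * _ * _); apply: eq_bigr => i _; rewrite ffunE.
have NN0 : 0 < (N ^ n)%:R :> R by rewrite ltr0n expn_gt0 N0.
rewrite -(ler_pM2l NN0).
have -> : (N ^ n)%:R * (normc (mcoef s al) * \prod_i rho ^+ al i) =
    normc (\sum_j monom_sum s (pt j) * ch j).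
  rewrite key normcM normc_nat normcM normc_prod; congr (_ * (_ * _)).
  by apply: eq_bigr => i _; rewrite normcX normc_real ger0_norm// ltW.
apply: le_trans (normc_sum _ _ _) _.
apply: (@le_trans _ _ (\sum_(j : {ffun 'I_n -> 'I_N}) M)); last first.
  by rewrite sumr_const card_ffun !card_ord mulr_natl.
apply: ler_sum => j _; rewrite normcM.
have -> : normc (ch j) = 1.
  rewrite normc_prod big1// => i _.
  by rewrite normcX normcV normcX nz expr1n invr1 expr1n.
rewrite mulr1; apply: hM => i; rewrite mxE normcM normcX nz expr1n mulr1.
by rewrite normc_real ger0_norm// ltW.
Qed.

End CauchyEstimate.

(** * Power series versus uniform limits of polynomials *)

Section AnalyticUnifPoly.
Variables (R : realType) (n : nat).
Local Notation C := R[i].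

Definition cpolydisc (r : R) : set 'rV[C]_n := [set h | forall i, normc (h 0 i) <= r].

Lemma coordf_bounded r i : bounded_fun_on (cpolydisc r) (@coordf R n i).
Proof. by exists r => h; exact. Qed.

Lemma polyfun_ext (X I : Type) (x : I -> X -> C) f g : (forall t, f t = g t) ->
  polyfun x f -> polyfun x g.
Proof. by move=> /funext->. Qed.

Lemma polyfun_sum (X I : Type) (x : I -> X -> C) (J : Type) (s : seq J)
    (F : J -> X -> C) : (forall j, polyfun x (F j)) ->
  polyfun x (fun t => \sum_(j <- s) F j t).
Proof.
move=> pF; elim: s => [|j s IH].
  by apply: polyfun_ext (polyfun_cst x 0) => t; rewrite big_nil.
by apply: polyfun_ext (polyfun_add (pF j) IH) => t; rewrite big_cons.
Qed.

Lemma polyfun_prod (X I : Type) (x : I -> X -> C) (J : Type) (s : seq J)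
    (F : J -> X -> C) : (forall j, polyfun x (F j)) ->
  polyfun x (fun t => \prod_(j <- s) F j t).
Proof.
move=> pF; elim: s => [|j s IH].
  by apply: polyfun_ext (polyfun_cst x 1) => t; rewrite big_nil.
by apply: polyfun_ext (polyfun_mul (pF j) IH) => t; rewrite big_cons.
Qed.

Lemma polyfun_exp (X I : Type) (x : I -> X -> C) f m : polyfun x f ->
  polyfun x (fun t => f t ^+ m).
Proof.
move=> pf; elim: m => [|m IH].
  by apply: polyfun_ext (polyfun_cst x 1) => t; rewrite expr0.
by apply: polyfun_ext (polyfun_mul pf IH) => t; rewrite exprS.
Qed.

Lemma monomial_polyfun (c : C) (al : 'I_n -> nat) :
  polyfun (@coordf R n) (fun h => c * \prod_i h 0 i ^+ al i).
Proof.
apply: polyfun_mul; first exact: polyfun_cst.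
by apply: polyfun_prod => i; apply: polyfun_exp; exact: (polyfun_coord _ i).
Qed.

Lemma geometric_half_le N : \sum_(j < N) (2^-1 : R) ^+ j <= 2.
Proof.
have := subrX1 (2^-1 : R) N; have : 0 <= (2^-1 : R) ^+ N by rewrite exprn_ge0 ?invr_ge0.
set u := _ ^+ N; set s := \sum_(_ < _) _; have -> : (2^-1 : R) - 1 = - 2^-1 by field.
by lra.
Qed.

(** Halving the radius gains a factor 2^-|al| on each monomial, and the sum of these factors over a
    box is a product of [n] geometric sums, each at most 2. *)
Lemma box_sum_le (c : ('I_n -> nat) -> C) (r A : R) h N : 0 < r ->
  (forall al, normc (c al) * \prod_i r ^+ al i <= A) ->
  cpolydisc (r / 2) h ->
  \sum_(al : {ffun 'I_n -> 'I_N}) normc (monomial_term c h al) <= A * 2 ^+ n.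
Proof.
move=> r0 cA hr; have A0 : 0 <= A.
  by apply: le_trans (cA (fun=> 0%N)); rewrite mulr_ge0 ?normc_ge0 ?prodr_ge0.
apply: (@le_trans _ _ (\sum_(al : {ffun 'I_n -> 'I_N}) A * \prod_i (2^-1) ^+ al i)).
  apply: ler_sum => al _; rewrite /monomial_term normcM normc_prod.
  apply: (@le_trans _ _ (normc (c (fun i => al i)) * \prod_i (r / 2) ^+ al i)).
    rewrite ler_wpM2l ?normc_ge0//; apply: ler_prod => i _.
    by rewrite normc_ge0 normcX lerXn2r ?nnegrE ?normc_ge0 ?divr_ge0 ?(ltW r0) ?hr.
  under eq_bigr do rewrite exprMn.
  rewrite big_split /= mulrA; apply: ler_wpM2r; last exact: cA.
  by apply: prodr_ge0 => i _; rewrite exprn_ge0 ?invr_ge0.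
rewrite -mulr_sumr ler_wpM2l//.
rewrite -(bigA_distr_bigA (fun (i : 'I_n) (j : 'I_N) => (2^-1 : R) ^+ j)) /=.
have g0 : 0 <= \sum_(j < N) (2^-1 : R) ^+ j.
  by rewrite sumr_ge0// => i _; rewrite exprn_ge0 ?invr_ge0.
by rewrite prodr_const card_ord lerXn2r ?nnegrE ?geometric_half_le.
Qed.

Definition msub (s s' : seq (C * {ffun 'I_n -> nat})) :=
  s ++ [seq ((- m.1 : C), m.2) | m <- s'].

Lemma monom_sum_msub s s' h : monom_sum (msub s s') h = monom_sum s h - monom_sum s' h.
Proof.
rewrite /monom_sum big_cat big_map /=; congr (_ + _).
by rewrite -sumrN; apply: eq_bigr => m _; rewrite mulNr.
Qed.

Lemma mcoef_msub s s' al : mcoef (msub s s') al = mcoef s al - mcoef s' al.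
Proof. by rewrite /mcoef big_cat big_map /= -sumrN. Qed.

(** Cauchy's estimate, applied to differences of approximating polynomials, makes each coefficient a
    Cauchy sequence with a rate that is uniform after weighting by powers of [r]. The limits are the
    coefficients of the series, which converges on the half polydisc by [box_sum_le]. *)
Lemma unif_poly_analytic (f : 'rV[C]_n -> C) z r : 0 < r ->
  unif_poly (@coordf R n) (cpolydisc r) (fun h => f (z + h)) -> analytic_at f z.
Proof.
move=> r0 uf.
have /choice[S hS] : forall m : nat, exists s, forall h, cpolydisc r h ->
    normc (f (z + h) - monom_sum s h) <= m.+1%:R^-1.
  move=> m; have [|p /polyfun_monom_sum[s ->] hp] := uf (m.+1%:R^-1).
    by rewrite invr_gt0.
  by exists s.
have ep (m : nat) : 0 < m.+1%:R^-1 :> R by rewrite invr_gt0.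
pose q (al : 'I_n -> nat) : R := \prod_i r ^+ al i.
have q0 al : 0 < q al by rewrite prodr_gt0// => i _; rewrite exprn_gt0.
have dS m m' al : (m <= m')%N ->
    normc (mcoef (S m') al - mcoef (S m) al) * q al <= 2 * m.+1%:R^-1.
  move=> mm; rewrite -mcoef_msub; apply: cauchy_estimate r0 _ => h hr.
  rewrite monom_sum_msub; apply: le_trans (normc_dist3 _ (f (z + h)) _) _.
  rewrite mulr2n mulrDl mul1r lerD ?hS//.
  by rewrite normcB; apply: le_trans (hS _ _ hr) _; rewrite lef_pV2 ?posrE ?ler_nat.
have /choice[a ha] : forall al, exists l, forall m,
    normc (l - mcoef (S m) al) * q al <= 2 * m.+1%:R^-1.
  move=> al; have [|l hl] := @complex_lim R (fun m => mcoef (S m) al).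
    move=> e e0; have eq0 : 0 < e * q al / 4 by rewrite divr_gt0 ?mulr_gt0.
    have [N _ hN] := near_infty_natSinv_lt (PosNum eq0).
    exists N => p m pN mN; have := hN N (leqnn N) => /= hNN.
    rewrite -(ltr_pM2r (q0 al)).
    apply: le_lt_trans (_ : 2 * N.+1%:R^-1 + 2 * N.+1%:R^-1 < _); last first.
      by move: hNN; move: (_^-1) (e * q al) => u v; lra.
    apply: le_trans (lerD (dS _ _ al pN) (dS _ _ al mN)).
    rewrite -mulrDl ler_wpM2r ?(ltW (q0 _))//.
    by rewrite [X in _ <= _ + X]normcB; exact: normc_dist3.
  exists l => m; apply/ler_addgt0Pr => e e0.
  have [|N hN] := hl (e / q al); first by rewrite divr_gt0.
  have := hN (maxn N m) (leq_maxl _ _) => h1.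
  have h2 := dS m (maxn N m) al (leq_maxr _ _).
  apply: le_trans (_ : normc (mcoef (S (maxn N m)) al - l) * q al +
     normc (mcoef (S (maxn N m)) al - mcoef (S m) al) * q al <= _).
    by rewrite -mulrDl ler_wpM2r ?(ltW (q0 _))// [X in _ <= X + _]normcB normc_dist3.
  by rewrite addrC lerD//; rewrite -ler_pdivlMr// ltW.
have [B hB] : exists B, forall al, normc (a al) * q al <= B.
  have [B0 hB0] := unif_poly_bounded (@coordf_bounded r) uf.
  exists (2 + (B0 + 1)) => al.
  rewrite -[a al](subrK (mcoef (S 0%N) al)).
  apply: le_trans (ler_wpM2r (ltW (q0 al)) (normcD _ _)) _; rewrite mulrDl lerD//.
    by apply: le_trans (ha al 0%N) _; rewrite invr1 mulr1.
  apply: cauchy_estimate r0 _ => h hr.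
  rewrite -[monom_sum _ _](subrK (f (z + h))).
  apply: le_trans (normcD _ _) _; rewrite addrC lerD ?hB0//.
  by rewrite normcB; apply: le_trans (hS 0%N _ hr) _; rewrite invr1.
exists a, (r / 2)%:C; split; first by rewrite ltcR divr_gt0.
move=> h hr.
have {}hr : cpolydisc (r / 2) h.
  by move=> i; have := hr i; rewrite normrcE ltcR => /ltW.
split.
  exists (B * 2 ^+ n)%:C => N.
  under eq_bigr do rewrite normrcE.
  by rewrite -rmorph_sum lecR; exact: box_sum_le r0 hB hr.
apply/cvgrPdist_lt => e /gt0_complexP[d d0 ->].
(* The term 1 pays for replacing [f] by [S m], the term 2 * 2^n for replacing the coefficients of
   [S m] by their limits. *)
pose K : R := 1 + 2 * 2 ^+ n.
have K0 : 0 < K by rewrite ltr_wpDr// mulr_ge0// exprn_ge0.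
have dK : 0 < d / K by rewrite divr_gt0.
have [m _ hm] := near_infty_natSinv_lt (PosNum dK).
have {hm} := hm m (leqnn m); rewrite /= ltr_pdivlMr// => hm.
have [N0 hN0] := mdeg_ltP (S m).
exists N0 => // N /= N0N; rewrite normrcE ltcR; apply: le_lt_trans hm.
apply: le_trans (normc_dist3 _ (monom_sum (S m) h) _) _.
rewrite /K mulrDr mulr1; apply: lerD.
  by apply: hS => i; apply: le_trans (hr i) _; rewrite ler_pdivrMr// ler_peMr ?(ltW r0)// ler1n.
rewrite (@monom_sum_box _ _ _ N); last exact: mdeg_ltW hN0.
rewrite mulrA [_ * 2]mulrC.
pose c al := mcoef (S m) al - a al.
apply: le_trans (@box_sum_le c r _ h N r0 _ hr); last first.
  by move=> al; rewrite /c normcB; exact: ha.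
rewrite -sumrB; apply: le_trans (normc_sum _ _ _) _.
by apply: ler_sum => al _; rewrite /monomial_term /c mulrBl.
Qed.

(** Boxes of different sides are different index types; [F] is taken on functions to [nat] so that
    their sums can be compared. *)
Lemma box_widen (T : nmodType) (F : ('I_n -> nat) -> T) N N' : (N <= N')%N ->
  \sum_(al : {ffun 'I_n -> 'I_N}) F (fun i => al i) =
  \sum_(al : {ffun 'I_n -> 'I_N'} | [forall i, (al i < N)%N]) F (fun i => al i).
Proof.
(* The side 0 is treated apart because [inord] needs an inhabited ordinal; that box is empty unless
   [n] is 0. *)
move=> NN; case: N NN => [|N] NN.
  have [n0|n0] := posnP n.
    subst n; have F0 (f : 'I_0 -> nat) : F f = F (fun=> 0%N).
      by congr F; apply/funext => -[].
    under eq_bigr do rewrite F0.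
    under [RHS]eq_bigr do rewrite F0.
    rewrite !sumr_const; congr (_ *+ _).
    transitivity #|{ffun 'I_0 -> 'I_N'}|; first by rewrite !card_ffun !card_ord !expn0.
    by apply: eq_card => al; rewrite [LHS]inE; apply/esym; rewrite unfold_in; apply/forallP => i; case: (i).
  rewrite [LHS]big1; last by move=> al; case: (al (Ordinal n0)).
  by rewrite big1// => al /forallP/(_ (Ordinal n0)).
rewrite [RHS](reindex_onto (fun al : {ffun 'I_n -> 'I_N.+1} =>
    [ffun i => widen_ord NN (al i)])
  (fun al : {ffun 'I_n -> 'I_N'} => [ffun i => inord (al i)])) /=; last first.
  move=> al /forallP h; apply/ffunP => i; rewrite !ffunE; apply/val_inj => /=.
  by rewrite inordK.
apply: eq_big => [al|al _].
  apply/esym/andP; split; first by apply/forallP => i; rewrite ffunE /=.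
  apply/eqP/ffunP => i; rewrite !ffunE; apply/val_inj => /=.
  by rewrite inordK.
by congr F; apply/funext => i; rewrite ffunE.
Qed.

(** The partial sums themselves are the polynomials. Their convergence is uniform because all tails
    are dominated by those of the absolute series at one point. *)
Lemma analytic_unif_poly (f : 'rV[C]_n -> C) z : analytic_at f z ->
  exists2 r : R, 0 < r & unif_poly (@coordf R n) (cpolydisc r) (fun h => f (z + h)).
Proof.
move=> [a [r' [/gt0_complexP[r r0 ->] fa]]].
have r20 : 0 < r / 2 by rewrite divr_gt0.
have r2r : r / 2 < r by rewrite gtr_pMr ?invf_lt1 ?ltr1n.
exists (r / 2) => //.
pose A N : R := \sum_(al : {ffun 'I_n -> 'I_N}) normc (a (fun i => al i)) * \prod_i (r / 2) ^+ al i.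
have [B hB] : exists B, forall N, A N <= B.
  (* The point whose coordinates all equal r/2 dominates the whole polydisc of radius r/2. *)
  have [|[B hB] _] := fa (const_mx (r / 2)%:C).
    by move=> i; rewrite mxE normrcE ltcR normc_real gtr0_norm.
  exists (complex.Re B) => N; have := hB N.
  under eq_bigr do rewrite normrcE.
  rewrite -rmorph_sum lecE /= => /andP[_]; apply: le_trans.
  apply: ler_sum => al _; rewrite /monomial_term normcM normc_prod.
  rewrite ler_wpM2l ?normc_ge0//; apply: ler_prod => i _; rewrite exprn_ge0 ?(ltW r20)//.
  by rewrite /= mxE normcX normc_real gtr0_norm.
pose F (al : 'I_n -> nat) := normc (a al) * \prod_i (r / 2) ^+ al i.
have F0 al : 0 <= F al.
  by rewrite mulr_ge0 ?normc_ge0// prodr_ge0// => i _; rewrite exprn_ge0 ?(ltW r20).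
have tail N N' : (N <= N')%N -> A N' = A N +
   \sum_(al : {ffun 'I_n -> 'I_N'} | ~~ [forall i, (al i < N)%N]) F (fun i => al i).
  by move=> NN; rewrite /A (box_widen F NN) [LHS](bigID (fun al : {ffun 'I_n -> 'I_N'} => [forall i, (al i < N)%N])).
have Acauchy (e : R) : 0 < e -> exists N, forall N', (N <= N')%N -> A N' - A N <= e.
  move=> e0; have hs : has_sup (range A).
    by split; [exists (A 0%N), 0%N | exists B => _ [N _ <-]].
  have [_ [N _ <-] hN] := sup_adherent e0 hs.
  exists N => N' _; have : A N' <= sup (range A) by apply: ub_le_sup; [exact: hs.2|exists N'].
  by move: hN; lra.
move=> e e0; have e2 : 0 < e / 2 by rewrite divr_gt0.
have [N hN] := Acauchy _ e2.
exists (fun h => \sum_(al : {ffun 'I_n -> 'I_N}) monomial_term a h al).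
  by apply: polyfun_sum => al; exact: monomial_polyfun.
move=> h hr; have [|_ /cvgrPdist_lt cf] := fa h.
  by move=> i; rewrite normrcE ltcR; apply: le_lt_trans (hr i) _.
have [|N1 _ hN1] := cf (e / 2)%:C; first by rewrite ltcR.
(* [N1] depends on [h], but it only serves to reach the limit: the distance from box [N] to box
   [maxn N1 N] is bounded by the tail of [A], uniformly in [h]. *)
have := hN1 (maxn N1 N) (leq_maxl _ _); rewrite /= normrcE ltcR => h1.
set S1 := \sum_(_ | _) _ in h1.
apply: le_trans (normc_dist3 _ S1 _) _; rewrite [e]splitr lerD ?(ltW h1)//.
apply: le_trans (hN (maxn N1 N) (leq_maxr _ _)).
rewrite (tail _ _ (leq_maxr N1 N)) [leRHS]addrC addKr.
rewrite (box_widen (fun al => a al * \prod_i h 0 i ^+ al i) (leq_maxr N1 N)).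
rewrite /S1 (bigID (fun al : {ffun 'I_n -> 'I__} => [forall i, (al i < N)%N])) /=.
rewrite [X in normc X <= _]addrC addKr; apply: le_trans (normc_sum _ _ _) _.
apply: ler_sum => al _; rewrite /monomial_term normcM normc_prod.
rewrite ler_wpM2l ?normc_ge0//; apply: ler_prod => i _.
by rewrite normc_ge0 normcX lerXn2r ?nnegrE ?normc_ge0 ?(ltW r20) ?hr.
Qed.

End AnalyticUnifPoly.

(** * The maximum principle *)

Section ComplexCompactness.
Variables (R : realType).
Local Notation C := R[i].

(** Makes a locally available radius uniform. With [Q r z] saying that a modulus times [r] is at
    most 1, it also yields bounds, [r] being the inverse of the bound. *)
Lemma compact_uniform_radius (T : topologicalType) (K : set T) (Q : R -> T -> Prop) :
  compact K -> (forall r r' z, r' <= r -> Q r z -> Q r' z) ->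
  (forall z, K z -> exists2 r, 0 < r & \forall z' \near z, Q r z') ->
  exists2 r, 0 < r & forall z, K z -> Q r z.
Proof.
move=> /compact_near_coveringP cK Qmono Qloc.
have := cK R (0 : R)^'+ (fun r z => Q r z) _.
move=> H; have {H}/= : \forall r \near (0 : R)^'+, K `<=` Q r.
  apply: H => z /Qloc[r r0 hr].
  exists ([set z' | Q r z'], [set t | 0 < t < r]) => /=.
    split=> //; near=> t; apply/andP; split; near: t; first exact: nbhs_right_gt.
    exact: nbhs_right_lt.
  by move=> [z' t] /= [h /andP[_ tr]]; apply: Qmono (ltW tr) h.
move=> H; have /filter_ex[r [r0 hr]] :
    \forall r \near (0 : R)^'+, 0 < r /\ K `<=` Q r.
  by near=> r; split; near: r => //; exact: nbhs_right_gt.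
by exists r.
Unshelve. all: by end_near. Qed.

Lemma closed_complexP (A : set C) :
  (forall z, ~ A z -> exists2 r : R, 0 < r & forall y, normc (y - z) < r -> ~ A y) ->
  closed A.
Proof.
move=> h; rewrite -openC openE => z /= /h[r r0 hr].
by apply/nbhs_complexP; exists r.
Qed.

Lemma compact_square (B : R) :
  compact [set z : C | `|complex.Re z| <= B /\ `|complex.Im z| <= B].
Proof.
pose f (p : R * R) : C := p.1 +i* p.2.
have -> : [set z : C | `|complex.Re z| <= B /\ `|complex.Im z| <= B] =
    f @` (`[- B, B]%classic `*` `[- B, B]%classic).
  apply/seteqP; split=> [[a b] /= [ha hb]|z [[a b] [/= ha hb] <-]].
    by exists (a, b) => //; split; rewrite /= in_itv /= -ler_norml.
  by move: ha hb; rewrite !in_itv /= -!ler_norml.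
apply: continuous_compact; last by apply: compact_setX; exact: segment_compact.
apply: continuous_subspaceT => -[a b] A /nbhs_complexP[r r0 hr].
have r2 : 0 < r / 2 by rewrite divr_gt0.
apply/nbhs_ballP; exists (r / 2) => // -[a' b'] [/= ha hb]; apply: hr.
apply: le_lt_trans (normc_le_ReIm _) _; rewrite /= [r]splitr.
by apply: ltrD; rewrite distrC.
Qed.

Lemma compact_disc (B : R) : compact [set z : C | normc z <= B].
Proof.
apply: subclosed_compact (@compact_square B) _.
  apply: closed_complexP => z /negP; rewrite -ltNge => Bz.
  exists (normc z - B); first by rewrite subr_gt0.
  move=> y yz /=; apply/negP; rewrite -ltNge.
  by have := normc_lerB z y; rewrite normcB; move: yz; lra.
by move=> z /= zB; split; apply: le_trans zB; [exact: normRe_le|exact: normIm_le].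
Qed.

Lemma compact_polydisc n (B : R) :
  compact [set z : 'rV[C]_n | forall i, normc (z 0 i) <= B].
Proof. exact: (rV_compact (fun=> @compact_disc B)). Qed.

Lemma bounded_rVcomplexP n (U : set 'rV[C]_n) : bounded_set U ->
  exists2 B : R, 0 < B & forall z, U z -> forall i, normc (z 0 i) <= B.
Proof.
move=> [M [Mr hM]]; have /gt0_complexP[B B0 E] : 0 < `|M| + 1.
  by rewrite ltr_wpDl.
exists (B + 1) => [|z Uz i]; first by rewrite addr_gt0.
have := hM B%:C; rewrite -E => /(_ _ z Uz) h.
have {}h : `|z| <= `|M| + 1.
  by apply: h; rewrite (le_lt_trans (real_ler_norm Mr))// ltrDl.
have : ball (0 : 'rV[C]_n) (B + 1)%:C z.
  rewrite -ball_normE /= sub0r normrN; apply: le_lt_trans h _.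
  by rewrite E ltcR ltrDl.
case=> _ /(_ 0 i); rewrite -ball_normE /= mxE sub0r normrN normrcE ltcR.
exact: ltW.
Qed.

Lemma compact_closure_bounded n (U : set 'rV[C]_n) : bounded_set U ->
  compact (closure U).
Proof.
move=> /bounded_rVcomplexP[B _ hB].
have cB := @compact_polydisc n B.
apply: subclosed_compact cB _; first exact: closed_closure.
move=> z zU i /=; rewrite leNgt; apply/negP => Bz.
have [|y [Uy yz]] := zU [set y | cdist_lt (normc (z 0 i) - B) y z].
  by apply/nbhs_rVcomplexP; exists (normc (z 0 i) - B); rewrite ?subr_gt0.
have := normc_lerB (z 0 i) (y 0 i); have := yz i; have := hB _ Uy i.
by rewrite (normcB (y 0 i)); lra.
Qed.

Lemma within_continuous_complexP n (A : set 'rV[C]_n) (f : 'rV[C]_n -> C) :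
  {within A, continuous f} <-> forall z, A z -> forall e : R, 0 < e ->
    exists2 d : R, 0 < d & forall y, A y -> cdist_lt d y z -> normc (f y - f z) < e.
Proof.
rewrite subspace_continuousP; split=> [cf z Az e e0|h z Az].
- have /(cf z Az) : nbhs (f z) [set y | normc (y - f z) < e].
    by apply/nbhs_complexP; exists e.
  move=> /nbhs_rVcomplexP[d d0 hd]; exists d => // y Ay yz.
  exact: hd.
- move=> B /nbhs_complexP[e e0 he].
  have [d d0 hd] := h z Az e e0.
  apply/nbhs_rVcomplexP; exists d => // y yz Ay.
  by apply: he; exact: hd.
Qed.

End ComplexCompactness.

Section MaximumPrinciple.
Variables (R : realType).
Local Notation C := R[i].

Definition cdisc (r : R) : set C := [set s | normc s <= r].
Definition cid1 (_ : unit) (s : C) : C := s.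

Lemma cid1_bounded r i : bounded_fun_on (cdisc r) (cid1 i).
Proof. by exists r => s. Qed.

(** Write h = t k with t = 2 rho / r at most 1 and [k] in the polydisc of radius r/2: every
    nonconstant monomial gains a factor [t], and [box_sum_le] bounds the sum at [k]. The constant
    involves only a bound of [g], so it is common to all approximating polynomials. *)
Lemma unif_poly_lipschitz n (g : 'rV[C]_n -> C) (r : R) : 0 < r ->
  unif_poly (@coordf R n) (cpolydisc r) g ->
  exists L : R, forall rho h, 0 < rho -> rho <= r / 2 -> cpolydisc rho h ->
    normc (g h - g 0) <= L * rho.
Proof.
move=> r0 ug; have [B hB] := unif_poly_bounded (@coordf_bounded R n r) ug.
have zr : cpolydisc r (0 : 'rV[C]_n) by move=> i; rewrite mxE normc0 ltW.
have B0 : 0 <= B by apply: le_trans (hB _ zr); exact: normc_ge0.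
pose L := (B + 1) * 2 ^+ n * (2 / r).
exists L => rho h rho0 rhor hrho; apply/ler_addgt0Pr => e e0.
(* The bound 1 keeps the polynomial below [B + 1]; e/2 is spent twice, at [h] and at 0. *)
pose e' := Num.min 1 (e / 2).
have e'0 : 0 < e' by rewrite lt_min ltr01 divr_gt0.
have [p /polyfun_monom_sum[s ->] hs] := ug _ e'0.
have hrr : cpolydisc r h.
  by move=> i; apply: le_trans (hrho i) _; apply: le_trans rhor _; rewrite ger_pMr ?invf_le1 ?ler1n.
have := hs _ hrr; have := hs _ zr.
rewrite /e' !le_min => /andP[_ h1] /andP[_ h2].
suff : normc (monom_sum s h - monom_sum s 0) <= L * rho.
  move=> h3; have -> : g h - g 0 = (g h - monom_sum s h) +
     (monom_sum s h - monom_sum s 0) + (monom_sum s 0 - g 0) by ring.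
  apply: le_trans (normcD _ _) _; apply: le_trans (lerD (normcD _ _) (lexx _)) _.
  by rewrite (normcB (monom_sum s 0)); move: h1 h2 h3; lra.
have [N sN] := mdeg_ltP s.
rewrite !(monom_sum_box _ sN) -sumrB; apply: le_trans (normc_sum _ _ _) _.
pose t : R := 2 * rho / r.
have t0 : 0 < t by rewrite divr_gt0 ?mulr_gt0.
have t1 : t <= 1 by rewrite ler_pdivrMr// mul1r; move: rhor; lra.
pose k : 'rV[C]_n := \row_i (h 0 i / t%:C).
have tC : t%:C != 0 :> C by rewrite -normc_gt0 normc_real gtr0_norm.
have hk i : h 0 i = t%:C * k 0 i by rewrite mxE mulrC divfK.
have kr : cpolydisc (r / 2) k.
  move=> i; rewrite mxE normcM normcV normc_real gtr0_norm// ler_pdivrMr//.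
  by apply: le_trans (hrho i) _; rewrite /t [leRHS](_ : _ = rho)//; field; rewrite gt_eqF.
apply: (@le_trans _ _ (\sum_(al : {ffun 'I_n -> 'I_N})
    t * normc (monomial_term (mcoef s) k al))); last first.
  rewrite -mulr_sumr (_ : L * rho = t * ((B + 1) * 2 ^+ n)); last first.
    by rewrite /L /t; ring.
  rewrite ler_pM2l//; apply: (@box_sum_le R n (mcoef s) r (B + 1) k N r0 _ kr) => al.
  apply: cauchy_estimate => // y yr.
  rewrite -[monom_sum s y](subrK (g y)); apply: le_trans (normcD _ _) _.
  rewrite addrC lerD ?hB// normcB; apply: le_trans (hs _ yr) _.
  by rewrite ge_min lexx.
apply: ler_sum => al _; rewrite /monomial_term -mulrBr.
have [al0|] := boolP [forall i, (al i == 0 :> nat)].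
  have E (y : 'rV[C]_n) : \prod_i y 0 i ^+ al i = 1.
    by rewrite big1// => i _; rewrite (eqP (forallP al0 i)) expr0.
  by rewrite !E subrr mulr0 normc0 mulr_ge0 ?normc_ge0// ltW.
rewrite negb_forall => /existsP[i ali].
have -> : \prod_i (0 : 'rV[C]_n) 0 i ^+ al i = 0.
  by rewrite (bigD1 i)//= mxE expr0n (negbTE ali) mul0r.
rewrite subr0 !normcM mulrCA ler_wpM2l ?normc_ge0//.
under eq_bigr do rewrite hk exprMn.
rewrite big_split /= normcM ler_wpM2r ?normc_ge0//.
rewrite (bigD1 i)//= normcM -[leRHS]mulr1 ler_pM ?normc_ge0//.
  rewrite normcX normc_real gtr0_norm//; case: (al i : nat) ali => // m _.
  by rewrite exprS ger_pMr// exprn_ile1 ?(ltW t0).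
rewrite normc_prod; apply: prodr_ile1 => j _; rewrite normc_ge0 normcX normc_real gtr0_norm//.
by rewrite exprn_ile1 ?(ltW t0).
Qed.

Lemma unif_poly1_lipschitz (g : C -> C) (r : R) : 0 < r ->
  unif_poly cid1 (cdisc r) g ->
  exists L : R, forall s, normc s <= r / 2 -> normc (g s - g 0) <= L * normc s.
Proof.
move=> r0 ug; pose phi (h : 'rV[C]_1) := h 0 0.
have ug' : unif_poly (@coordf R 1) (cpolydisc r) (g \o phi).
  apply: unif_poly_comp ug => [i|j|t]; first exact: coordf_bounded.
    by apply: polyfun_unif_poly; exact: (polyfun_coord _ (0 : 'I_1)).
  exact.
have [L hL] := unif_poly_lipschitz r0 ug'.
exists L => s sr; have [->|s0] := eqVneq s 0; first by rewrite subrr normc0 mulr0.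
have := hL (normc s) (const_mx s); rewrite normc_gt0 /= /phi !mxE; apply=> //.
by move=> i; rewrite mxE.
Qed.

Lemma polyfun1_horner (p : C -> C) : polyfun cid1 p ->
  exists q : {poly C}, p = fun t => q.[t].
Proof.
elim=> [c|i|f g _ [a ->] _ [b ->]|f g _ [a ->] _ [b ->]].
- by exists c%:P; apply/funext => t; rewrite hornerC.
- by exists 'X; apply/funext => t; rewrite hornerX.
- by exists (a + b); apply/funext => t; rewrite hornerD.
- by exists (a * b); apply/funext => t; rewrite hornerM.
Qed.

(** A discrete mean value property, exact as soon as the points outnumber the degree: every positive
    power below the order has zero sum over the roots of unity. *)
Lemma polyfun1_mean (p : C -> C) : polyfun cid1 p ->
  exists N0, forall N z, (N0 < N)%N -> N.-primitive_root z ->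
    forall rho, \sum_(j < N) p (rho * z ^+ j) = N%:R * p 0.
Proof.
move=> /polyfun1_horner[q ->]; exists (size q) => N z qN zprim rho.
under eq_bigr do rewrite horner_coef.
rewrite exchange_big /= horner_coef0.
transitivity (\sum_(i < size q) q`_i * rho ^+ i * \sum_(j < N) (z ^+ i) ^+ j).
  apply: eq_bigr => i _; rewrite mulr_sumr; apply: eq_bigr => j _.
  by rewrite exprMn -!exprM mulnC mulrA.
have zN := prim_expr_order zprim.
have E (i : 'I_(size q)) : \sum_(j < N) (z ^+ i) ^+ j = if (i == 0 :> nat) then N%:R else 0.
  rewrite sum_unity_root; last by rewrite -exprM mulnC exprM zN expr1n.
  rewrite -(prim_order_dvd zprim); congr (if _ then _ else _).
  have [->|i0] := eqVneq (i : nat) 0%N; first exact: dvdn0.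
  by rewrite gtnNdvd ?lt0n// (ltn_trans (ltn_ord i)).
under eq_bigr do rewrite E.
case: (size q) (@nth_default _ 0 q 0) => [q0|m _].
  by rewrite big_ord0 q0// mulr0.
rewrite big_ord_recl /= expr0 mulr1 big1 ?addr0 1?mulrC// => i _.
by rewrite mulr0.
Qed.

(** Pythagoras: the cross terms vanish. It gives the strict gain of the squared modulus when
    averaged over a circle. *)
Lemma sumr_shift_sqr N (a : C) (w : 'I_N -> C) : \sum_j w j = 0 ->
  \sum_j normc (a + w j) ^+ 2 = \sum_j (normc a ^+ 2 + normc (w j) ^+ 2).
Proof.
have nsq (z : C) : normc z ^+ 2 = complex.Re z ^+ 2 + complex.Im z ^+ 2.
  by case: z => x y; rewrite /= sqr_sqrtr// addr_ge0 ?sqr_ge0.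
move=> w0; have wR : \sum_j complex.Re (w j) = 0 by rewrite -raddf_sum w0.
have wI : \sum_j complex.Im (w j) = 0 by rewrite -raddf_sum w0.
transitivity (\sum_j (normc a ^+ 2 + normc (w j) ^+ 2) +
    2 * (complex.Re a * \sum_j complex.Re (w j) + complex.Im a * \sum_j complex.Im (w j))).
  rewrite !mulr_sumr -big_split mulr_sumr -big_split /=; apply: eq_bigr => j _.
  by rewrite !nsq !raddfD /=; ring.
by rewrite wR wI !mulr0 addr0 mulr0 addr0.
Qed.

(* If [|G| + eta |t|^2] had a maximum at an interior point [c] off the origin,
   averaging over a small circle around [c] would contradict maximality: the
   polynomials approximating [G] have the mean value property, and the second
   term gains [eta s^2]. *)
Lemma max_principle (G : C -> C) (M L r1 : R) : 0 <= M ->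
  (forall t0, t0 != 0 -> normc t0 <= 1 -> exists2 r : R, 0 < r &
     unif_poly cid1 (cdisc r) (fun s => G (t0 + s))) ->
  G 0 = 0 -> 0 < r1 -> (forall t, normc t <= r1 -> normc (G t) <= L * normc t) ->
  (forall t, normc t = 1 -> normc (G t) <= M) ->
  forall t, normc t <= 1 -> normc (G t) <= M.
Proof.
move=> M0 Gloc G0 r10 GL GM t t1; apply/ler_addgt0Pr => eta eta0.
pose u (t : C) : R := normc (G t) + eta * normc t ^+ 2.
(* At the origin, where [G] is not assumed to be approximable, continuity comes from the bound
   [GL]. *)
have Glip t0 : normc t0 <= 1 -> exists2 d : R, 0 < d & exists2 L' : R, 0 <= L' &
    forall s, normc s <= d -> normc (G (t0 + s) - G t0) <= L' * normc s.
  move=> t01; have [->|t00] := eqVneq t0 0.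
    exists r1 => //; exists `|L| => // s /GL h.
    rewrite add0r G0 subr0; apply: le_trans h _.
    by rewrite ler_wpM2r ?normc_ge0 ?ler_norm.
  have [r r0 ur] := Gloc _ t00 t01; have [L' hL'] := unif_poly1_lipschitz r0 ur.
  exists (r / 2); first by rewrite divr_gt0.
  exists `|L'| => // s /hL'; rewrite addr0 => h; apply: le_trans h _.
  by rewrite ler_wpM2r ?normc_ge0 ?ler_norm.
have cu : {within cdisc 1, continuous u}.
  apply/subspace_continuousP => t0 t01; apply/cvgrPdist_lt => e e0.
  have [d d0 [L' L'0 hL']] := Glip _ t01.
  pose K := L' + eta * 2 + 1.
  have K0 : 0 < K by rewrite ltr_wpDl// addr_ge0// mulr_ge0// ltW.
  apply/nbhs_complexP; exists (Num.min d (e / K)); first by rewrite lt_min d0 divr_gt0.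
  move=> y; rewrite lt_min => /andP[yd ye] y1.
  have := hL' (y - t0) (ltW yd); rewrite [t0 + _]addrC subrK => h.
  have h1 : `|normc (G y) - normc (G t0)| <= normc (G y - G t0).
    by rewrite ler_norml; have := normc_lerB (G y) (G t0);
       have := normc_lerB (G t0) (G y); rewrite (normcB (G t0)); lra.
  have h2 : `|normc y - normc t0| <= normc (y - t0).
    by rewrite ler_norml; have := normc_lerB y t0;
       have := normc_lerB t0 y; rewrite (normcB t0); lra.
  have h3 : `|normc y ^+ 2 - normc t0 ^+ 2| <= 2 * normc (y - t0).
    rewrite subr_sqr normrM mulrC; apply: ler_pM => //.
    rewrite ger0_norm ?addr_ge0 ?normc_ge0//.
    by move: y1 t01; rewrite /cdisc /=; lra.
  have -> : u t0 - u y = - ((normc (G y) - normc (G t0)) +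
     eta * (normc y ^+ 2 - normc t0 ^+ 2)) by rewrite /u; ring.
  rewrite normrN; apply: le_lt_trans (ler_normD _ _) _.
  rewrite normrM (gtr0_norm eta0).
  apply: le_lt_trans (_ : K * normc (y - t0) < e); last by rewrite -ltr_pdivlMl// mulrC.
  rewrite /K 2!mulrDl mul1r -addrA; apply: lerD; first exact: le_trans h.
  rewrite -mulrA -[leLHS]addr0 lerD ?normc_ge0//.
  by rewrite ler_pM2l.
have ne : cdisc 1 !=set0 by exists 0; rewrite /cdisc /mkset normc0.
have [c /set_mem c1 cmax] := compact_EVT_max ne (@compact_disc R 1) cu.
have um s : normc s <= 1 -> u s <= u c by move=> s1; apply: cmax; exact: mem_set.
suff uc : u c <= M + eta.
  have := um _ t1; rewrite {1}/u; have : 0 <= eta * normc t ^+ 2.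
    by rewrite mulr_ge0 ?(ltW eta0)// exprn_ge0 ?normc_ge0.
  by move: uc; lra.
have [c1' | c1'] := eqVneq (normc c) 1.
  by rewrite /u c1' expr1n mulr1 lerD2r GM.
have {}c1' : normc c < 1 by rewrite lt_neqAle c1'.
have [->|c0] := eqVneq c 0.
  by rewrite /u G0 !normc0 expr0n mulr0 addr0 addr_ge0// ltW.
exfalso; have [r r0 ur] := Gloc _ c0 c1.
pose s := Num.min r (1 - normc c).
have s0 : 0 < s by rewrite lt_min r0 subr_gt0.
have sr : s <= r by rewrite ge_min lexx.
have sc : s <= 1 - normc c by rewrite ge_min lexx orbT.
(* This error is spent once on the circle and once at the centre; half of the gain eta * s^2
   survives. *)
have e0 : 0 < eta * s ^+ 2 / 4 by rewrite divr_gt0 ?mulr_gt0 ?exprn_gt0.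
have [p pp hp] := ur _ e0.
have [N0 hN0] := polyfun1_mean pp.
(* [N0.+2] exceeds [N0] and is at least 2, so that a primitive root differs from 1 and the points of
   the circle sum to zero. *)
have [N N0N] : exists N, N = N0.+2 by exists N0.+2.
have Ngt0 : (0 < N)%N by rewrite N0N.
have [z zp] := primitive_root_exists R Ngt0.
have zN := prim_expr_order zp.
have nz := normc_unity_root Ngt0 zN.
have z1 : z != 1.
  by apply/eqP => z1; have := prim_order_dvd zp 1; rewrite expr1 z1 eqxx dvdn1 N0N.
have := hN0 N z _ zp s%:C; rewrite {1}N0N ltnS leqnSn => /(_ isT).
pose w (j : 'I_N) := s%:C * z ^+ j.
have nw j : normc (w j) = s.
  by rewrite /w normcM normcX nz expr1n mulr1 normc_real gtr0_norm.
have ws : \sum_j w j = 0.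
  by rewrite /w -mulr_sumr sum_unity_root// (negbTE z1) mulr0.
move=> mean.
have p0 : N%:R * normc (p 0) <= \sum_j normc (p (w j)).
  by rewrite -normc_nat -normcM -mean; exact: normc_sum.
have h1 : \sum_j normc (p (w j)) <= \sum_j (u c - eta * normc (c + w j) ^+ 2 + eta * s ^+ 2 / 4).
  apply: ler_sum => j _; have := hp (w j); rewrite /cdisc /= nw => /(_ sr) h.
  have cw : normc (c + w j) <= 1.
    by apply: le_trans (normcD _ _) _; rewrite nw; move: sc; lra.
  have := um _ cw; rewrite {1}/u => h2.
  have := normc_lerB (p (w j)) (G (c + w j)); rewrite (normcB (p (w j))).
  by move: h h2; lra.
have h2 : normc (G c) <= normc (p 0) + eta * s ^+ 2 / 4.
  have := hp 0; rewrite /cdisc /mkset normc0 addr0 => /(_ (ltW r0)) h.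
  by have := normc_lerB (G c) (p 0); move: h; lra.
have S : \sum_j normc (c + w j) ^+ 2 = N%:R * (normc c ^+ 2 + s ^+ 2).
  rewrite (sumr_shift_sqr c ws); under eq_bigr do rewrite nw.
  by rewrite sumr_const card_ord mulr_natl.
have {}h1 : \sum_j normc (p (w j)) <=
    N%:R * (u c - eta * (normc c ^+ 2 + s ^+ 2) + eta * s ^+ 2 / 4).
  apply: le_trans h1 _; rewrite big_split /= sumrB -mulr_sumr S !sumr_const card_ord -[u c *+ _]mulr_natl -[(_ / 4) *+ _]mulr_natl.
  by move: (N%:R) => NN; rewrite le_eqVlt; apply/orP; left; apply/eqP; ring.
have {p0}h1 := le_trans p0 h1.
have NR0 : 0 < N%:R :> R by rewrite ltr0n Ngt0.
have {}h1 : normc (p 0) <= u c - eta * (normc c ^+ 2 + s ^+ 2) + eta * s ^+ 2 / 4.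
  by rewrite -(ler_pM2l NR0).
have : 0 < eta * s ^+ 2 by rewrite mulr_gt0 ?exprn_gt0.
move: h1 h2; rewrite /u mulrDr; move: (eta * normc c ^+ 2) => Q; move: (normc (G c)) (normc (p 0)) => A B.
by move: (eta * s ^+ 2) => q; lra.
Qed.

(** The maximum principle is applied to g^2 / t, where g is the increment of [w]. Near the origin g
    is O(t), so g^2 / t is O(t) and continuous with the value 0 that division by zero assigns,
    whereas g / t would have to be extended by a derivative. *)
Lemma schwarz_sqrt n (w : 'rV[C]_n -> C) (a v : 'rV[C]_n) (D : R) : 0 <= D ->
  (forall t, normc t <= 1 -> analytic_at w (a + t *: v)) ->
  (forall t, normc t <= 1 -> normc (w (a + t *: v) - w a) <= D) ->
  forall t, normc t <= 1 -> normc (w (a + t *: v) - w a) ^+ 2 <= D ^+ 2 * normc t.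
Proof.
move=> D0 wan wD t t1.
pose g (t : C) := w (a + t *: v) - w a.
have gloc t0 : normc t0 <= 1 -> exists2 r : R, 0 < r &
    unif_poly cid1 (cdisc r) (fun s => g (t0 + s)).
  move=> t01; have [r r0 ur] := analytic_unif_poly (wan _ t01).
  pose K := 1 + \sum_i normc (v 0 i).
  have K0 : 0 < K by rewrite ltr_wpDr// sumr_ge0// => i _; exact: normc_ge0.
  exists (r / K); first by rewrite divr_gt0.
  have wloc : unif_poly cid1 (cdisc (r / K)) (fun s => w (a + t0 *: v + s *: v)).
    apply: (unif_poly_comp (@cid1_bounded _) (phi := fun s => s *: v) _ _ ur) => [j|s].
      apply: polyfun_unif_poly.
      apply: (@polyfun_ext _ _ _ _ (fun s => cid1 tt s * v 0 j)).
        by move=> s; rewrite /= /coordf mxE.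
      by apply: polyfun_mul; [exact: polyfun_coord|exact: polyfun_cst].
    rewrite /cdisc /= ler_pdivlMr// => sr i; rewrite mxE normcM; apply: le_trans sr.
    rewrite ler_wpM2l ?normc_ge0// /K (bigD1 i)//= addrCA lerDl addr_ge0// sumr_ge0// => j _.
    exact: normc_ge0.
  apply: unif_poly_eq (unif_poly_add wloc (unif_poly_cst _ _ (- w a))) => s _.
  by rewrite /g scalerDl addrA.
have [r0' r0 u0] := gloc 0 ltac:(by rewrite normc0).
have [L hL] := unif_poly1_lipschitz r0 u0.
have g0 : g 0 = 0 by rewrite /g scale0r addr0 subrr.
pose G (t : C) := g t ^+ 2 / t.
have [->|t0] := eqVneq t 0.
  by rewrite scale0r addr0 subrr normc0 expr0n mulr0.
suff : normc (G t) <= D ^+ 2.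
  by rewrite /G normcM normcV normcX ler_pdivrMr// normc_gt0.
apply: (@max_principle G (D ^+ 2) (L ^+ 2) (r0' / 2)) => //.
- by rewrite exprn_ge0.
- move=> c c0 c1; have [r rp ur] := gloc _ c1.
  have nc : 0 < normc c by rewrite normc_gt0.
  (* Half of [normc c] keeps [s / c] in the range of the geometric series for the inverse of
     [c + s]. *)
  pose r' := Num.min r (normc c / 2).
  exists r'; first by rewrite lt_min rp divr_gt0.
  have ur' : unif_poly cid1 (cdisc r') (fun s => g (c + s)).
    by apply: unif_poly_sub ur => s /le_trans; apply; rewrite ge_min lexx.
  have ui : unif_poly cid1 (cdisc r') (fun s => (1 + s / c)^-1).
    apply: unif_poly_inv; first exact: cid1_bounded.
      apply: unif_poly_mul; [exact: cid1_bounded| |exact: unif_poly_cst].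
      by apply: polyfun_unif_poly; exact: (polyfun_coord _ tt).
    move=> s; rewrite /cdisc /= le_min => /andP[_ h].
    by rewrite normcM normcV ler_pdivrMr// mulrC.
  have b := @cid1_bounded r'.
  apply: unif_poly_eq (unif_poly_mul b (unif_poly_exp b 2 ur')
    (unif_poly_mul b (unif_poly_cst _ _ c^-1) ui)) => s _.
  rewrite /G -invfM; congr (_ * _^-1).
  by rewrite mulrDr mulr1 mulrCA divff ?mulr1.
- by rewrite /G g0 expr0n mul0r.
- by rewrite divr_gt0.
- move=> s sr; rewrite /G normcM normcV normcX.
  have [->|s0] := eqVneq s 0; first by rewrite normc0 invr0 !mulr0.
  rewrite ler_pdivrMr ?normc_gt0// -mulrA -expr2 -exprMn.
  have := hL s sr; rewrite !add0r g0 subr0 => h.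
  by rewrite lerXn2r ?nnegrE ?normc_ge0// (le_trans _ h) ?normc_ge0.
- move=> s s1; rewrite /G normcM normcV s1 invr1 mulr1 normcX.
  by rewrite lerXn2r ?nnegrE ?normc_ge0// wD// s1.
Qed.

End MaximumPrinciple.

(** * Contraction of projective maps *)

Section Doeblin.
Variables (R : realType) (I : finType).
Local Notation C := R[i].

(* The common part [delta] of the two weights only sees [X i - Y i]; the rest
   is a coupling of two measures of equal mass. *)
Lemma doeblin (a b : I -> R) (delta S O : R) (X Y : I -> C) :
  \sum_i a i = 1 -> \sum_i b i = 1 ->
  (forall i, delta <= a i) -> (forall i, delta <= b i) -> 0 <= delta ->
  (forall i, normc (X i - Y i) <= S) -> (forall i j, normc (X i - Y j) <= O) ->
  normc (\sum_i (a i)%:C * X i - \sum_i (b i)%:C * Y i) <=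
    #|I|%:R * delta * S + (1 - #|I|%:R * delta) * O.
Proof.
move=> a1 b1 da db d0 XYS XYO.
pose a' i := a i - delta; pose b' i := b i - delta; pose m := 1 - #|I|%:R * delta.
have a'0 i : 0 <= a' i by rewrite subr_ge0.
have b'0 i : 0 <= b' i by rewrite subr_ge0.
have sa : \sum_i a' i = m by rewrite /m sumrB a1 sumr_const mulr_natl.
have sb : \sum_i b' i = m by rewrite /m sumrB b1 sumr_const mulr_natl.
have m0 : 0 <= m by rewrite -sa sumr_ge0.
have E : \sum_i (a i)%:C * X i - \sum_i (b i)%:C * Y i =
    \sum_i delta%:C * (X i - Y i) + (\sum_i (a' i)%:C * X i - \sum_i (b' i)%:C * Y i).
  rewrite -!sumrB -big_split /=; apply: eq_bigr => i _.
  by rewrite /a' /b' !rmorphB /=; ring.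
rewrite E; apply: le_trans (normcD _ _) _; apply: lerD.
  apply: le_trans (normc_sum _ _ _) _.
  rewrite -[leRHS]mulrA [leRHS]mulr_natl -sumr_const; apply: ler_sum => i _.
  by rewrite normcM normc_real ger0_norm// ler_wpM2l.
(* [m] is the mass of each residual measure. The product coupling used below divides by it, so zero
   mass is settled first. *)
have [mz|mnz] := eqVneq m 0.
  have az i : a' i = 0.
    by apply/eqP; move/eqP: sa; rewrite mz psumr_eq0// => /allP/(_ i (mem_index_enum _)).
  have bz i : b' i = 0.
    by apply/eqP; move/eqP: sb; rewrite mz psumr_eq0// => /allP/(_ i (mem_index_enum _)).
  rewrite -/m mz mul0r big1 ?big1 ?subr0 ?normc0// => i _; rewrite ?az ?bz ?mul0r//.
have mp : 0 < m by rewrite lt_def mnz.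
have mC : m%:C != 0 :> C by rewrite -normc_gt0 normc_real gtr0_norm.
rewrite -(ler_pM2l mp) -{1}(gtr0_norm mp) -normc_real -normcM mulrBr.
have -> : m%:C * (\sum_i (a' i)%:C * X i) - m%:C * (\sum_i (b' i)%:C * Y i) =
    \sum_i \sum_j (a' i * b' j)%:C * (X i - Y j).
  have mb : m%:C = \sum_j (b' j)%:C by rewrite -sb rmorph_sum.
  have ma : m%:C = \sum_j (a' j)%:C by rewrite -sa rmorph_sum.
  rewrite {1}mb ma mulrC !big_distrlr /= -sumrB; apply: eq_bigr => i _.
  by rewrite -sumrB; apply: eq_bigr => j _; rewrite rmorphM /=; ring.
apply: le_trans (normc_sum _ _ _) _.
have -> : m * (m * O) = \sum_i \sum_j a' i * b' j * O.
  rewrite -{1}sa -sb mulrA big_distrlr /= mulr_suml.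
  by apply: eq_bigr => i _; rewrite mulr_suml.
apply: ler_sum => i _; apply: le_trans (normc_sum _ _ _) _; apply: ler_sum => j _.
by rewrite normcM normc_real ger0_norm ?mulr_ge0// ler_wpM2l ?mulr_ge0.
Qed.

End Doeblin.

Section Ratio.
Variables (R : realType) (I : finType).
Local Notation C := R[i].

Definition wratio (x y : I -> R) (v : I -> C) : C :=
  (\sum_l (y l)%:C * v l) / (\sum_l (x l)%:C * v l).

(** If the spread were 0, the rows [x] and [y] would be proportional and [wratio x y v] would not
    depend on [v]. *)
Definition osc_ratio_le (x y : I -> R) (D : R) :=
  forall l l', `|y l / x l - y l' / x l'| <= D.

Lemma den_lb (x : I -> R) (v : I -> C) (c0 : R) : (forall l, 0 < x l) ->
  (forall l, c0 <= complex.Re (v l)) ->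
  c0 * \sum_l x l <= normc (\sum_l (x l)%:C * v l).
Proof.
move=> x0 vc; apply: le_trans (normRe_le _); apply: le_trans (ler_norm _).
rewrite raddf_sum mulr_sumr /=; apply: ler_sum => l _.
have -> : complex.Re ((x l)%:C * v l) = x l * complex.Re (v l).
  by case: (v l) => a b /=; rewrite mul0r subr0.
by rewrite mulrC ler_pM2l.
Qed.

(** The vector [h] of the numerator is kept apart from [v]: with [h] equal to [v] this is
    [ratio_close], with [h] an increment of the vector it bounds the increment of the ratio. *)
Lemma ratio_near (x y : I -> R) (v h : I -> C) (D B c0 : R) (t : C) (l0 : I) :
  (forall l, 0 < x l) -> 0 < c0 -> (forall l, c0 <= complex.Re (v l)) ->
  (forall l, normc (h l) <= B) -> (forall l, normc ((y l / x l)%:C - t) <= D) ->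
  normc ((\sum_l (y l)%:C * h l - t * \sum_l (x l)%:C * h l) /
     \sum_l (x l)%:C * v l) <= D * (B / c0).
Proof.
move=> x0 c00 vc hB hD; have B0 : 0 <= B by apply: le_trans (hB l0); exact: normc_ge0.
have sx : 0 < \sum_l x l.
  by rewrite (bigD1 l0)//= ltr_pwDl// sumr_ge0// => l _; exact: ltW.
have dl := den_lb x0 vc.
have dp : 0 < normc (\sum_l (x l)%:C * v l) by apply: lt_le_trans dl; rewrite mulr_gt0.
rewrite normcM normcV ler_pdivrMr//.
have D0 : 0 <= D by apply: le_trans (hD l0); exact: normc_ge0.
apply: (@le_trans _ _ (D * B / c0 * (c0 * \sum_l x l))); last first.
  by rewrite -(mulrA D) ler_wpM2l// !mulr_ge0// invr_ge0 ltW.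
rewrite mulrA divfK ?gt_eqF// mulr_sumr -sumrB; apply: le_trans (normc_sum _ _ _) _.
rewrite mulr_sumr; apply: ler_sum => l _.
have -> : (y l)%:C * h l - t * ((x l)%:C * h l) =
   ((y l / x l)%:C - t) * h l * (x l)%:C.
  rewrite rmorphM /= fmorphV; field.
  by rewrite -normc_gt0 normc_real gtr0_norm.
by rewrite !normcM normc_real (gtr0_norm (x0 l)) ler_pM2r// ler_pM ?normc_ge0.
Qed.

Lemma ratio_close (x y : I -> R) (v : I -> C) (D B c0 : R) (l0 : I) :
  (forall l, 0 < x l) -> 0 < c0 -> (forall l, c0 <= complex.Re (v l)) ->
  (forall l, normc (v l) <= B) -> osc_ratio_le x y D ->
  normc (wratio x y v - (y l0 / x l0)%:C) <= D * (B / c0).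
Proof.
move=> x0 c00 vc vB hD.
have dl := den_lb x0 vc.
have sx : 0 < \sum_l x l.
  by rewrite (bigD1 l0)//= ltr_pwDl// sumr_ge0// => l _; exact: ltW.
have dp : \sum_l (x l)%:C * v l != 0.
  by rewrite -normc_gt0; apply: lt_le_trans dl; rewrite mulr_gt0.
have -> : wratio x y v - (y l0 / x l0)%:C =
  (\sum_l (y l)%:C * v l - (y l0 / x l0)%:C * \sum_l (x l)%:C * v l) / \sum_l (x l)%:C * v l.
  by rewrite mulrBl mulfK.
by apply: ratio_near => // l; rewrite -rmorphB normc_real.
Qed.

(* One right multiplication by a positive matrix replaces the quotients
   [y_l / x_l] by averages of them with weights at least
   [(#|I| kappa kappa')^-1]. *)
Lemma ratio_contract (x y : I -> R) (N : I -> I -> R) (ka a b D : R) :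
  (forall l, 0 < x l) -> 0 < ka -> (forall l l', x l <= ka * x l') ->
  0 < a -> (forall m l, a <= N m l <= b) -> osc_ratio_le x y D -> 0 <= D ->
  osc_ratio_le (fun l => \sum_m x m * N m l) (fun l => \sum_m y m * N m l)
    ((1 - a / (b * ka)) * D).
Proof.
move=> x0 ka0 xka a0 Nab hD D0 l l'.
have I0 : 0 < #|I|%:R :> R by rewrite ltr0n; apply/card_gt0P; exists l; rewrite inE.
have N0 m i : 0 < N m i by have /andP[h _] := Nab m i; exact: lt_le_trans h.
have b0 : 0 < b.
  by have /andP[_ h] := Nab l l; exact: lt_le_trans (N0 l l) h.
pose X i := \sum_m x m * N m i.
have X0 i : 0 < X i.
  by rewrite /X (bigD1 i)//= ltr_pwDl ?mulr_gt0// sumr_ge0// => m _; rewrite mulr_ge0 ?ltW.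
pose om i m := x m * N m i / X i.
have om1 i : \sum_m om i m = 1 by rewrite -mulr_suml -/(X i) divff// gt_eqF.
pose delta := a / (b * ka) / #|I|%:R.
have omd i m : delta <= om i m.
  have XB : X i <= #|I|%:R * (ka * x m * b).
    rewrite mulr_natl -sumr_const; apply: ler_sum => m' _.
    by have /andP[_ h] := Nab m' i; apply: ler_pM => //; exact: ltW.
  rewrite /om ler_pdivlMr//; apply: (@le_trans _ _ (delta * (#|I|%:R * (ka * x m * b)))).
    by rewrite ler_wpM2l// /delta !divr_ge0 ?mulr_ge0 ?ltW.
  have -> : delta * (#|I|%:R * (ka * x m * b)) = x m * a.
    by rewrite /delta; field; rewrite !gt_eqF.
  by have /andP[h _] := Nab m i; rewrite ler_pM2l.
have E i : (\sum_m y m * N m i) / X i = \sum_m om i m * (y m / x m).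
  rewrite mulr_suml; apply: eq_bigr => m _; rewrite /om; field.
  by rewrite !gt_eqF.
rewrite -normc_real !E (rmorphB (real_complex R)) !(rmorph_sum (real_complex R)) /=.
under eq_bigr do rewrite rmorphM /=.
under [X in _ - X]eq_bigr do rewrite rmorphM /=.
have E2 : #|I|%:R * delta = a / (b * ka) by rewrite /delta mulrC divfK// gt_eqF.
(* Both averages are taken of one family of quotients, so the term [S] of [doeblin] is 0. *)
have := @doeblin R I (om l) (om l') delta 0 D (fun m => (y m / x m)%:C) (fun m => (y m / x m)%:C).
rewrite E2 mulr0 add0r; apply => //.
- by rewrite !divr_ge0 ?mulr_ge0 ?ltW.
- by move=> m; rewrite subrr normc0.
- by move=> m m'; rewrite -rmorphB normc_real.
Qed.

End Ratio.

Section Words.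
Variables (R : realType) (n k : nat) (M : 'I_k -> 'M[R]_(1 + n)).
Hypothesis M_pos : forall i, positive_mx (M i).
Local Notation C := R[i].

Definition hatc (j : 'I_k) (z : 'rV[C]_n) : 'rV[C]_n := hat (cmx (M j)) z.

Definition act (s : seq 'I_k) (z : 'rV[C]_n) : 'rV[C]_n := foldl (fun z j => hatc j z) z s.

(** The head of the word acts first, hence is the rightmost factor. *)
Definition word_mx (s : seq 'I_k) : 'M[R]_(1 + n) := foldr (fun j A => A *m M j) 1%:M s.

Definition av (z : 'rV[C]_n) (l : 'I_(1 + n)) : C := affine z l 0.

Lemma av_lshift z i : av z (lshift n i) = 1.
Proof. by rewrite /av /affine col_mxEu !ord1 mxE eqxx. Qed.

Lemma av_rshift z j : av z (rshift 1 j) = z 0 j.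
Proof. by rewrite /av /affine col_mxEd mxE. Qed.

Lemma hat_ratio (A : 'M[R]_(1 + n)) z j : hat (cmx A) z 0 j =
  wratio (A (lshift n 0)) (A (rshift 1 j)) (av z).
Proof.
by rewrite mxE !mxE; congr (_ / _); apply: eq_bigr => l _; rewrite mxE.
Qed.

Lemma act_nil z : act [::] z = z. Proof. by []. Qed.

Lemma act_cons j s z : act (j :: s) z = act s (hatc j z). Proof. by []. Qed.

Variable U : set 'rV[C]_n.
Hypothesis U_pos : forall z, U z -> forall j, 0 < complex.Re (z 0 j).
Hypothesis U_hat : forall j z, U z -> U (hatc j z).

Lemma act_U s z : U z -> U (act s z).
Proof. by elim: s z => //= j s IH z Uz; apply: IH; exact: U_hat. Qed.

Lemma av_pos (z : 'rV[C]_n) l : (forall j, 0 < complex.Re (z 0 j)) -> 0 < complex.Re (av z l).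
Proof.
move=> h; rewrite -(fintype.splitK l); case: (fintype.split l) => i /=;
  by rewrite ?av_lshift ?av_rshift//= ltr01.
Qed.

Lemma den_neq0 (x : 'I_(1 + n) -> R) (v : 'I_(1 + n) -> C) :
  (forall l, 0 <= x l) -> (exists l, 0 < x l) -> (forall l, 0 < complex.Re (v l)) ->
  \sum_l (x l)%:C * v l != 0.
Proof.
move=> x0 [l0 xl0] v0; apply/eqP => /(congr1 (@complex.Re R)); rewrite raddf_sum /=.
have E l : complex.Re ((x l)%:C * v l) = x l * complex.Re (v l).
  by case: (v l) => a b /=; rewrite mul0r subr0.
under eq_bigr do rewrite E.
apply/eqP; rewrite gt_eqF// (bigD1 l0)//= ltr_pwDl ?mulr_gt0// sumr_ge0// => l _.
by rewrite mulr_ge0// ltW.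
Qed.

(** Each letter divides the homogeneous vector by its first entry [c]; this scalar cancels in the
    ratio, so one division at the end suffices. *)
Lemma act_ratio s z j : U z -> act s z 0 j =
  wratio (word_mx s (lshift n 0)) (word_mx s (rshift 1 j)) (av z).
Proof.
elim: s z => [|i s IH] z Uz /=.
  rewrite /wratio (bigD1 (rshift 1 j))//= big1 => [|l lj]; last first.
    by rewrite !mxE eq_sym (negbTE lj) mul0r.
  rewrite [X in _ / X](bigD1 (lshift n 0))//= [X in _ / (_ + X)]big1 => [|l lj]; last first.
    by rewrite !mxE eq_sym (negbTE lj) mul0r.
  by rewrite !mxE !eqxx !mul1r !addr0 av_lshift av_rshift divr1.
rewrite IH; last exact: U_hat.
pose c := \sum_l (M i (lshift n 0) l)%:C * av z l.
have c0 : c != 0.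
  apply: den_neq0 => [l||l]; first exact/ltW/M_pos.
    by exists (lshift n 0); exact: M_pos.
  exact/av_pos/U_pos.
have E l : av (hatc i z) l = (\sum_m (M i l m)%:C * av z m) / c.
  rewrite -(fintype.splitK l); case: (fintype.split l) => l' /=.
    by rewrite av_lshift ord1 divff.
  by rewrite av_rshift /hatc hat_ratio.
have E2 (x : 'I_(1 + n)) (A : 'M[R]_(1 + n)) : \sum_l (A x l)%:C * av (hatc i z) l =
    (\sum_l ((A *m M i) x l)%:C * av z l) / c.
  under eq_bigr do rewrite E mulrA mulr_sumr.
  rewrite -mulr_suml; congr (_ / c).
  rewrite exchange_big /=; apply: eq_bigr => m _.
  rewrite mxE rmorph_sum mulr_suml /=; apply: eq_bigr => l _.
  by rewrite rmorphM /= mulrA.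
rewrite /wratio !E2 invfM invrK.
by rewrite mulrACA mulVf// mulr1.
Qed.

Local Opaque act.

Lemma fin_lower_bound (I : finType) (F : I -> R) : (forall i, 0 < F i) ->
  exists2 a, 0 < a & forall i, a <= F i.
Proof.
move=> F0; exists (\big[Num.min/1]_i F i).
  by apply: lt_bigmin => //; exact: ltr01.
by move=> i; exact: bigmin_le.
Qed.

Lemma entries_bounds : exists a b, 0 < a /\ a <= b /\
  forall j m l, a <= M j m l <= b.
Proof.
have [a a0 ha] := @fin_lower_bound ('I_k * ('I_(1 + n) * 'I_(1 + n)))%type
  (fun t => M t.1 t.2.1 t.2.2) (fun t => M_pos _ _ _).
exists a, (a + \sum_(t : 'I_k * ('I_(1 + n) * 'I_(1 + n))) M t.1 t.2.1 t.2.2).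
have Mt0 (t : 'I_k * ('I_(1 + n) * 'I_(1 + n))) : 0 <= M t.1 t.2.1 t.2.2.
  exact/ltW/M_pos.
split=> //; split; first by rewrite lerDl sumr_ge0.
move=> j m l; rewrite (ha (j, (m, l))) /= (bigD1 (j, (m, l)))//= addrCA lerDl.
by rewrite addr_ge0 ?sumr_ge0// ltW.
Qed.

Lemma word_mx_row0 s : (forall l, 0 <= word_mx s (lshift n 0) l) /\
  exists l, 0 < word_mx s (lshift n 0) l.
Proof.
elim: s => [|j s [IH1 [l IH2]]] /=.
  split; first by move=> l; rewrite mxE; case: eqP.
  by exists (lshift n 0); rewrite mxE eqxx ltr01.
split=> [l'|].
  by rewrite mxE sumr_ge0// => m _; rewrite mulr_ge0 ?IH1// ltW// M_pos.
exists l; rewrite mxE (bigD1 l)//= ltr_pwDl ?mulr_gt0 ?M_pos// sumr_ge0// => m _.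
by rewrite mulr_ge0 ?IH1// ltW// M_pos.
Qed.

Lemma word_mx_pos s j l : 0 < word_mx (j :: s) (lshift n 0) l.
Proof.
have [h1 [l' h2]] := word_mx_row0 s.
rewrite /= mxE (bigD1 l')//= ltr_pwDl ?mulr_gt0 ?M_pos// sumr_ge0// => m _.
by rewrite mulr_ge0// ltW// M_pos.
Qed.

Lemma word_mx_osc : exists D la : R, [/\ 0 <= D, 0 <= la < 1 &
  forall s j i, osc_ratio_le (word_mx (j :: s) (lshift n 0))
    (word_mx (j :: s) (rshift 1 i)) (la ^+ size s * D)].
Proof.
have [a [b [a0 [ab hab]]]] := entries_bounds.
have b0 : 0 < b := lt_le_trans a0 ab.
have Mb0 j m l : 0 < M j m l <= b.
  by have /andP[h ->] := hab j m l; rewrite (lt_le_trans a0).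
(* b/a compares any two entries of the first row of a nonempty product; it plays the role of [ka] in
   [ratio_contract]. It also bounds the quotients for one letter, whence the choice of [D]. *)
pose la := 1 - a / (b * (b / a)).
have la01 : 0 <= la < 1.
  rewrite /la subr_ge0 ltrBlDl ltrDr divr_gt0 ?mulr_gt0 ?invr_gt0// andbT.
  rewrite ler_pdivrMr ?mulr_gt0 ?invr_gt0// mul1r mulrA ler_pdivlMr//.
  by apply: ler_pM => //; exact: ltW.
exists (b / a), la; split=> //; first by rewrite divr_ge0// ltW.
elim=> [|j' s IH] j i.
  rewrite expr0 mul1r => l l' /=; rewrite !mul1mx.
  have h m m' : 0 <= M j (rshift 1 i) m / M j (lshift n 0) m' <= b / a.
    have /andP[h1 h2] := Mb0 j (rshift 1 i) m.
    have /andP[h3 _] := Mb0 j (lshift n 0) m'; have /andP[h4 _] := hab j (lshift n 0) m'.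
    apply/andP; split; first by apply: divr_ge0; exact: ltW.
    apply: ler_pM => //; first exact: ltW.
      by rewrite invr_ge0 ltW.
    by rewrite lef_pV2.
  rewrite ler_norml; have /andP[h1 h2] := h l l; have /andP[h3 h4] := h l' l'.
  by apply/andP; split; lra.
have -> : word_mx [:: j, j' & s] = word_mx (j' :: s) *m M j by [].
have E r : (word_mx (j' :: s) *m M j) r = fun l => \sum_m word_mx (j' :: s) r m * M j m l.
  by apply/funext => l; rewrite mxE.
rewrite !E (_ : size (j' :: s) = (size s).+1)// exprS -mulrA.
apply: (@ratio_contract _ _ _ _ _ (b / a) a b) => //.
- exact: word_mx_pos.
- by rewrite divr_gt0.
- have [h1 [l0 h2]] := word_mx_row0 s.
  have -> : word_mx (j' :: s) = word_mx s *m M j' by [].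
  move=> l l'; rewrite !mxE mulr_sumr; apply: ler_sum => m _.
  rewrite mulrCA ler_wpM2l//.
  have /andP[_ h3] := Mb0 j' m l; have /andP[h4 _] := hab j' m l'.
  apply: le_trans h3 _; rewrite mulrAC ler_pdivlMr//.
  by rewrite ler_pM2l.
- by have /andP[h _] := la01; rewrite mulr_ge0 ?exprn_ge0// divr_ge0// ltW.
Qed.

(** For a long word all quotients of entries are near one real number [t], and so are the images of
    both points. The bounds [c0] and [B] are asked of the points because [U] itself may come near
    the boundary of the positive cone. *)
Lemma act_contract (B c0 e : R) : 0 < c0 -> 0 < e ->
  exists N0, forall s, (N0 <= size s)%N -> forall z z', U z -> U z' ->
    (forall l, c0 <= complex.Re (av z l)) -> (forall l, c0 <= complex.Re (av z' l)) ->
    (forall l, normc (av z l) <= B) -> (forall l, normc (av z' l) <= B) ->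
    forall i, normc (act s z 0 i - act s z' 0 i) < e.
Proof.
move=> c00 e0; have [D [la [D0 /andP[la0 la1] hD]]] := word_mx_osc.
pose K := 2 * D * `|B| / c0 + 1.
have K0 : 0 < K by rewrite ltr_wpDl// divr_ge0 ?mulr_ge0// ltW.
have /cvgrPdist_lt /(_ (e / K)) : (fun m => la ^+ m) @ \oo --> (0 : R).
  by apply: cvg_expr; rewrite ger0_norm.
case=> [|N _ hN]; first by rewrite divr_gt0.
(* The decay in [word_mx_osc] is counted by the length of the tail of the word. *)
exists N.+1 => -[//|j s] Ns z z' Uz Uz' zc z'c zB z'B i.
have := hN (size s) Ns; rewrite /= sub0r normrN ger0_norm ?exprn_ge0//.
rewrite ltr_pdivlMr// => hla.
pose x := word_mx (j :: s) (lshift n 0); pose y := word_mx (j :: s) (rshift 1 i).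
have x0 l : 0 < x l by exact: word_mx_pos.
have BB l : normc (av z l) <= `|B| by apply: le_trans (zB l) (ler_norm _).
have BB' l : normc (av z' l) <= `|B| by apply: le_trans (z'B l) (ler_norm _).
pose t := (y (lshift n 0) / x (lshift n 0))%:C; pose F := la ^+ size s * D * (`|B| / c0).
have r1 : normc (act (j :: s) z 0 i - t) <= F.
  by rewrite act_ratio//; exact: ratio_close.
have r2 : normc (act (j :: s) z' 0 i - t) <= F.
  by rewrite act_ratio//; exact: ratio_close.
apply: le_lt_trans (normc_dist3 _ t _) _.
apply: (@le_lt_trans _ _ (F + F)); first by apply: lerD r1 _; rewrite normcB.
apply: le_lt_trans hla.
have -> : F + F = la ^+ size s * (K - 1) by rewrite /F /K; ring.
by rewrite ler_wpM2l ?exprn_ge0// gerBl.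
Qed.

Lemma addmx_subE (z h : 'rV[C]_n) i : (z + h) 0 i - z 0 i = h 0 i.
Proof. by rewrite mxE addrAC subrr add0r. Qed.

(** The radius [d] serves all words at once because the spread of the quotients is at most [D] for
    every nonempty word; only this spread, and not the size of the entries, enters the increment of
    the ratio. *)
Lemma act_equi_unif_poly z (r : R) : U z -> 0 < r ->
  (exists2 d : R, 0 < d & forall h, cpolydisc d h -> U (z + h)) ->
  exists2 d : R, 0 < d & forall s,
    (forall j, unif_poly (@coordf R n) (cpolydisc d)
       (fun h => act s (z + h) 0 j - act s z 0 j)) /\
    forall h, cpolydisc d h -> U (z + h) /\
       forall j, normc (act s (z + h) 0 j - act s z 0 j) <= r.
Proof.
move=> Uz r0 [d0 d00 Ud0].
have [D [la [D0 /andP[la0 la1] hD]]] := word_mx_osc.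
have [c c0 hc] := fin_lower_bound (fun l => av_pos l (U_pos Uz)).
pose B := \sum_l normc (av z l).
have hB l : normc (av z l) <= B.
  by rewrite /B (bigD1 l)//= lerDl sumr_ge0// => ? _; exact: normc_ge0.
have B0 : 0 <= B by rewrite sumr_ge0// => ? _; exact: normc_ge0.
pose K := D + D * (B / c).
have K0 : 0 <= K by rewrite addr_ge0// mulr_ge0// divr_ge0// ltW.
(* In turn: [d0] keeps [z + h] in [U], [r] handles the empty word, c/2 keeps the denominators away
   from 0, and the last term makes the bound of [ratio_near] at most [r]. *)
pose d := Num.min (Num.min d0 r) (Num.min (c / 2) (r * (c / 2) / (K + 1))).
have dp : 0 < d.
  by rewrite !lt_min d00 r0 !divr_gt0 ?mulr_gt0 ?ltr_wpDl.
have /andP[/andP[dd0 dr] /andP[dc dK]] :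
    (d <= d0) && (d <= r) && ((d <= c / 2) && (d <= r * (c / 2) / (K + 1))).
  by rewrite -!le_min.
exists d => // s.
have Uh h : cpolydisc d h -> U (z + h).
  by move=> hd; apply: Ud0 => i; apply: le_trans (hd i) dd0.
case: s => [|j s].
  split=> [i|h hd].
    apply: unif_poly_eq (polyfun_unif_poly _ (polyfun_coord _ i)) => h _.
    by rewrite !act_nil addmx_subE.
  split=> [|i]; first exact: Uh.
  by rewrite !act_nil addmx_subE; apply: le_trans (hd i) dr.
pose x := word_mx (j :: s) (lshift n 0).
have x0 l : 0 < x l by exact: word_mx_pos.
pose H (h : 'rV[C]_n) l := av (z + h) l - av z l.
have HE h l : av (z + h) l = av z l + H h l by rewrite /H [RHS]addrC subrK.
have H1 h i : H h (lshift n i) = 0 by rewrite /H !av_lshift subrr.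
have H2 h i : H h (rshift 1 i) = h 0 i by rewrite /H !av_rshift addmx_subE.
have Hd h l : cpolydisc d h -> normc (H h l) <= d.
  move=> hd; rewrite -(fintype.splitK l); case: (fintype.split l) => i /=.
    by rewrite H1 normc0 ltW.
  by rewrite H2.
have Hpf l : polyfun (@coordf R n) (fun h => H h l).
  rewrite -(fintype.splitK l); case: (fintype.split l) => i /=.
    by apply: polyfun_ext (polyfun_cst _ 0) => h; rewrite H1.
  by apply: polyfun_ext (polyfun_coord _ i) => h; rewrite H2.
have Hsum (y : 'I_(1 + n) -> R) : polyfun (@coordf R n) (fun h => \sum_l (y l)%:C * H h l).
  by apply: polyfun_sum => l; apply: polyfun_mul (polyfun_cst _ _) (Hpf l).
pose X := \sum_l (x l)%:C * av z l.
pose Y h := \sum_l (x l)%:C * H h l.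
have sx : 0 < \sum_l x l.
  by rewrite (bigD1 (lshift n 0))//= ltr_pwDl// sumr_ge0// => l _; exact: ltW.
have Xlb : c * \sum_l x l <= normc X by apply: den_lb.
have Xp : 0 < normc X by apply: lt_le_trans Xlb; rewrite mulr_gt0.
have X0 : X != 0 by rewrite -normc_gt0.
have Yub h : cpolydisc d h -> normc (Y h) <= d * \sum_l x l.
  move=> hd; apply: le_trans (normc_sum _ _ _) _; rewrite mulr_sumr.
  apply: ler_sum => l _; rewrite normcM normc_real gtr0_norm// mulrC.
  by rewrite ler_pM2r// Hd.
have XY h : \sum_l (x l)%:C * av (z + h) l = X + Y h.
  by rewrite /X /Y -big_split /=; apply: eq_bigr => l _; rewrite HE mulrDr.
have YX2 h : cpolydisc d h -> normc (Y h / X) <= 2^-1.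
  move=> hd; rewrite normcM normcV ler_pdivrMr//; apply: le_trans (Yub h hd) _.
  apply: le_trans (_ : c / 2 * \sum_l x l <= _); first by rewrite ler_pM2r.
  by rewrite [c / 2]mulrC -mulrA ler_pM2l ?invr_gt0.
have XY0 h : cpolydisc d h -> X + Y h != 0.
  move=> hd; have -> : X + Y h = X * (1 + Y h / X) by rewrite mulrDr mulr1 mulrCA divff ?mulr1.
  rewrite mulf_neq0// -normc_gt0; have := YX2 h hd.
  have := normc_lerB 1 (- (Y h / X)); rewrite normc1 opprK normcNE.
  by move=> h1 h2; apply: lt_le_trans h1; rewrite subr_gt0; apply: le_lt_trans h2 _; rewrite invf_lt1 ?ltr1n.
have diffE h i : cpolydisc d h -> act (j :: s) (z + h) 0 i - act (j :: s) z 0 i =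
    (\sum_l (word_mx (j :: s) (rshift 1 i) l)%:C * H h l - act (j :: s) z 0 i * Y h) / (X + Y h).
  move=> hd; transitivity ((\sum_l (word_mx (j :: s) (rshift 1 i) l)%:C * av (z + h) l) / (X + Y h) -
      act (j :: s) z 0 i); first by congr (_ - _); rewrite act_ratio ?/wratio -?XY//; exact: Uh.
  rewrite (act_ratio (j :: s) i Uz) /wratio -/x -/X.
  under eq_bigr do rewrite HE mulrDr.
  rewrite big_split /=; field.
  by rewrite X0 XY0.
split=> [i|h hd].
  apply: (@unif_poly_eq _ _ _ _ _ (fun h =>
    (\sum_l (word_mx (j :: s) (rshift 1 i) l)%:C * H h l - act (j :: s) z 0 i * Y h) *
    (X^-1 * (1 + Y h / X)^-1))).
    move=> h hd; rewrite diffE// -invfM; congr (_ / _).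
    by rewrite mulrDr mulr1 mulrCA divff ?mulr1.
  have cb := @coordf_bounded R n d.
  apply: unif_poly_mul => //.
    apply: unif_poly_add; first exact/polyfun_unif_poly/Hsum.
    apply: polyfun_unif_poly.
    apply: (@polyfun_ext _ _ _ _ (fun h => - act (j :: s) z 0 i * Y h)).
      by move=> h; rewrite mulNr.
    by apply: polyfun_mul (polyfun_cst _ _) (Hsum x).
  apply: unif_poly_mul => //; first exact: unif_poly_cst.
  apply: unif_poly_inv => //.
  by apply: polyfun_unif_poly; apply: polyfun_mul (Hsum x) (polyfun_cst _ _).
split=> [|i]; first exact: Uh.
rewrite diffE//.
have c20 : 0 < c / 2 by rewrite divr_gt0.
have vc l : c / 2 <= complex.Re (av (z + h) l).
  rewrite HE raddfD /=; have := hc l.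
  have := normRe_le (H h l); have := Hd h l hd; have := ler_norm (- complex.Re (H h l)).
  by rewrite normrN; move: dc; lra.
have := @ratio_near _ _ x (word_mx (j :: s) (rshift 1 i)) (av (z + h)) (H h) K d (c / 2)
  (act (j :: s) z 0 i) (lshift n 0) x0 c20 vc (fun l => Hd h l hd).
rewrite XY; move=> h1; apply: le_trans (h1 _) _; last first.
  apply: (@le_trans _ _ (K * (r * (c / 2) / (K + 1) / (c / 2)))).
    by rewrite ler_wpM2l// ler_pM2r ?invr_gt0.
  have -> : K * (r * (c / 2) / (K + 1) / (c / 2)) = r * (K / (K + 1)).
    by field; rewrite !gt_eqF// ltr_wpDl.
  rewrite ger_pMr// ler_pdivrMr ?ltr_wpDl// mul1r lerDl.
  exact: ler01.
move=> l.
have oD : osc_ratio_le x (word_mx (j :: s) (rshift 1 i)) D.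
  by move=> m m'; apply: le_trans (hD s j i m m') _; rewrite ler_piMl// exprn_ile1// ltW.
have := ratio_close l x0 c0 hc hB oD; rewrite -act_ratio// normcB => h2.
by apply: le_trans h2 _; rewrite /K lerDr.
Qed.

End Words.

(** * Oscillation under Markov operators *)

Section Oscillation.
Variables (R : realType) (k : nat) (P : 'M[R]_k) (T : Type) (X : set T).
Variable f : 'I_k -> T -> T.
Hypothesis P_stoch : stochastic P.
Hypothesis f_X : forall j x, X x -> X (f j x).
Local Notation C := R[i].
Implicit Types w : 'I_k -> T -> C.

(** The state space is abstract: the same estimates serve [U] and, after embedding real functions
    into complex ones, the closure of [V]. *)
Definition markov_op w : 'I_k -> T -> C := fun i x => \sum_j (P i j)%:C * w j (f j x).

Definition orb (s : seq 'I_k) x := foldl (fun x j => f j x) x s.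

Definition osc_le w (O : R) :=
  forall i j x y, X x -> X y -> normc (w i x - w j y) <= O.

(** The oscillation within one index, the only one that long words reduce; the spread between
    indices is left to [doeblin]. *)
Definition sosc_le w (S : R) :=
  forall i x y, X x -> X y -> normc (w i x - w i y) <= S.

Lemma markov_ext w w' : (forall i x, X x -> w i x = w' i x) ->
  forall i x, X x -> markov_op w i x = markov_op w' i x.
Proof. by move=> e i x Xx; apply: eq_bigr => j _; rewrite e//; exact: f_X. Qed.

Lemma markov_ext_iter N w w' : (forall i x, X x -> w i x = w' i x) ->
  forall i x, X x -> iter N markov_op w i x = iter N markov_op w' i x.
Proof. by move=> e; elim: N => // N IH; rewrite !iterS; exact: markov_ext. Qed.

Lemma markov_diff_iter N w w' (O : R) :
  (forall i x, X x -> normc (w i x - w' i x) <= O) ->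
  forall i x, X x -> normc (iter N markov_op w i x - iter N markov_op w' i x) <= O.
Proof.
move=> h; elim: N => // N IH i x Xx; rewrite !iterS /markov_op -sumrB.
have [P0 P1] := P_stoch; apply: le_trans (normc_sum _ _ _) _.
rewrite -[leRHS]mul1r -(P1 i) mulr_suml; apply: ler_sum => j _.
by rewrite -mulrBr normcM normc_real ger0_norm// ler_wpM2l// IH//; exact: f_X.
Qed.

(** Closed discs are convex and the operator takes averages. *)
Lemma markov_disc w c (O : R) : (forall i x, X x -> normc (w i x - c) <= O) ->
  forall i x, X x -> normc (markov_op w i x - c) <= O.
Proof.
move=> wc i x Xx; have [P0 P1] := P_stoch.
have -> : markov_op w i x - c = \sum_j (P i j)%:C * (w j (f j x) - c).
  under [RHS]eq_bigr do rewrite mulrBr.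
  by rewrite sumrB -mulr_suml -rmorph_sum P1 mul1r.
apply: le_trans (normc_sum _ _ _) _.
rewrite -[leRHS]mul1r -(P1 i) mulr_suml; apply: ler_sum => j _.
by rewrite normcM normc_real ger0_norm// ler_wpM2l// wc//; exact: f_X.
Qed.

Lemma markov_disc_iter N w c (O : R) : (forall i x, X x -> normc (w i x - c) <= O) ->
  forall i x, X x -> normc (iter N markov_op w i x - c) <= O.
Proof. by move=> wc; elim: N => //= N IH; exact: markov_disc. Qed.

Lemma markov_osc w O : osc_le w O -> osc_le (markov_op w) O.
Proof.
move=> wO i j x y Xx Xy; apply: markov_disc => // i' x' Xx'.
by rewrite normcB; apply: markov_disc => // j' y' Xy'; rewrite normcB; exact: wO.
Qed.

Lemma markov_osc_iter N w O : osc_le w O -> osc_le (iter N markov_op w) O.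
Proof. by move=> wO; elim: N => //= N IH; exact: markov_osc. Qed.

Lemma markov_osc_contract (delta : R) w O S : 0 <= delta ->
  (forall i j, delta <= P i j) -> osc_le w O -> sosc_le w S ->
  osc_le (markov_op w) (k%:R * delta * S + (1 - k%:R * delta) * O).
Proof.
move=> d0 dP wO wS i j x y Xx Xy; have [_ P1] := P_stoch.
rewrite -{1 2}(card_ord k).
apply: doeblin => //; [by move=> m; apply: wS; exact: f_X|].
by move=> m m'; apply: wO; exact: f_X.
Qed.

Lemma orb_X s x : X x -> X (orb s x).
Proof. by elim: s x => //= j s IH x Xx; apply: IH; exact: f_X. Qed.

(** From a common index both points are moved by the same words with the same weights, so the terms
    are compared word by word. *)
Lemma markov_sosc_iter N w S x y : X x -> X y ->
  (forall s i, size s = N -> normc (w i (orb s x) - w i (orb s y)) <= S) ->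
  forall i, normc (iter N markov_op w i x - iter N markov_op w i y) <= S.
Proof.
elim: N x y => [|N IH] x y Xx Xy wS i; first exact: (wS [::]).
rewrite !iterS /markov_op -sumrB; have [P0 P1] := P_stoch.
apply: le_trans (normc_sum _ _ _) _.
rewrite -[leRHS]mul1r -(P1 i) mulr_suml; apply: ler_sum => j _.
rewrite -mulrBr normcM normc_real ger0_norm// ler_wpM2l//.
apply: IH; try exact: f_X.
by move=> s l sN; apply: (wS (j :: s)); rewrite /= sN.
Qed.

Lemma stochastic_lower_bound : (0 < k)%N -> positive_mx P ->
  exists delta : R, [/\ 0 < delta, 0 < k%:R * delta <= 1 & forall i j, delta <= P i j].
Proof.
move=> k0 Ppos; have [_ P1] := P_stoch.
have [d d0 hd] := @fin_lower_bound R ('I_k * 'I_k)%type (fun t => P t.1 t.2) (fun t => Ppos _ _).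
have dP i j : d <= P i j by exact: (hd (i, j)).
exists d; split=> //; rewrite mulr_gt0 ?ltr0n//=.
have -> : k%:R * d = \sum_(j < k) d by rewrite sumr_const card_ord mulr_natl.
by rewrite -(P1 (Ordinal k0)); apply: ler_sum => j _; exact: dP.
Qed.

(** The version for continuous functions: the spread within an index is eventually small, rather
    than reduced by a fixed factor. *)
Lemma osc_decay w (O0 : R) : (0 < k)%N -> positive_mx P -> osc_le w O0 ->
  (forall e : R, 0 < e -> exists N0, forall N, (N0 <= N)%N -> sosc_le (iter N markov_op w) e) ->
  forall e : R, 0 < e -> exists N0, forall N, (N0 <= N)%N -> osc_le (iter N markov_op w) e.
Proof.
move=> k0 Ppos wO0 wS e e0.
have [d [d0 /andP[kd0 kd1] dP]] := stochastic_lower_bound k0 Ppos.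
have e2 : 0 < e / 2 by rewrite divr_gt0.
have [N0 hN0] := wS _ e2.
pose la := 1 - k%:R * d.
have la0 : 0 <= la by rewrite subr_ge0.
have la1 : la < 1 by rewrite ltrBlDl ltrDr.
(* e/2 is the fixed point of the recursion given by [markov_osc_contract] with S = e/2; the excess
   over it is multiplied by [la] at each step. *)
have step m : osc_le (iter (m + N0) markov_op w) (e / 2 + la ^+ m * `|O0|).
  elim: m => [|m IH].
    rewrite expr0 mul1r => i j x y Xx Xy.
    apply: le_trans (markov_osc_iter N0 wO0 _ _ Xx Xy) _.
    by rewrite (le_trans (ler_norm O0))// lerDr ltW.
  have := markov_osc_contract (ltW d0) dP IH (hN0 _ (leq_addl m N0)).
  have -> : k%:R * d * (e / 2) + (1 - k%:R * d) * (e / 2 + la ^+ m * `|O0|) =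
    e / 2 + la ^+ m.+1 * `|O0| by rewrite exprS /la; move: (la ^+ m) => u; ring.
  by [].
have /cvgrPdist_lt /(_ (e / 2 / (`|O0| + 1))) : (fun m => la ^+ m) @ \oo --> (0 : R).
  by apply: cvg_expr; rewrite ger0_norm.
case=> [|m _ hm]; first by rewrite divr_gt0// ltr_wpDl.
exists (m + N0)%N => N mN i j x y Xx Xy.
rewrite -(subnK (leq_trans (leq_addl m N0) mN)).
apply: le_trans (step _ _ _ _ _ Xx Xy) _.
have mNN0 : (m <= N - N0)%N by rewrite leq_subRL 1?addnC// (leq_trans (leq_addl m N0) mN).
have := hm (N - N0)%N mNN0.
rewrite /= sub0r normrN ger0_norm ?exprn_ge0// ltr_pdivlMr ?ltr_wpDl// => h.
have : 0 <= la ^+ (N - N0) by rewrite exprn_ge0.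
by move: h; rewrite mulrDr mulr1; lra.
Qed.

End Oscillation.

(** * The transfer operator on analytic functions *)

Section AnalyticComposition.
Variables (R : realType) (n : nat).
Local Notation C := R[i].

Lemma unif_poly_map_small m (F : 'rV[C]_n -> 'rV[C]_m) z (d r : R) : 0 < d -> 0 < r ->
  (forall i, unif_poly (@coordf R n) (cpolydisc d) (fun h => F (z + h) 0 i)) ->
  exists2 d' : R, 0 < d' <= d &
    forall h, cpolydisc d' h -> forall i, normc (F (z + h) 0 i - F z 0 i) <= r.
Proof.
move=> d0 r0 uF.
have /choice[L hL] := fun i => unif_poly_lipschitz d0 (uF i).
pose K := 1 + \sum_i `|L i|.
have K0 : 0 < K by rewrite ltr_pwDl// sumr_ge0.
pose d' := Num.min (d / 2) (r / K).
have d'0 : 0 < d' by rewrite lt_min !divr_gt0.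
have d'd : d' <= d / 2 by rewrite ge_min lexx.
exists d'; first by rewrite d'0 (le_trans d'd)// ger_pMr// invf_le1// ler1n.
move=> h hd i; have := hL i d' h d'0 d'd hd; rewrite addr0 => /le_trans; apply.
apply: (@le_trans _ _ (K * d')).
  rewrite ler_pM2r// (le_trans (ler_norm _))// /K (bigD1 i)//= addrCA lerDl.
  by rewrite addr_ge0// sumr_ge0.
by rewrite mulrC -ler_pdivlMr// ge_min lexx orbT.
Qed.

Lemma analytic_comp m (F : 'rV[C]_n -> 'rV[C]_m) (w : 'rV[C]_m -> C) z :
  (exists2 d : R, 0 < d &
     forall i, unif_poly (@coordf R n) (cpolydisc d) (fun h => F (z + h) 0 i)) ->
  analytic_at w (F z) -> analytic_at (w \o F) z.
Proof.
move=> [d d0 uF] /analytic_unif_poly[r r0 uw].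
have [d' /andP[d'0 d'd] hd'] := unif_poly_map_small d0 r0 uF.
apply: (unif_poly_analytic d'0).
have cb := @coordf_bounded R n d'.
apply: (@unif_poly_eq _ _ _ _ _ ((fun h => w (F z + h)) \o (fun h => F (z + h) - F z))).
  by move=> h _ /=; rewrite [F z + _]addrC subrK.
apply: unif_poly_comp uw => // [i|h hd i]; last by rewrite mxE mxE; exact: hd'.
apply: (@unif_poly_eq _ _ _ _ _ (fun h => F (z + h) 0 i + - F z 0 i)).
  by move=> h _ /=; rewrite /coordf mxE mxE.
apply: unif_poly_add; last exact: unif_poly_cst.
by apply: unif_poly_sub (uF i) => h hd j; exact: le_trans (hd j) d'd.
Qed.

Lemma analytic_continuous (w : 'rV[C]_n -> C) z (e : R) : analytic_at w z -> 0 < e ->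
  exists2 d : R, 0 < d & forall y, cdist_lt d y z -> normc (w y - w z) < e.
Proof.
move=> /analytic_unif_poly[r r0 uw] e0; have [L hL] := unif_poly_lipschitz r0 uw.
pose d := Num.min (r / 2) (e / (`|L| + 1)).
have L0 : 0 < `|L| + 1 by rewrite ltr_wpDl.
have d0 : 0 < d by rewrite lt_min !divr_gt0.
exists d => // y yz; have := hL d (y - z) d0.
rewrite ge_min lexx => /(_ isT); rewrite addr0 [z + _]addrC subrK => h.
apply: le_lt_trans (h _) _.
  by move=> i; rewrite mxE mxE ltW//; exact: yz.
apply: (@lt_le_trans _ _ ((`|L| + 1) * d)).
  by rewrite ltr_pM2r// (le_lt_trans (ler_norm _))// ltrDl.
by rewrite mulrC -ler_pdivlMr// ge_min lexx orbT.
Qed.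

End AnalyticComposition.

Section HatContinuity.
Variables (R : realType) (n k : nat) (M : 'I_k -> 'M[R]_(1 + n)).
Hypothesis M_pos : forall i, positive_mx (M i).
Local Notation C := R[i].

Lemma av_polyfun (z : 'rV[C]_n) l : polyfun (@coordf R n) (fun h => av (z + h) l).
Proof.
rewrite -(fintype.splitK l); case: (fintype.split l) => i /=.
  by apply: polyfun_ext (polyfun_cst _ 1) => h; rewrite av_lshift.
apply: polyfun_ext (polyfun_add (polyfun_cst _ (z 0 i)) (polyfun_coord _ i)) => h.
by rewrite av_rshift mxE.
Qed.

Lemma av_form_polyfun (x : 'I_(1 + n) -> R) (z : 'rV[C]_n) :
  polyfun (@coordf R n) (fun h => \sum_l (x l)%:C * av (z + h) l).
Proof.
by apply: polyfun_sum => l; apply: polyfun_mul (polyfun_cst _ _) (av_polyfun z l).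
Qed.

(** Nonnegative real parts are asked so that boundary points of [U] are covered: the entry 1 of the
    homogeneous vector still gives the denominator a positive real part. *)
Lemma hatc_unif_poly j (z : 'rV[C]_n) : (forall i, 0 <= complex.Re (z 0 i)) ->
  exists2 d : R, 0 < d &
     forall i, unif_poly (@coordf R n) (cpolydisc d) (fun h => hatc M j (z + h) 0 i).
Proof.
move=> z0; pose x := M j (lshift n 0); pose den h := \sum_l (x l)%:C * av (z + h) l.
have x0 l : 0 < x l by exact: M_pos.
have az l : 0 <= complex.Re (av z l).
  by rewrite -(fintype.splitK l); case: (fintype.split l) => i /=;
    rewrite ?av_lshift ?av_rshift//= ler01.
pose X := \sum_l (x l)%:C * av z l.
have X0 : X != 0.
  apply/eqP => /(congr1 (@complex.Re R)); rewrite raddf_sum /=.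
  have E l : complex.Re ((x l)%:C * av z l) = x l * complex.Re (av z l).
    by case: (av z l) => a b /=; rewrite mul0r subr0.
  under eq_bigr do rewrite E.
  apply/eqP; rewrite gt_eqF// (bigD1 (lshift n 0))//= av_lshift mulr1 ltr_pwDl// sumr_ge0// => l _.
  by rewrite mulr_ge0// ltW.
have Xp : 0 < normc X by rewrite normc_gt0.
have sx : 0 < \sum_l x l.
  by rewrite (bigD1 (lshift n 0))//= ltr_pwDl// sumr_ge0// => l _; exact: ltW.
(* On this polydisc the denominator moves by at most half of its modulus at [z], as [unif_poly_inv]
   requires. *)
pose d := normc X / (2 * \sum_l x l).
have d0 : 0 < d by rewrite divr_gt0// mulr_gt0.
exists d => // i; have cb := @coordf_bounded R n d.
pose g h := (den h - X) / X.
have uden : unif_poly (@coordf R n) (cpolydisc d) den.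
  exact/polyfun_unif_poly/av_form_polyfun.
have ug : unif_poly (@coordf R n) (cpolydisc d) g.
  by apply: unif_poly_mul => //; [apply: unif_poly_add => //|]; exact: unif_poly_cst.
have g2 h : cpolydisc d h -> normc (g h) <= 2^-1.
  move=> hd; rewrite /g normcM normcV ler_pdivrMr//.
  have -> : den h - X = \sum_l (x l)%:C * (av (z + h) l - av z l).
    by rewrite -sumrB; apply: eq_bigr => l _; rewrite mulrBr.
  apply: le_trans (normc_sum _ _ _) _.
  apply: (@le_trans _ _ (\sum_l x l * d)).
    apply: ler_sum => l _; rewrite normcM normc_real gtr0_norm// ler_pM2l//.
    rewrite -(fintype.splitK l); case: (fintype.split l) => i' /=.
      by rewrite !av_lshift subrr normc0 ltW.
    by rewrite !av_rshift addmx_subE.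
  rewrite -mulr_suml /d mulrC.
  by rewrite le_eqVlt; apply/orP; left; apply/eqP; field; rewrite gt_eqF.
apply: (@unif_poly_eq _ _ _ _ _ (fun h =>
    (\sum_l (M j (rshift 1 i) l)%:C * av (z + h) l) * (X^-1 * (1 + g h)^-1))).
  move=> h hd; rewrite /hatc hat_ratio /wratio -invfM; congr (_ / _).
  by rewrite mulrDr mulr1 /g mulrCA divff// mulr1 addrC subrK.
apply: unif_poly_mul => //; first exact/polyfun_unif_poly/av_form_polyfun.
by apply: unif_poly_mul => //; [exact: unif_poly_cst|exact: unif_poly_inv].
Qed.

Lemma hatc_continuous j (z : 'rV[C]_n) (e : R) : (forall i, 0 <= complex.Re (z 0 i)) ->
  0 < e -> exists2 d : R, 0 < d &
    forall y, cdist_lt d y z -> cdist_lt e (hatc M j y) (hatc M j z).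
Proof.
move=> z0 e0; have [d d0 ud] := hatc_unif_poly j z0.
have e2 : 0 < e / 2 by rewrite divr_gt0.
have [d' /andP[d'0 _] hd'] := unif_poly_map_small d0 e2 ud.
exists d' => // y yz i; have := hd' (y - z); rewrite [z + _]addrC subrK => h.
apply: le_lt_trans (h _ _) _; last by rewrite ltr_pdivrMr// ltr_pMr// ltr1n.
by move=> l; rewrite mxE mxE ltW//; exact: yz.
Qed.

End HatContinuity.

Section AinfOperator.
Variables (R : realType) (n k : nat) (M : 'I_k -> 'M[R]_(1 + n)).
Hypothesis M_pos : forall i, positive_mx (M i).
Local Notation C := R[i].
Variable U : set 'rV[C]_n.
Hypothesis U_open : open U.
Hypothesis U_bounded : bounded_set U.
Hypothesis U_pos : forall z, U z -> forall j, 0 < complex.Re (z 0 j).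
Hypothesis MU_sub : forall i, closure [set hat (cmx (M i)) z | z in U] `<=` U.

Lemma U_hatc j z : U z -> U (hatc M j z).
Proof. by move=> Uz; apply: (@MU_sub j (hatc M j z)); apply: subset_closure; exists z. Qed.

Lemma closure_U_pos z : closure U z -> forall i, 0 <= complex.Re (z 0 i).
Proof.
move=> zU i; rewrite leNgt; apply/negP => h.
have [|y [Uy yz]] := zU [set y | cdist_lt (- complex.Re (z 0 i)) y z].
  by apply/nbhs_rVcomplexP; exists (- complex.Re (z 0 i)); rewrite ?oppr_gt0.
have := yz i; have := normRe_le (y 0 i - z 0 i); rewrite raddfB /=.
have := U_pos Uy i; have := ler_norm (complex.Re (y 0 i) - complex.Re (z 0 i)).
by lra.
Qed.

(** This gives a composed function its continuous extension to the boundary: the closure of [U] is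
    sent into [U] itself, where [w] is analytic. *)
Lemma closure_U_hatc j z : closure U z -> U (hatc M j z).
Proof.
move=> zU; apply: (@MU_sub j (hatc M j z)) => B /nbhs_rVcomplexP[e e0 he].
have [d d0 hd] := hatc_continuous M_pos j (closure_U_pos zU) e0.
have [|y [Uy yz]] := zU [set y | cdist_lt d y z].
  by apply/nbhs_rVcomplexP; exists d.
exists (hatc M j y); split; first by exists y.
by apply: he; exact: hd.
Qed.

Lemma Ainf_analytic (w : Ainf U) : analytic_on U w.
Proof. by have /asboolP[_ ? _] := Ainf_valP w. Qed.

Lemma Ainf_out (w : Ainf U) z : ~ U z -> w z = 0.
Proof. by have /asboolP[+ _ _] := Ainf_valP w; apply. Qed.

Lemma Ainf_ext (u v : Ainf U) : (forall z, U z -> u z = v z) -> u = v.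
Proof.
move=> h; apply/val_inj/funext => z /=.
by have [Uz|nUz] := pselect (U z); [exact: h|rewrite !Ainf_out].
Qed.

Lemma Ainf_addE (u v : Ainf U) z : (u + v) z = u z + v z.
Proof. by []. Qed.

Lemma Ainf_scaleE (c : C) (v : Ainf U) z : (c *: v) z = c * v z.
Proof. by []. Qed.

Lemma Ainf_sumE (I : Type) (r : seq I) (F : I -> Ainf U) z :
  (\sum_(i <- r) F i) z = \sum_(i <- r) F i z.
Proof. by elim/big_rec2: _ => // i y1 y2 _ <-. Qed.

Lemma Ainf_bounded (w : Ainf U) : exists B : R, forall z, U z -> normc (w z) <= B.
Proof.
have /asboolP[_ _ [g cg gw]] := Ainf_valP w.
have cU := compact_closure_bounded U_bounded.
have [r r0 hr] : exists2 r : R, 0 < r & forall z, closure U z ->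
    closure U z -> normc (g z) * r <= 1.
  apply: (@compact_uniform_radius R 'rV[C]_n (closure U)
    (fun r z => closure U z -> normc (g z) * r <= 1)) => // [r r' z rr h /h|z zU].
    by apply: le_trans; rewrite ler_wpM2l ?normc_ge0.
  have [d d0 hd] := (within_continuous_complexP _ _).1 cg z zU _ ltr01.
  have K0 : 0 < normc (g z) + 1 by rewrite ltr_wpDl ?normc_ge0.
  exists (normc (g z) + 1)^-1; first by rewrite invr_gt0.
  apply/nbhs_rVcomplexP; exists d => // y yz yU.
  rewrite ler_pdivrMr// mul1r; have := normc_lerB (g y) (g z).
  by have := hd y yU yz; lra.
exists r^-1 => z Uz; rewrite -gw// -[leRHS]mul1r ler_pdivlMr//.
by apply: hr; exact: subset_closure.
Qed.

Lemma normA_ub (w : Ainf U) z : U z -> normc (w z) <= normA U w.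
Proof.
move=> Uz; have [B hB] := Ainf_bounded w; apply: ub_le_sup; last by exists z.
by exists B => _ [y Uy <-]; exact: hB.
Qed.

Lemma normA_le (w : Ainf U) (B : R) : U !=set0 ->
  (forall z, U z -> normc (w z) <= B) -> normA U w <= B.
Proof.
move=> [z0 Uz0] hB; apply: ge_sup; first by exists (normc (w z0)), z0.
by move=> _ [z Uz <-]; exact: hB.
Qed.

Lemma normA_ge0 (w : Ainf U) : U !=set0 -> 0 <= normA U w.
Proof. by move=> [z Uz]; apply: le_trans (normA_ub w Uz); exact: normc_ge0. Qed.

Definition comp_fun (w : 'rV[C]_n -> C) j z : C := if `[< U z >] then w (hatc M j z) else 0.

Lemma comp_funE w j z : U z -> comp_fun w j z = w (hatc M j z).
Proof. by move=> Uz; rewrite /comp_fun asboolT. Qed.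

Lemma analytic_at_hatc w j z : analytic_on U w -> closure U z ->
  analytic_at (fun y => w (hatc M j y)) z.
Proof.
move=> wU zU; apply: (@analytic_comp _ _ _ (hatc M j) w).
  by apply: hatc_unif_poly => //; exact: closure_U_pos.
by apply: wU; exact: closure_U_hatc.
Qed.

Lemma comp_fun_Ainf w j : analytic_on U w -> comp_fun w j \in @Ainf_pred R n U.
Proof.
move=> wU; apply/asboolP; split=> [z Uz|z Uz|].
- by rewrite /comp_fun asboolF.
- apply: near_analytic_at (analytic_at_hatc j wU (subset_closure Uz)).
  near=> y; rewrite comp_funE//.
  by near: y; exact: open_nbhs_nbhs.
- exists (fun y => w (hatc M j y)); last by move=> z Uz; rewrite comp_funE.
  apply/within_continuous_complexP => z zU e e0.
  have [d d0 hd] := analytic_continuous (analytic_at_hatc j wU zU) e0.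
  by exists d => // y _; exact: hd.
Unshelve. all: by end_near. Qed.

Definition compA w j (wU : analytic_on U w) : Ainf U := MkAinf (comp_fun_Ainf j wU).

Lemma compAE w j (wU : analytic_on U w) z : U z -> compA j wU z = w (hatc M j z).
Proof. exact: comp_funE. Qed.

Variable P : 'M[R]_k.

(** The input is any tuple analytic on [U], whatever its boundary behaviour; one step already lands
    in [Ainf]. In [block_surjective] this turns a pointwise limit into an element of the space. *)
Definition transfer_an (w : 'I_k -> 'rV[C]_n -> C) (wU : forall j, analytic_on U (w j)) :
    Ainfk k U :=
  [ffun i => \sum_j (P i j)%:C *: compA j (wU j)].

Lemma transfer_anE w (wU : forall j, analytic_on U (w j)) i z : U z ->
  transfer_an wU i z = markov_op P (hatc M) w i z.
Proof.
move=> Uz; rewrite ffunE Ainf_sumE; apply: eq_bigr => j _.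
by rewrite Ainf_scaleE compAE.
Qed.

Definition transferA_fun (w : Ainfk k U) : Ainfk k U :=
  transfer_an (fun j => Ainf_analytic (w j)).

Lemma transferA_linear : linear transferA_fun.
Proof.
move=> c u v; apply/ffunP => i; apply: Ainf_ext => z Uz.
have E w : transferA_fun w i z = \sum_j (P i j)%:C * w j (hatc M j z).
  by rewrite transfer_anE.
have -> : (c *: transferA_fun u + transferA_fun v) i z =
    c * transferA_fun u i z + transferA_fun v i z by rewrite ffunE ffunE.
rewrite !E mulr_sumr -big_split /=; apply: eq_bigr => j _.
by rewrite ffunE ffunE Ainf_addE Ainf_scaleE; ring.
Qed.

HB.instance Definition _ := GRing.isLinear.Build C (Ainfk k U) (Ainfk k U) _
  transferA_fun transferA_linear.

Definition transferA : {linear Ainfk k U -> Ainfk k U} := transferA_fun.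

Lemma transferAE w i z : U z ->
  transferA w i z = markov_op P (hatc M) (fun j => w j) i z.
Proof. exact: transfer_anE. Qed.

Lemma iter_transferAE N w i z : U z ->
  iter N transferA w i z = iter N (markov_op P (hatc M)) (fun j => w j) i z.
Proof.
elim: N i z => //= N IH i z Uz; rewrite transferAE//.
by apply: (@markov_ext _ _ P _ U) => //; exact: U_hatc.
Qed.

End AinfOperator.
Arguments transferA : simpl never.

(** * Uniform contraction of the oscillation by a power of the operator *)

Section SpectralGap.
Variables (R : realType) (n k : nat) (M : 'I_k -> 'M[R]_(1 + n)).
Hypothesis k_gt0 : (0 < k)%N.
Hypothesis M_pos : forall i, positive_mx (M i).
Local Notation C := R[i].
Variable U : set 'rV[C]_n.
Hypothesis U_open : open U.
Hypothesis U_bounded : bounded_set U.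
Hypothesis U_nonempty : U !=set0.
Hypothesis U_pos : forall z, U z -> forall j, 0 < complex.Re (z 0 j).
Hypothesis MU_sub : forall i, closure [set hat (cmx (M i)) z | z in U] `<=` U.

Lemma hatc_U_radius : exists2 r : R, 0 < r &
  forall j z, U z -> forall h, cpolydisc r h -> U (hatc M j z + h).
Proof.
pose K j := closure [set hatc M j z | z in U].
have cK j : compact (K j).
  apply: subclosed_compact (compact_closure_bounded U_bounded) _.
    exact: closed_closure.
  by move=> z /(@MU_sub j) Uz; exact: subset_closure.
have H j : exists r : R, 0 < r /\ forall z, U z -> forall h, cpolydisc r h -> U (hatc M j z + h).
  have [r r0 hr] : exists2 r : R, 0 < r &
      forall z, K j z -> forall h, cpolydisc r h -> U (z + h).
    apply: (@compact_uniform_radius R _ (K j)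
      (fun r z => forall h, cpolydisc r h -> U (z + h)) (cK j)) => [r r' z rr hU h hd|z].
      by apply: hU => i; exact: le_trans (hd i) rr.
    move=> /(@MU_sub j) Uz; have : nbhs z U by exact: open_nbhs_nbhs.
    move=> /nbhs_rVcomplexP[e e0 he]; exists (e / 4); first by rewrite divr_gt0.
    apply/nbhs_rVcomplexP; exists (e / 2); first by rewrite divr_gt0.
    move=> y yz h hd; apply: he => i; rewrite mxE.
    have := normcD (y 0 i - z 0 i) (h 0 i); have := yz i; have := hd i.
    by rewrite addrAC; move: e0; lra.
  by exists r; split=> // z Uz; apply: hr; apply: subset_closure; exists z.
have [r hr] := choice H.
have [a a0 ha] := fin_lower_bound (fun j => (hr j).1).
by exists a => // j z Uz h hd; apply: (hr j).2 => // i; exact: le_trans (hd i) (ha j).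
Qed.

Lemma hatc_U_bounds : exists B c0 : R, 0 < c0 /\
  forall j z, U z -> forall l, c0 <= complex.Re (av (hatc M j z) l) /\
                               normc (av (hatc M j z) l) <= B.
Proof.
have [B B0 hB] := bounded_rVcomplexP U_bounded.
have [r r0 hr] := hatc_U_radius.
exists (1 + B), (Num.min 1 r); split; first by rewrite lt_min ltr01.
move=> j z Uz l; rewrite -(fintype.splitK l); case: (fintype.split l) => i /=.
  by rewrite av_lshift; split; [rewrite /= ge_min lexx|rewrite normc1 lerDl ltW].
rewrite av_rshift; split; last first.
  by rewrite (le_trans (hB _ (U_hatc MU_sub _ Uz) i))// lerDr.
rewrite ge_min; apply/orP; right.
(* Moving the coordinate [i] by [- r] stays inside [U], where real parts are positive; hence the
   real part was at least [r]. *)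
pose h : 'rV[C]_n := \row_l (if l == i then (- r)%:C else 0).
have hd : cpolydisc r h.
  move=> l'; rewrite mxE; case: eqP => _; first by rewrite normc_real normrN gtr0_norm.
  by rewrite normc0 ltW.
have := U_pos (hr j z Uz h hd) i; rewrite !mxE eqxx raddfD /=.
by lra.
Qed.

Lemma act_rcons s j (z : 'rV[C]_n) : act M (rcons s j) z = hatc M j (act M s z).
Proof. by rewrite /act foldl_rcons. Qed.

(** A long word brings the two images within r/4 of each other, whereas a polydisc of radius [r]
    around one of them lies in [U]. The images are thus well inside a disc on which [w] oscillates
    by at most [S], and the Schwarz lemma applies. [N0] is independent of [w]. *)
Lemma act_half : exists N0, forall s, (N0 <= size s)%N -> forall (w : 'rV[C]_n -> C) (S : R),
  analytic_on U w -> (forall x y, U x -> U y -> normc (w x - w y) <= S) ->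
  forall z z', U z -> U z' -> normc (w (act M s z) - w (act M s z')) <= S / 2.
Proof.
have UH j z := @U_hatc R n k M U MU_sub j z.
have [B [c0 [c00 hb]]] := hatc_U_bounds.
have [r r0 hr] := hatc_U_radius.
have r4 : 0 < r / 4 by rewrite divr_gt0.
have [N1 hN1] := act_contract M_pos U_pos UH B c00 r4.
(* The extra first letter moves the points to where the bounds of [hatc_U_bounds] hold. *)
exists N1.+1 => s sN w S wU wS z z' Uz Uz'.
have S0 : 0 <= S by apply: le_trans (wS z z Uz Uz); exact: normc_ge0.
have [a Ea] : exists a, a = act M s z by exists (act M s z).
have [b Eb] : exists b, b = act M s z' by exists (act M s z').
rewrite -Ea -Eb.
have ab i : normc (a 0 i - b 0 i) < r / 4.
  rewrite Ea Eb; case: s sN {Ea Eb} => // j s sN; rewrite !act_cons.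
  apply: hN1 => //; try exact: UH.
  - by move=> l; have [] := hb j z Uz l.
  - by move=> l; have [] := hb j z' Uz' l.
  - by move=> l; have [] := hb j z Uz l.
  - by move=> l; have [] := hb j z' Uz' l.
have bU : U b by rewrite Eb; exact: act_U.
have hball h : cpolydisc r h -> U (b + h).
  rewrite Eb; case/lastP: s sN {Ea Eb ab} => // s j _; rewrite act_rcons.
  by apply: hr; exact: act_U.
(* With this direction [a] is the point of parameter 1/4 on the disc centred at [b]. *)
pose v := 4%:R *: (a - b).
have vr (t : C) : normc t <= 1 -> cpolydisc r (t *: v).
  move=> t1 i; rewrite !mxE normcM normcM normc_nat.
  apply: (@le_trans _ _ (1 * (4 * (r / 4)))); last by rewrite mul1r mulrC divfK.
  rewrite ler_pM ?mulr_ge0 ?normc_ge0// ler_pM2l//.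
  exact/ltW/ab.
have Uv t : normc t <= 1 -> U (b + t *: v) by move=> /vr; exact: hball.
have t4 : normc (4%:R^-1 : C) = 4^-1 by rewrite normcV normc_nat.
have t41 : normc (4%:R^-1 : C) <= 1 by rewrite t4 invf_le1 ?ler1n.
have := @schwarz_sqrt _ _ w b v S S0 (fun t t1 => wU _ (Uv t t1)) (fun t t1 => wS _ _ (Uv t t1) bU) _ t41.
rewrite t4 /v scalerA mulVf ?pnatr_eq0// scale1r [b + _]addrC subrK => h.
rewrite -(@ler_pXn2r _ 2)// ?nnegrE ?normc_ge0 ?divr_ge0//.
by apply: le_trans h _; rewrite le_eqVlt; apply/orP; left; apply/eqP; field.
Qed.

Lemma act_diam (e : R) : 0 < e -> exists N0, forall s, (N0 <= size s)%N ->
  forall z z', U z -> U z' -> forall i, normc (act M s z 0 i - act M s z' 0 i) < e.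
Proof.
move=> e0; have UH j z := @U_hatc R n k M U MU_sub j z.
have [B [c0 [c00 hb]]] := hatc_U_bounds.
have [N0 hN0] := act_contract M_pos U_pos UH B c00 e0.
exists N0.+1 => -[//|j s] Ns z z' Uz Uz' i; rewrite !act_cons.
apply: hN0 => //; try exact: UH.
- by move=> l; have [] := hb j z Uz l.
- by move=> l; have [] := hb j z' Uz' l.
- by move=> l; have [] := hb j z Uz l.
- by move=> l; have [] := hb j z' Uz' l.
Qed.

Variables (P : 'M[R]_k) (q : 'rV[R]_k).
Hypothesis P_stoch : stochastic P.
Hypothesis P_pos : positive_mx P.
Hypothesis q_stat : stationary P q.

Local Notation T := (transferA M_pos U_open U_pos MU_sub P).
Local Notation oscA w := (osc_le U (fun j => w j)).
Local Notation UH := (U_hatc MU_sub).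

(** [N0] steps halve the spread within each index, and one more step mixes the indices: k d (O/2) +
    (1 - k d) O = (1 - k d/2) O. *)
Lemma block_contraction : exists N1 (ka : R), [/\ (0 < N1)%N, 0 <= ka < 1 &
  forall (w : Ainfk k U) O, oscA w O -> oscA (iter N1 T w) (ka * O)].
Proof.
have [N0 hN0] := act_half.
have [d [d0 /andP[kd0 kd1] dP]] := stochastic_lower_bound P_stoch k_gt0 P_pos.
exists N0.+1, (1 - k%:R * d / 2); split=> //.
  by apply/andP; split; [move: kd1; lra|move: kd0; lra].
move=> w O wO i j x y Xx Xy; rewrite !iter_transferAE// !iterS.
have O1 := markov_osc_iter P_stoch UH N0 wO.
have S1 : sosc_le U (iter N0 (markov_op P (hatc M)) (fun j => w j)) (O / 2).
  move=> i' x' y' Ux' Uy'; apply: (markov_sosc_iter P_stoch UH) => // s l sN.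
  apply: (@hN0 s _ (w l) O) => //; first by rewrite sN.
    exact: Ainf_analytic.
  by move=> u v Uu Uv; exact: wO.
have := markov_osc_contract P_stoch UH (ltW d0) dP O1 S1 i j Xx Xy.
by move/le_trans; apply; rewrite le_eqVlt; apply/orP; left; apply/eqP; field.
Qed.

Lemma stationary_gt0 i : 0 < q 0 i.
Proof.
have [q0 q1 qP] := q_stat.
have [l ql] : exists l, 0 < q 0 l.
  apply/not_existsP => h; have : \sum_i q 0 i = 0.
    by rewrite big1// => l _; apply/eqP; rewrite eq_le q0 andbT leNgt; apply/negP; exact: h.
  by rewrite q1 => /eqP; rewrite oner_eq0.
rewrite -qP mxE (bigD1 l)//= ltr_pwDl ?mulr_gt0// sumr_ge0// => m _.
by rewrite mulr_ge0// ltW.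
Qed.

Lemma normAk_ge0 (w : Ainfk k U) : 0 <= normAk q U w.
Proof.
by rewrite sumr_ge0// => i _; rewrite mulr_ge0 ?normA_ge0// ltW// stationary_gt0.
Qed.

Lemma normA_le_normAk : exists2 c : R, 0 < c &
  forall (w : Ainfk k U) i, normA U (w i) <= c * normAk q U w.
Proof.
have [a a0 ha] := fin_lower_bound stationary_gt0.
exists a^-1 => [|w i]; first by rewrite invr_gt0.
rewrite mulrC ler_pdivlMr// mulrC; apply: (@le_trans _ _ (q 0 i * normA U (w i))).
  by rewrite ler_wpM2r ?normA_ge0.
rewrite /normAk (bigD1 i)//= lerDl sumr_ge0// => j _.
by rewrite mulr_ge0 ?normA_ge0// ltW// stationary_gt0.
Qed.

Lemma osc_normAk : exists2 c : R, 0 < c &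
  forall w : Ainfk k U, oscA w (c * normAk q U w).
Proof.
have [c c0 hc] := normA_le_normAk; exists (2 * c); first by rewrite mulr_gt0.
move=> w i j x y Ux Uy; apply: le_trans (normcD _ _) _; rewrite normcNE.
have := hc w i; have := hc w j; have := normA_ub U_bounded (w i) Ux.
by have := normA_ub U_bounded (w j) Uy; lra.
Qed.

Lemma osc_iter_small (w : Ainfk k U) (e : R) : 0 < e ->
  exists N0, forall N, (N0 <= N)%N -> oscA (iter N T w) e.
Proof.
move=> e0; have [N1 [ka [N10 /andP[ka0 ka1] hka]]] := block_contraction.
have [c c0 hc] := osc_normAk; pose O := c * normAk q U w.
have O0 : 0 <= O by rewrite mulr_ge0 ?normAk_ge0// ltW.
have hm m : oscA (iter (m * N1) T w) (ka ^+ m * O).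
  elim: m => [|m IH]; first by rewrite expr0 mul1r; exact: hc.
  by rewrite mulSn iterD exprS -mulrA; exact: hka.
have /cvgrPdist_lt /(_ (e / (O + 1))) : (fun m => ka ^+ m) @ \oo --> (0 : R).
  by apply: cvg_expr; rewrite ger0_norm.
case=> [|m _ hm2]; first by rewrite divr_gt0// ltr_wpDl.
exists (m * N1)%N => N mN i j x y Ux Uy.
rewrite -(subnK mN) iterD !iter_transferAE//.
apply: (markov_osc_iter P_stoch UH) => // i' j' x' y' Ux' Uy'.
apply: le_trans (hm m i' j' x' y' Ux' Uy') _.
have := hm2 m (leqnn m); rewrite /= sub0r normrN ger0_norm ?exprn_ge0//.
rewrite ltr_pdivlMr ?ltr_wpDl// => h; have : 0 <= ka ^+ m by rewrite exprn_ge0.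
by move: h; rewrite mulrDr mulr1; lra.
Qed.

(** The norm is weighted by [q] precisely for this: after exchanging the sums, the weight of the
    component [j] is the [j]-th entry of [q *m P], that is [q 0 j]. *)
Lemma normAk_transfer (w : Ainfk k U) : normAk q U (T w) <= normAk q U w.
Proof.
have [q0 q1 qP] := q_stat; have [P0 P1] := P_stoch.
apply: (@le_trans _ _ (\sum_i q 0 i * \sum_j P i j * normA U (w j))).
  apply: ler_sum => i _; rewrite ler_wpM2l//; apply: normA_le => // z Uz.
  rewrite transferAE//; apply: le_trans (normc_sum _ _ _) _; apply: ler_sum => j _.
  by rewrite normcM normc_real ger0_norm// ler_wpM2l// normA_ub//; exact: UH.
under eq_bigr do rewrite mulr_sumr.
rewrite exchange_big /=; apply: ler_sum => j _.
under eq_bigr do rewrite mulrA.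
by rewrite -mulr_suml -[in leRHS]qP mxE.
Qed.

Lemma normAk_iter N (w : Ainfk k U) : normAk q U (iter N T w) <= normAk q U w.
Proof. by elim: N => //= N IH; apply: le_trans (normAk_transfer _) IH. Qed.

End SpectralGap.

(** * Spectrum and invariant functionals *)

Section ResolventCriterion.
Variables (R : realType) (E : lmodType R[i]) (nE : E -> R) (T : {linear E -> E}) (l : R[i]).

Lemma shift_op_linear (a : R[i]) (u v : E) :
  shift_op T l (a *: u + v) = a *: shift_op T l u + shift_op T l v.
Proof.
rewrite /shift_op linearP scalerDr scalerBr opprD !scalerA [l * a]mulrC.
by rewrite addrACA.
Qed.

(** The inverse is chosen pointwise; injectivity makes it linear, and the lower bound makes it
    bounded. *)
Lemma resolvent_setP : (exists c, forall x, nE x <= c * nE (shift_op T l x)) ->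
  (forall x, shift_op T l x = 0 -> x = 0) ->
  (forall y, exists x, shift_op T l x = y) -> resolvent_set nE T l.
Proof.
move=> [c hc] inj /choice[S0 hS].
have inj' x y : shift_op T l x = shift_op T l y -> x = y.
  move=> e; apply/eqP; rewrite -subr_eq0; apply/eqP/inj.
  by rewrite addrC -scaleN1r shift_op_linear e scaleN1r addrC subrr.
have linS : linear S0.
  by move=> a u v; apply: inj'; rewrite shift_op_linear !hS.
pose lS := GRing.isLinear.Build R[i] E E _ S0 linS.
pose S : {linear E -> E} := HB.pack S0 lS.
exists S; split=> [|x|x]; last 2 first.
- exact: hS.
- by apply: inj'; rewrite hS.
by exists c => x; rewrite -{2}(hS x); exact: hc.
Qed.

End ResolventCriterion.

Section InvariantFunctional.
Variables (R : realType) (n k : nat) (M : 'I_k -> 'M[R]_(1 + n)).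
Hypothesis k_gt0 : (0 < k)%N.
Hypothesis M_pos : forall i, positive_mx (M i).
Local Notation C := R[i].
Variable U : set 'rV[C]_n.
Hypothesis U_open : open U.
Hypothesis U_bounded : bounded_set U.
Hypothesis U_nonempty : U !=set0.
Hypothesis U_pos : forall z, U z -> forall j, 0 < complex.Re (z 0 j).
Hypothesis MU_sub : forall i, closure [set hat (cmx (M i)) z | z in U] `<=` U.
Variables (P : 'M[R]_k) (q : 'rV[R]_k).
Hypothesis P_stoch : stochastic P.
Hypothesis P_pos : positive_mx P.
Hypothesis q_stat : stationary P q.

Local Notation T := (transferA M_pos U_open U_pos MU_sub P).
Local Notation oscA w := (osc_le U (fun j => w j)).
Local Notation UH := (U_hatc MU_sub).
Local Notation nuN := (normAk q U).
Local Notation osc_small := (osc_iter_small k_gt0 M_pos U_open U_bounded U_nonempty U_pos MU_sub P_stoch P_pos q_stat).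

Lemma Ainfk_ext (u v : Ainfk k U) : (forall i z, U z -> u i z = v i z) -> u = v.
Proof. by move=> h; apply/ffunP => i; apply: Ainf_ext => z; exact: h. Qed.

Lemma Ainfk_addE (u v : Ainfk k U) i z : (u + v) i z = u i z + v i z.
Proof. by rewrite ffunE. Qed.

Lemma Ainfk_scaleE (c : C) (v : Ainfk k U) i z : (c *: v) i z = c * v i z.
Proof. by rewrite ffunE. Qed.

Lemma Ainfk_subE (u v : Ainfk k U) i z : (u - v) i z = u i z - v i z.
Proof. by rewrite ffunE ffunE. Qed.

Lemma Ainfk_sumE (I : Type) (r : seq I) (F : I -> Ainfk k U) i z :
  (\sum_(m <- r) F m) i z = \sum_(m <- r) F m i z.
Proof.
elim: r => [|m r IH]; first by rewrite !big_nil ffunE.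
by rewrite !big_cons Ainfk_addE IH.
Qed.

Lemma cst_vecE c i z : U z -> cst_vec k U_open c i z = c.
Proof. by move=> Uz; rewrite ffunE /= /Acst_fun asboolT. Qed.

(** Later iterates take values in any disc that contains the values of an earlier one, so decay of
    the oscillation alone makes the values a Cauchy sequence with a limit common to all indices and
    points. *)
Lemma nu_exists (w : Ainfk k U) : exists c : C, forall e : R, 0 < e ->
  exists N0, forall N, (N0 <= N)%N -> forall i z, U z -> normc (iter N T w i z - c) <= e.
Proof.
have [z0 Uz0] := U_nonempty; pose i0 := Ordinal k_gt0.
have key e : 0 < e -> exists N0, forall N m, (N0 <= N)%N -> (N0 <= m)%N ->
    forall i j z y, U z -> U y -> normc (iter N T w i z - iter m T w j y) <= e.
  move=> e0; have e2 : 0 < e / 2 by rewrite divr_gt0.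
  have [N0 hN0] := osc_small w e2.
  exists N0 => N m N0N N0m i j z y Uz Uy.
  have near0 N' i' z' : (N0 <= N')%N -> U z' ->
      normc (iter N' T w i' z' - iter N0 T w i0 z0) <= e / 2.
    move=> N0N' Uz'; rewrite -(subnK N0N') iterD iter_transferAE//.
    apply: (markov_disc_iter P_stoch UH) => // i'' z'' Uz''.
    exact: hN0.
  apply: le_trans (normc_dist3 _ (iter N0 T w i0 z0) _) _.
  rewrite [e]splitr lerD ?near0//.
  by rewrite normcB near0.
have [c hc] : exists c : C, forall e : R, 0 < e -> exists N, forall m, (N <= m)%N ->
    normc (iter m T w i0 z0 - c) < e.
  apply: complex_lim => e e0; have e2 : 0 < e / 2 by rewrite divr_gt0.
  have [N hN] := key _ e2; exists N => p m pN mN.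
  by apply: le_lt_trans (hN p m pN mN _ _ _ _ Uz0 Uz0) _; rewrite ltr_pdivrMr// ltr_pMr// ltr1n.
exists c => e e0; have e2 : 0 < e / 2 by rewrite divr_gt0.
have [N1 h1] := key _ e2; have [N2 h2] := hc _ e2.
exists (maxn N1 N2) => N; rewrite geq_max => /andP[N1N N2N] i z Uz.
apply: le_trans (normc_dist3 _ (iter N T w i0 z0) _) _.
rewrite [e]splitr lerD ?h1//.
exact/ltW/h2.
Qed.

Definition nuf (w : Ainfk k U) : C := sval (cid (nu_exists w)).

Lemma nuf_lim (w : Ainfk k U) (e : R) : 0 < e -> exists N0, forall N, (N0 <= N)%N ->
  forall i z, U z -> normc (iter N T w i z - nuf w) <= e.
Proof. exact: (svalP (cid (nu_exists w))). Qed.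

Lemma nuf_unique (w : Ainfk k U) (c : C) i z : U z ->
  (forall e : R, 0 < e -> exists N0, forall N, (N0 <= N)%N -> normc (iter N T w i z - c) <= e) ->
  nuf w = c.
Proof.
move=> Uz hc; apply/eqP; rewrite -subr_eq0; apply/eqP/normc_lt_eps0 => e e0.
have e2 : 0 < e / 2 by rewrite divr_gt0.
have [N1 h1] := nuf_lim w e2; have [N2 h2] := hc _ e2.
have := h1 _ (leq_maxl N1 N2) i z Uz; have := h2 _ (leq_maxr N1 N2).
have := normc_dist3 (nuf w) (iter (maxn N1 N2) T w i z) c.
by rewrite (normcB (nuf w) (iter _ T w i z)); lra.
Qed.

Lemma nuf_linear : scalar nuf.
Proof.
move=> a u v; have [z Uz] := U_nonempty; pose i := Ordinal k_gt0.
apply: (nuf_unique (i := i) Uz) => e e0.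
have a1 : 0 < normc a + 1 by rewrite ltr_wpDl ?normc_ge0.
have eu : 0 < e / 2 / (normc a + 1) by rewrite divr_gt0 ?divr_gt0.
have ev : 0 < e / 2 by rewrite divr_gt0.
have [N1 h1] := nuf_lim u eu; have [N2 h2] := nuf_lim v ev.
exists (maxn N1 N2) => N; rewrite geq_max => /andP[N1N N2N].
have -> : iter N T (a *: u + v) = a *: iter N T u + iter N T v.
  by elim: N {N1N N2N} => // N; rewrite !iterS => ->; rewrite (linearP (transferA _ _ _ _ _)).
rewrite Ainfk_addE Ainfk_scaleE.
have -> : a * iter N T u i z + iter N T v i z - (a * nuf u + nuf v) =
  a * (iter N T u i z - nuf u) + (iter N T v i z - nuf v) by ring.
apply: le_trans (normcD _ _) _; rewrite [e]splitr; apply: lerD; last exact: h2.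
rewrite normcM; apply: (@le_trans _ _ ((normc a + 1) * (e / 2 / (normc a + 1)))).
  by rewrite ler_pM ?normc_ge0 ?h1// lerDl.
by rewrite mulrC divfK// gt_eqF.
Qed.

HB.instance Definition _ := GRing.isLinear.Build C (Ainfk k U) C _ nuf nuf_linear.

Lemma nuf_T (w : Ainfk k U) : nuf (T w) = nuf w.
Proof.
have [z Uz] := U_nonempty; pose i := Ordinal k_gt0.
apply: (nuf_unique (i := i) Uz) => e e0; have [N0 h] := nuf_lim w e0.
by exists N0 => N N0N; rewrite -iterSr; apply: h => //; exact: leqW.
Qed.

Lemma nuf_iter N (w : Ainfk k U) : nuf (iter N T w) = nuf w.
Proof. by elim: N => // N IH; rewrite iterS nuf_T. Qed.

Lemma T_cst c : T (cst_vec k U_open c) = cst_vec k U_open c.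
Proof.
apply: Ainfk_ext => i z Uz; rewrite transferAE// cst_vecE// /markov_op.
rewrite (eq_bigr (fun j => (P i j)%:C * c)); last first.
  by move=> j _; rewrite cst_vecE//; exact: UH.
have [_ P1] := P_stoch; by rewrite -mulr_suml -rmorph_sum P1 mul1r.
Qed.

Lemma nuf_cst c : nuf (cst_vec k U_open c) = c.
Proof.
have [z Uz] := U_nonempty; pose i := Ordinal k_gt0.
apply: (nuf_unique (i := i) Uz) => e e0; exists 0%N => N _.
have -> : iter N T (cst_vec k U_open c) = cst_vec k U_open c.
  by elim: N => // N IH; rewrite iterS IH; exact: T_cst.
by rewrite cst_vecE// subrr normc0 ltW.
Qed.

Lemma nuf_osc (w : Ainfk k U) O i z : oscA w O -> U z -> normc (w i z - nuf w) <= O.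
Proof.
move=> wO Uz; apply/ler_addgt0Pr => e e0; have [N0 h] := nuf_lim w e0.
apply: le_trans (normc_dist3 _ (iter N0 T w i z) _) _; apply: lerD; last exact: h.
rewrite normcB iter_transferAE//; apply: (markov_disc_iter P_stoch UH) => // j y Uy.
exact: wO.
Qed.

Lemma nuf_le (w : Ainfk k U) : normc (nuf w) <= nuN w.
Proof.
have [q0 q1 qP] := q_stat; have [z Uz] := U_nonempty.
apply/ler_addgt0Pr => e e0; have [N0 h] := nuf_lim w e0.
have h1 : normc (\sum_i (q 0 i)%:C * iter N0 T w i z) <= nuN w.
  apply: le_trans (normAk_iter M_pos U_open U_bounded U_nonempty U_pos MU_sub P_stoch q_stat N0 w).
  apply: le_trans (normc_sum _ _ _) _; apply: ler_sum => i _.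
  by rewrite normcM normc_real ger0_norm// ler_wpM2l// normA_ub.
have h2 : normc (\sum_i (q 0 i)%:C * iter N0 T w i z - nuf w) <= e.
  have -> : \sum_i (q 0 i)%:C * iter N0 T w i z - nuf w =
      \sum_i (q 0 i)%:C * (iter N0 T w i z - nuf w).
    under [RHS]eq_bigr do rewrite mulrBr.
    by rewrite sumrB -mulr_suml -rmorph_sum q1 mul1r.
  apply: le_trans (normc_sum _ _ _) _.
  rewrite -[leRHS]mul1r -q1 mulr_suml; apply: ler_sum => i _.
  by rewrite normcM normc_real ger0_norm// ler_wpM2l// h.
have := normc_lerB (nuf w) (\sum_i (q 0 i)%:C * iter N0 T w i z).
by rewrite normcB; lra.
Qed.

Lemma fixed_cst (w : Ainfk k U) : T w = w -> w = cst_vec k U_open (nuf w).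
Proof.
move=> Tw; apply: Ainfk_ext => i z Uz; rewrite cst_vecE//.
apply/eqP; rewrite -subr_eq0; apply/eqP/normc_lt_eps0 => e e0.
have [N0 h] := nuf_lim w e0; have := h N0 (leqnn _) i z Uz.
suff -> : iter N0 T w = w by [].
by elim: N0 {h} => //= N ->.
Qed.

Lemma cst_vecZ c : cst_vec k U_open c = c *: cst_vec k U_open 1.
Proof. by apply: Ainfk_ext => i z Uz; rewrite Ainfk_scaleE !cst_vecE// mulr1. Qed.

Lemma normA_cst c : normA U (Acst U_open c) = normc c.
Proof.
have [z Uz] := U_nonempty; apply/eqP; rewrite eq_le; apply/andP; split.
  by apply: normA_le => // y Uy; rewrite /= /Acst_fun asboolT.
by have := normA_ub U_bounded (Acst U_open c) Uz; rewrite /= /Acst_fun asboolT.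
Qed.

Lemma normAk_cst c : nuN (cst_vec k U_open c) = normc c.
Proof.
have [q0 q1 qP] := q_stat; rewrite /normAk.
under eq_bigr do rewrite ffunE normA_cst.
by rewrite -mulr_suml q1 mul1r.
Qed.

Lemma cst1_neq0 : cst_vec k U_open 1 <> 0.
Proof.
have [z Uz] := U_nonempty; pose i := Ordinal k_gt0.
move=> /(congr1 (fun w : Ainfk k U => w i z)); rewrite cst_vecE// ffunE => /eqP.
by rewrite oner_eq0.
Qed.

Lemma T_scale (a : C) (u : Ainfk k U) : T (a *: u) = a *: T u.
Proof. exact: linearZ. Qed.

Lemma T_add (u v : Ainfk k U) : T (u + v) = T u + T v.
Proof. exact: linearD. Qed.

Lemma T_sub (u v : Ainfk k U) : T (u - v) = T u - T v.
Proof. exact: linearB. Qed.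

Lemma T_sum (I : Type) (r : seq I) (F : I -> Ainfk k U) :
  T (\sum_(m <- r) F m) = \sum_(m <- r) T (F m).
Proof. exact: linear_sum. Qed.

Lemma nuf_scale (a : C) (u : Ainfk k U) : nuf (a *: u) = a * nuf u.
Proof. exact: linearZ. Qed.

Lemma nuf_sub (u v : Ainfk k U) : nuf (u - v) = nuf u - nuf v.
Proof. exact: linearB. Qed.

Definition osc_set (w : Ainfk k U) : set R :=
  [set r | exists i j x y, [/\ U x, U y & r = normc (w i x - w j y)]].

Lemma osc_set_has_sup (w : Ainfk k U) : has_sup (osc_set w).
Proof.
have [z Uz] := U_nonempty; pose i := Ordinal k_gt0; split.
  by exists (normc (w i z - w i z)), i, i, z, z.
have [c _ hc] := osc_normAk U_bounded U_nonempty P_pos q_stat.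
by exists (c * nuN w) => _ [i' [j [x [y [Ux Uy ->]]]]]; exact: hc.
Qed.

Definition Osc (w : Ainfk k U) : R := sup (osc_set w).

Lemma Osc_ub (w : Ainfk k U) : oscA w (Osc w).
Proof.
move=> i j x y Ux Uy; apply: ub_le_sup; first by have [] := osc_set_has_sup w.
by exists i, j, x, y.
Qed.

Lemma Osc_le (w : Ainfk k U) O : oscA w O -> Osc w <= O.
Proof.
move=> wO; apply: ge_sup; first by have [] := osc_set_has_sup w.
by move=> _ [i [j [x [y [Ux Uy ->]]]]]; exact: wO.
Qed.

Lemma Osc_ge0 (w : Ainfk k U) : 0 <= Osc w.
Proof.
have [z Uz] := U_nonempty; pose i := Ordinal k_gt0.
by apply: le_trans (Osc_ub w i i Uz Uz); exact: normc_ge0.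
Qed.

Lemma oscA_comb (c : C) (u v : Ainfk k U) O O' : oscA u O -> oscA v O' ->
  oscA (c *: u + v) (normc c * O + O').
Proof.
move=> uO vO i j x y Ux Uy; rewrite !Ainfk_addE !Ainfk_scaleE.
have -> : c * u i x + v i x - (c * u j y + v j y) =
  c * (u i x - u j y) + (v i x - v j y) by ring.
apply: le_trans (normcD _ _) _; rewrite normcM.
by apply: lerD; [rewrite ler_wpM2l ?normc_ge0// uO|exact: vO].
Qed.

Lemma oscA_iter N (w : Ainfk k U) O : oscA w O -> oscA (iter N T w) O.
Proof.
move=> wO i j x y Ux Uy; rewrite !iter_transferAE//.
exact: (markov_osc_iter P_stoch UH).
Qed.

Definition telescope_op (l : C) N (w : Ainfk k U) : Ainfk k U :=
  \sum_(m < N) l ^+ (N.-1 - m) *: iter m T w.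

Lemma iter_T_sub N (u v : Ainfk k U) : iter N T (u - v) = iter N T u - iter N T v.
Proof. by elim: N => // N IH; rewrite !iterS IH T_sub. Qed.

Lemma iter_T_scale N (a : C) (u : Ainfk k U) : iter N T (a *: u) = a *: iter N T u.
Proof. by elim: N => // N IH; rewrite !iterS IH T_scale. Qed.

(* T^N - l^N = (T - l) (sum_m l^(N-1-m) T^m), the two factors commuting. *)
Lemma telescope_opE l N (w : Ainfk k U) : iter N T w - l ^+ N *: w =
  T (telescope_op l N w) - l *: telescope_op l N w.
Proof.
rewrite /telescope_op; elim: N => [|N IH].
  by rewrite big_ord0 linear0 scaler0 subr0 expr0 scale1r subrr.
have E : \sum_(m < N.+1) l ^+ (N.+1.-1 - m) *: iter m T w =
   l *: (\sum_(m < N) l ^+ (N.-1 - m) *: iter m T w) + iter N T w.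
  rewrite big_ord_recr /= subnn expr0 scale1r; congr (_ + _).
  rewrite scaler_sumr; apply: eq_bigr => m _; rewrite scalerA -exprS.
  have N0 : (0 < N)%N by exact: leq_ltn_trans (ltn_ord m).
  by congr (_ ^+ _ *: _); rewrite /= -subSn ?prednK// -ltnS prednK.
rewrite E; move: IH; set S := \sum_(_ < _) _ => /eqP; rewrite eq_sym subr_eq => /eqP IH.
have ab (V : zmodType) (a x y z : V) : x - y + z + a - (z + x) = a - y.
  have -> : x - y + z = z + x - y by rewrite addrAC [x + z]addrC.
  by rewrite addrAC -[z + x - y - _]addrA [- y - _]addrC addrA subrr add0r addrC.
rewrite T_add T_scale IH scalerDr scalerBr scalerDr ab.
by rewrite exprS scalerA.
Qed.

Lemma telescope_op_shift l N (w : Ainfk k U) : telescope_op l N (T w - l *: w) =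
  T (telescope_op l N w) - l *: telescope_op l N w.
Proof.
rewrite /telescope_op T_sum scaler_sumr -sumrB; apply: eq_bigr => m _.
rewrite T_scale iter_T_sub iter_T_scale -iterSr iterS scalerBr !scalerA.
by rewrite [l * _]mulrC.
Qed.

Lemma telescope_op_osc l N : exists2 c : R, 0 <= c &
  forall (w : Ainfk k U) O, oscA w O -> oscA (telescope_op l N w) (c * O).
Proof.
exists (\sum_(m < N) normc l ^+ (N.-1 - m)).
  by rewrite sumr_ge0// => m _; rewrite exprn_ge0// normc_ge0.
move=> w O wO; rewrite /telescope_op; elim/big_rec2: _ => [i j x y Ux Uy|m c u _ IH].
  by rewrite !ffunE subrr normc0 mul0r.
by rewrite mulrDl -normcX; apply: oscA_comb => //; exact: oscA_iter.
Qed.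

Lemma normAk_le (w : Ainfk k U) (B : R) :
  (forall i z, U z -> normc (w i z) <= B) -> nuN w <= B.
Proof.
have [q0 q1 qP] := q_stat => wB; rewrite -[leRHS]mul1r -q1 mulr_suml.
by apply: ler_sum => i _; rewrite ler_wpM2l//; apply: normA_le => // z; exact: wB.
Qed.

Lemma normAk_eq0 (w : Ainfk k U) : nuN w <= 0 -> w = 0.
Proof.
move=> w0; apply: Ainfk_ext => i z Uz; rewrite ffunE; apply: (@eq0_normc R).
apply/eqP; rewrite eq_le normc_ge0 andbT.
have [c c0 hc] := normA_le_normAk U_bounded U_nonempty P_pos q_stat.
apply: le_trans (normA_ub U_bounded _ Uz) _; apply: le_trans (hc w i) _.
by rewrite pmulr_rle0.
Qed.

(** A nonempty word ends in one of finitely many compact subsets of [U], on each of which the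
    components of [w] have a uniform radius of approximation. [act_equi_unif_poly] then gives one
    [d] whose images under all words stay within that radius. *)
Lemma unif_poly_along_orbits (w : Ainfk k U) z : U z -> exists2 d : R, 0 < d &
  (forall h, cpolydisc d h -> U (z + h)) /\
  forall i s, unif_poly (@coordf R n) (cpolydisc d) (fun h => w i (act M s (z + h))).
Proof.
move=> Uz.
have loc i y : U y -> exists2 r : R, 0 < r & forall y', cdist_lt r y' y ->
    unif_poly (@coordf R n) (cpolydisc r) (fun h => w i (y' + h)).
  move=> Uy; have [r r0 ur] := analytic_unif_poly (Ainf_analytic (w i) Uy).
  have r2 : 0 < r / 2 by rewrite divr_gt0.
  exists (r / 2) => // y' yy'; have cb := @coordf_bounded R n (r / 2).
  apply: (@unif_poly_eq _ _ _ _ _ ((fun h => w i (y + h)) \o (fun h => (y' - y) + h))).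
    by move=> h _ /=; rewrite addrA [y + _]addrC subrK.
  apply: unif_poly_comp ur => // [l|h hd l].
    apply: polyfun_unif_poly.
    apply: polyfun_ext (polyfun_add (polyfun_cst _ ((y' - y) 0 l)) (polyfun_coord _ l)) => h.
    by rewrite /= /coordf [RHS]mxE.
  rewrite mxE [r]splitr; apply: le_trans (normcD _ _) _; apply: lerD => //.
  by rewrite mxE mxE ltW//; exact: yy'.
pose K j := closure [set hatc M j y | y in U].
have cK j : compact (K j).
  apply: subclosed_compact (compact_closure_bounded U_bounded) _.
    exact: closed_closure.
  by move=> y /(@MU_sub j) Uy; exact: subset_closure.
have H (t : 'I_k * 'I_k) : exists r : R, 0 < r /\ forall y, K t.2 y ->
    unif_poly (@coordf R n) (cpolydisc r) (fun h => w t.1 (y + h)).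
  have [r r0 hr] : exists2 r : R, 0 < r & forall y, K t.2 y ->
      unif_poly (@coordf R n) (cpolydisc r) (fun h => w t.1 (y + h)).
    apply: (@compact_uniform_radius R _ (K t.2) (fun r y =>
      unif_poly (@coordf R n) (cpolydisc r) (fun h => w t.1 (y + h))) (cK t.2)).
      by move=> r r' y rr; apply: unif_poly_sub => h hd l; exact: le_trans (hd l) rr.
    move=> y /(@MU_sub t.2) Uy; have [r r0 hr] := loc t.1 y Uy.
    by exists r => //; apply/nbhs_rVcomplexP; exists r.
  by exists r.
have [rK hrK] := choice H; have [a a0 ha] := fin_lower_bound (fun t => (hrK t).1).
have H' i : exists r : R, 0 < r /\ unif_poly (@coordf R n) (cpolydisc r) (fun h => w i (z + h)).
  have [r r0 hr] := loc i z Uz; exists r; split=> //; apply: hr.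
  by move=> l; rewrite subrr normc0.
have [rz hrz] := choice H'; have [b b0 hb] := fin_lower_bound (fun i => (hrz i).1).
have ab0 : 0 < Num.min a b by rewrite lt_min a0.
have Uball : exists2 d : R, 0 < d & forall h, cpolydisc d h -> U (z + h).
  have /nbhs_rVcomplexP[e e0 he] : nbhs z U by exact: open_nbhs_nbhs.
  exists (e / 2) => [|h hd]; first by rewrite divr_gt0.
  apply: he => l; rewrite addmx_subE; apply: le_lt_trans (hd l) _.
  by rewrite ltr_pdivrMr// ltr_pMr// ltr1n.
have [d d0 hd] := act_equi_unif_poly M_pos U_pos UH Uz ab0 Uball.
exists d => //; split=> [h hh|i s]; first by have [_ /(_ h hh) []] := hd [::].
have [h1 h2] := hd s; have cb := @coordf_bounded R n d.
have ur : unif_poly (@coordf R n) (cpolydisc (Num.min a b)) (fun h => w i (act M s z + h)).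
  (* The last letter tells which compact set contains the image; the empty word uses the radius at
     [z]. *)
  case/lastP: s h1 h2 => [|s j] _ _.
    apply: unif_poly_sub (hrz i).2 => h hh l; apply: le_trans (hh l) _.
    by rewrite ge_min hb orbT.
  rewrite act_rcons; apply: (@unif_poly_sub _ _ _ _ _ (cpolydisc (rK (i, j)))).
    by move=> h hh l; apply: le_trans (hh l) _; rewrite ge_min ha.
  apply: (hrK (i, j)).2; apply: subset_closure; exists (act M s z) => //.
  exact: (act_U UH).
apply: (@unif_poly_eq _ _ _ _ _ ((fun h => w i (act M s z + h)) \o
    (fun h => act M s (z + h) - act M s z))).
  by move=> h _ /=; rewrite [act M s z + _]addrC subrK.
apply: unif_poly_comp ur => // [l|h hh l].
  by apply: unif_poly_eq (h1 l) => h _; rewrite /= /coordf mxE mxE.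
by have [_ /(_ l)] := h2 h hh; rewrite mxE mxE.
Qed.

(** * Inverting the operator minus [l] outside the disc of the gap *)

Section Resolvent.
Variables (N1 : nat) (ka : R) (l : C).
Hypothesis N1_gt0 : (0 < N1)%N.
Hypothesis ka01 : 0 <= ka < 1.
Hypothesis blockH : forall (w : Ainfk k U) O, oscA w O -> oscA (iter N1 T w) (ka * O).
Hypothesis l_neq1 : l != 1.
Hypothesis l_big : ka < normc l ^+ N1.
Local Notation mu := (l ^+ N1).

Lemma mu_neq0 : mu != 0.
Proof. by rewrite -normc_gt0 normcX; have /andP[h _] := ka01; exact: le_lt_trans h l_big. Qed.

(** A function is controlled by its oscillation and its value under [nuf]. The first satisfies
    |l|^N1 Osc x <= ka Osc x + C |y|, where the term in [ka] is absorbed; the second satisfies nuf y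
    = (1 - l) nuf x. *)
Lemma shift_bounded_below : exists c : R, forall x,
  nuN x <= c * nuN (shift_op T l x).
Proof.
have [c c0 hc] := telescope_op_osc l N1.
have [c' c'0 hc'] := osc_normAk U_bounded U_nonempty P_pos q_stat.
have g0 : 0 < normc l ^+ N1 - ka by rewrite subr_gt0.
have lN0 : 0 < normc l ^+ N1 by have /andP[h _] := ka01; exact: le_lt_trans h l_big.
have l10 : 0 < normc (1 - l) by rewrite normc_gt0 subr_eq0 eq_sym.
exists (c * c' / (normc l ^+ N1 - ka) + (normc (1 - l))^-1) => x.
pose y := shift_op T l x.
have Ey : iter N1 T x - mu *: x = telescope_op l N1 y.
  by rewrite telescope_opE -telescope_op_shift.
have Ox : Osc x <= c * c' / (normc l ^+ N1 - ka) * nuN y.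
  rewrite mulrAC ler_pdivlMr// mulrBr lerBlDr.
  have h1 : oscA (mu *: x) (ka * Osc x + c * (c' * nuN y)).
    have -> : mu *: x = (-1) *: telescope_op l N1 y + iter N1 T x.
      by rewrite -Ey scaleN1r opprB subrK.
    have -> : ka * Osc x + c * (c' * nuN y) =
        normc (-1 : C) * (c * (c' * nuN y)) + ka * Osc x.
      by rewrite normcNE normc1 mul1r addrC.
    by apply: oscA_comb; [exact/hc/hc'|exact/blockH/Osc_ub].
  have : Osc x * normc l ^+ N1 <= ka * Osc x + c * (c' * nuN y).
    rewrite -ler_pdivlMr //; apply: Osc_le => i j a b Ua Ub.
    rewrite ler_pdivlMr // mulrC -normcX -normcM mulrBr.
    by have := h1 i j a b Ua Ub; rewrite !Ainfk_scaleE.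
  by move/le_trans; apply; rewrite le_eqVlt; apply/orP; left; apply/eqP; ring.
have nx : normc (nuf x) = (normc (1 - l))^-1 * normc (nuf y).
  have -> : nuf y = (1 - l) * nuf x.
    by rewrite /y /shift_op nuf_sub nuf_scale nuf_T mulrBl mul1r.
  by rewrite normcM mulrA mulVf ?mul1r// gt_eqF.
apply: normAk_le => i z Uz.
have := nuf_osc i (Osc_ub x) Uz; have := normc_lerB (x i z) (nuf x).
have : normc (nuf x) <= (normc (1 - l))^-1 * nuN y.
  by rewrite nx ler_wpM2l ?invr_ge0 ?normc_ge0// nuf_le.
by rewrite mulrDl -/y; move: Ox; lra.
Qed.

(** Fixed point iteration for u = mu^-1 (T^N1 u - y0). It contracts the oscillation, and on the
    kernel of [nuf] the oscillation bounds the supremum. The limit is taken pointwise and then shown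
    to be analytic. *)
Lemma block_surjective (y0 : Ainfk k U) : nuf y0 = 0 ->
  exists u, iter N1 T u - mu *: u = y0.
Proof.
move=> nu0; have mu0 := mu_neq0; have /andP[ka0 ka1] := ka01.
have nmu : 0 < normc mu by rewrite normc_gt0.
pose step (Y : Ainfk k U) := mu^-1 *: (iter N1 T Y - y0).
pose Y m := iter m step 0.
have YS m : Y m.+1 = step (Y m) by [].
pose D m := Y m.+1 - Y m.
pose th := ka / normc mu.
have th0 : 0 <= th by rewrite divr_ge0// ltW.
have th1 : th < 1 by rewrite ltr_pdivrMr// mul1r normcX.
have nuY m : nuf (Y m) = 0.
  elim: m => [|m IH]; first exact: linear0.
  by rewrite YS /step nuf_scale nuf_sub nuf_iter IH nu0 subr0 mulr0.
have DS m : D m.+1 = mu^-1 *: iter N1 T (D m).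
  by rewrite /D 2!YS {1}/step -scalerBr opprB addrA subrK iter_T_sub.
have oscD m : oscA (D m) (th ^+ m * Osc (D 0%N)).
  elim: m => [|m IH]; first by rewrite expr0 mul1r; exact: Osc_ub.
  rewrite DS -[mu^-1 *: _]addr0 -[_ * _]addr0 exprS.
  have -> : th * th ^+ m * Osc (D 0%N) = normc mu^-1 * (ka * (th ^+ m * Osc (D 0%N))).
    by rewrite normcV /th; ring.
  apply: oscA_comb; first exact: blockH.
  by move=> i j x y _ _; rewrite !ffunE subrr normc0.
(* Both iterates lie in the kernel of [nuf], so [nuf_osc] compares the difference with 0. *)
have supD m i z : U z -> normc (D m i z) <= th ^+ m * Osc (D 0%N).
  move=> Uz; have := nuf_osc i (oscD m) Uz.
  by rewrite {2}/D nuf_sub !nuY subrr subr0.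
pose K := Osc (D 0%N) / (1 - th).
have K0 : 0 <= K by rewrite divr_ge0 ?Osc_ge0// subr_ge0 ltW.
have KE : Osc (D 0%N) = (1 - th) * K by rewrite mulrC divfK// gt_eqF// subr_gt0.
have cY m p i z : U z -> normc (Y (m + p)%N i z - Y m i z) <= th ^+ m * K * (1 - th ^+ p).
  move=> Uz; elim: p => [|p IH]; first by rewrite addn0 subrr normc0 expr0 subrr mulr0.
  rewrite addnS; apply: le_trans (normc_dist3 _ (Y (m + p)%N i z) _) _.
  have := supD (m + p)%N i z Uz; rewrite /D Ainfk_subE => h.
  apply: le_trans (lerD h IH) _; rewrite KE exprD exprS.
  by rewrite le_eqVlt; apply/orP; left; apply/eqP; ring.
have cY' m p i z : U z -> (m <= p)%N -> normc (Y p i z - Y m i z) <= th ^+ m * K.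
  move=> Uz mp; rewrite -(subnKC mp); apply: le_trans (cY m _ i z Uz) _.
  apply: ler_piMr; first by rewrite mulr_ge0 ?exprn_ge0.
  by rewrite gerBl exprn_ge0.
have small (e : R) : 0 < e -> exists m, th ^+ m * K < e.
  move=> e0; have /cvgrPdist_lt /(_ (e / (K + 1))) : (fun m => th ^+ m) @ \oo --> (0 : R).
    by apply: cvg_expr; rewrite ger0_norm.
  case=> [|m _ hm]; first by rewrite divr_gt0// ltr_wpDl.
  exists m; have := hm m (leqnn m); rewrite /= sub0r normrN ger0_norm ?exprn_ge0//.
  rewrite ltr_pdivlMr ?ltr_wpDl// => h; have : 0 <= th ^+ m by rewrite exprn_ge0.
  by move: h; rewrite mulrDr mulr1; lra.
have thle m p : (m <= p)%N -> th ^+ p * K <= th ^+ m * K.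
  by move=> mp; rewrite ler_wpM2r// ler_wiXn2l// ltW.
have /choice[y hy] : forall t : 'I_k * 'rV[C]_n, exists c, U t.2 ->
    forall m, normc (Y m t.1 t.2 - c) <= th ^+ m * K.
  move=> [i z] /=; have [Uz|nUz] := pselect (U z); last by exists 0.
  have [c hc] : exists c : C, forall e : R, 0 < e -> exists N, forall m, (N <= m)%N ->
      normc (Y m i z - c) < e.
    apply: complex_lim => e e0; have e2 : 0 < e / 2 by rewrite divr_gt0.
    have [N hN] := small _ e2; exists N => p m Np Nm.
    apply: le_lt_trans (normc_dist3 _ (Y N i z) _) _; rewrite [e]splitr.
    have := cY' N p i z Uz Np; have := cY' N m i z Uz Nm.
    by rewrite (normcB (Y N i z)); move: hN; lra.
  exists c => _ m; apply/ler_addgt0Pr => e e0; have [N hN] := hc e e0.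
  apply: le_trans (normc_dist3 _ (Y (maxn N m) i z) _) _; apply: lerD.
    by rewrite normcB; apply: cY' => //; exact: leq_maxr.
  by apply/ltW/hN; exact: leq_maxl.
have yan i : analytic_on U (fun z => y (i, z)).
  move=> z Uz; have [d d0 [Ud ud]] := unif_poly_along_orbits y0 Uz.
  have cb := @coordf_bounded R n d.
  (* Quantifying over all words makes [Q] stable under [T], which only lengthens the word by one
     letter; the radius [d], chosen for [y0], thus serves every iterate. *)
  pose Q (w : Ainfk k U) := forall i s,
    unif_poly (@coordf R n) (cpolydisc d) (fun h => w i (act M s (z + h))).
  have QT w : Q w -> Q (T w).
    move=> Qw i' s; apply: (@unif_poly_eq _ _ _ _ _
      (fun h => \sum_j (P i' j)%:C * w j (act M (rcons s j) (z + h)))).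
      move=> h hd; rewrite transferAE; last by apply: (act_U UH); exact: Ud.
      by apply: eq_bigr => j _; rewrite act_rcons.
    apply: unif_poly_sum => j; apply: unif_poly_mul => //; exact: unif_poly_cst.
  have QTN N w : Q w -> Q (iter N T w) by elim: N => // N IH Qw; exact/QT/IH.
  have QY m : Q (Y m).
    elim: m => [|m IH] i' s.
      apply: (@unif_poly_eq _ _ _ _ _ (fun=> 0)); last exact: unif_poly_cst.
      by move=> h _; rewrite ffunE.
    apply: (@unif_poly_eq _ _ _ _ _ (fun h => mu^-1 *
      (iter N1 T (Y m) i' (act M s (z + h)) + (-1) * y0 i' (act M s (z + h))))).
      by move=> h _; rewrite YS Ainfk_scaleE Ainfk_subE mulN1r.
    apply: unif_poly_mul => //; first exact: unif_poly_cst.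
    apply: unif_poly_add; first exact: QTN.
    by apply: unif_poly_mul => //; exact: unif_poly_cst.
  apply: (unif_poly_analytic d0); apply: unif_poly_lim => e e0.
  have [m hm] := small e e0; exists (fun h => Y m i (z + h)); first exact: (QY m i [::]).
  move=> h hd; rewrite normcB; apply: le_trans (ltW hm).
  by apply: (hy (i, z + h)); exact: Ud.
pose y' i z := y (i, z).
(* The limit [y'] is only known to be analytic on [U]. Its first transfer step, by [transfer_an],
   lies in [Ainf], and the other [N1.-1] steps follow; by the fixed point equation the resulting [u]
   agrees with [y'] on [U]. *)
pose u := mu^-1 *: (iter N1.-1 T (transfer_an M_pos U_open U_pos MU_sub P (w := y') yan) - y0).
have BE i z : U z -> iter N1.-1 T (transfer_an M_pos U_open U_pos MU_sub P (w := y') yan) i z =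
    iter N1 (markov_op P (hatc M)) y' i z.
  move=> Uz; rewrite iter_transferAE// -[in RHS](prednK N1_gt0) iterSr.
  apply: (@markov_ext_iter R k P _ U _ UH) => // i' z' Uz'.
  exact: transfer_anE.
have uE i z : U z -> u i z = y' i z.
  move=> Uz; rewrite Ainfk_scaleE Ainfk_subE BE//.
  apply/eqP; rewrite -subr_eq0; apply/eqP/normc_lt_eps0 => e e0.
  have c0 : 0 < normc mu^-1 + 1 by rewrite ltr_wpDl ?normc_ge0.
  have [m hm] := small (e / (normc mu^-1 + 1)) ltac:(by rewrite divr_gt0).
  have h1 := @markov_diff_iter R k P _ U (hatc M) P_stoch UH N1 (fun j => Y m j) y' (th ^+ m * K)
    (fun i z Uz => hy (i, z) Uz m) i z Uz.
  have h2 := hy (i, z) Uz m.+1; have h3 := thle m m.+1 (leqnSn m).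
  have YE : Y m.+1 i z = mu^-1 * (iter N1 (markov_op P (hatc M)) (fun j => Y m j) i z - y0 i z).
    by rewrite YS /step Ainfk_scaleE Ainfk_subE iter_transferAE.
  have -> : mu^-1 * (iter N1 (markov_op P (hatc M)) y' i z - y0 i z) - y' i z =
    mu^-1 * (iter N1 (markov_op P (hatc M)) y' i z -
             iter N1 (markov_op P (hatc M)) (fun j => Y m j) i z) + (Y m.+1 i z - y' i z).
    by rewrite YE; ring.
  apply: le_trans (normcD _ _) _; rewrite normcM (normcB (iter N1 _ y' i z)).
  apply: (@le_trans _ _ (normc mu^-1 * (th ^+ m * K) + th ^+ m * K)).
    by apply: lerD; [rewrite ler_wpM2l ?normc_ge0|exact: le_trans h2 h3].
  by rewrite -{2}[th ^+ m * K]mul1r -mulrDl mulrC -ler_pdivlMr// ltW.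
exists u; apply: Ainfk_ext => i z Uz; rewrite Ainfk_subE Ainfk_scaleE.
have -> : iter N1 T u i z = iter N1 (markov_op P (hatc M)) y' i z.
  by rewrite iter_transferAE//; exact: (@markov_ext_iter R k P _ U _ UH).
by rewrite -BE// /u Ainfk_scaleE Ainfk_subE mulrA divff// mul1r; ring.
Qed.

Lemma resolvent_mem : resolvent_set nuN T l.
Proof.
apply: resolvent_setP.
- exact: shift_bounded_below.
- have [c hc] := shift_bounded_below => x x0.
  apply: normAk_eq0; have := hc x; rewrite x0.
  have -> : nuN 0 = 0; last by rewrite mulr0.
  apply/eqP; rewrite eq_le (normAk_ge0 U_bounded U_nonempty P_pos q_stat) andbT.
  by apply: normAk_le => i z Uz; rewrite ffunE normc0.
- move=> y; have l1 : 1 - l != 0 by rewrite subr_eq0 eq_sym.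
  (* [y] splits into a constant, on which the operator minus [l] is multiplication by 1 - l, and an
     element of the kernel of [nuf]. *)
  have [u hu] := @block_surjective (y - cst_vec k U_open (nuf y)) ltac:(by rewrite nuf_sub nuf_cst subrr).
  exists ((1 - l)^-1 *: cst_vec k U_open (nuf y) + telescope_op l N1 u).
  rewrite shift_op_linear {2}/shift_op -telescope_opE hu /shift_op T_cst.
  rewrite -[X in X - l *: _]scale1r -scalerBl scalerA mulVf// scale1r.
  by rewrite addrC subrK.
Qed.

End Resolvent.

Lemma spectrum1 : spectrum nuN T 1.
Proof.
move=> [S [_ _ cS]]; apply: cst1_neq0; rewrite -(cS (cst_vec k U_open 1)).
by rewrite /shift_op T_cst scale1r subrr linear0.
Qed.

Lemma normc_continuous : continuous (normc : C -> R).
Proof.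
move=> z B /nbhs_ballP[e /= e0 he]; apply/nbhs_complexP; exists e => // y yz.
apply: he; rewrite -ball_normE /=; apply: le_lt_trans yz; rewrite ler_norml; have := normc_lerB y z.
by have := normc_lerB z y; rewrite (normcB z); lra.
Qed.

(** The set is the closed disc whose radius is the [N1]-th root of [ka], written without a root. *)
Lemma spectrum_gap : exists F : set C, [/\ closed F, F `<=` [set l | normc l < 1] &
  spectrum nuN T `\ 1 `<=` F].
Proof.
have [N1 [ka [N10 ka01 hka]]] := block_contraction k_gt0 M_pos U_open U_bounded U_pos MU_sub P_stoch P_pos.
have /andP[ka0 ka1] := ka01.
exists ((fun l => normc l ^+ N1) @^-1` [set x | x <= ka]); split.
- apply: closed_comp (@closed_le R ka) => l _.
  apply: (@continuous_comp _ _ _ (normc : C -> R) (fun x => x ^+ N1)).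
    exact: normc_continuous.
  exact: exprn_continuous.
- move=> l /= hl; rewrite ltNge; apply/negP => l1; move: ka1; rewrite ltNge => /negP; apply.
  by apply: le_trans hl; rewrite exprn_ege1.
- move=> l [sl l1] /=; rewrite leNgt; apply/negP => hl; apply: sl.
  by apply: (resolvent_mem N10 ka01 hka) => //; apply/eqP => l1'; exact: l1.
Qed.

Lemma spectrum_isolated : isolated (spectrum nuN T) 1.
Proof.
have [F [Fc F1 Fs]] := spectrum_gap; split; first exact/mem_set/spectrum1.
exists (~` F).
  apply: open_nbhs_nbhs; split; first by rewrite openC.
  by move=> /F1; rewrite /mkset normc1 ltxx.
apply/seteqP; split=> [l [nFl sl]|_ ->] /=.
  by apply: contrapT => l1; apply: nFl; apply: Fs.
split; last exact: spectrum1.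
by move=> /F1; rewrite /mkset normc1 ltxx.
Qed.

Lemma eigenvector1 : eigenfunction T 1 (cst_vec k U_open 1).
Proof. by split; [exact: cst1_neq0|rewrite T_cst scale1r]. Qed.

Lemma eigenvector1_unique w : eigenfunction T 1 w -> exists c, w = c *: cst_vec k U_open 1.
Proof.
by move=> [_]; rewrite scale1r => /fixed_cst ->; exists (nuf w); exact: cst_vecZ.
Qed.

Lemma multiplicity1 : algebraic_multiplicity T 1 1.
Proof.
exists (fun=> cst_vec k U_open 1); split=> [c|x].
  have [z Uz] := U_nonempty; rewrite big_ord1 => h i; rewrite ord1.
  have := congr1 (fun w : Ainfk k U => w (Ordinal k_gt0) z) h.
  by rewrite Ainfk_scaleE cst_vecE// mulr1 ffunE.
split=> [[N]|[c ->]]; last first.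
  exists 1%N; rewrite big_ord1 /= /shift_op scale1r T_scale T_cst subrr //.
suff H : forall N x, iter N (shift_op T 1) x = 0 -> exists c, x = c *: cst_vec k U_open 1.
  by move=> /H[c ->]; exists (fun=> c); rewrite big_ord1.
elim=> [y /= ->|M' IH y]; first by exists 0; rewrite scale0r.
rewrite iterSr => /IH[c hc].
(* No Jordan chain: applying [nuf] to T y - y = c 1 gives c = 0, since [nuf] is invariant and takes
   the value 1 on 1. *)
have c0 : c = 0.
  have := congr1 nuf hc; rewrite /shift_op scale1r nuf_sub nuf_T subrr nuf_scale nuf_cst mulr1.
  by move/esym.
move: hc; rewrite c0 scale0r /shift_op scale1r => /eqP; rewrite subr_eq0 => /eqP /fixed_cst ->.
by exists (nuf y); exact: cst_vecZ.
Qed.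

Lemma transfer_bounded : bounded_op nuN nuN T.
Proof. by exists 1 => w; rewrite mul1r; exact: normAk_transfer. Qed.

Lemma transfer_opnorm : opnorm nuN nuN T = 1.
Proof.
apply/eqP; rewrite eq_le; apply/andP; split.
  apply: ge_sup.
    by exists (nuN (T (cst_vec k U_open 1))), (cst_vec k U_open 1) => //; rewrite /mkset normAk_cst normc1.
  by move=> _ [w /= w1 <-]; apply: le_trans w1; exact: normAk_transfer.
apply: ub_le_sup.
  by exists 1 => _ [w /= w1 <-]; apply: le_trans w1; exact: normAk_transfer.
by exists (cst_vec k U_open 1); rewrite /mkset ?T_cst normAk_cst normc1.
Qed.

Definition single i (w : Ainf U) : Ainfk k U := [ffun j => if j == i then w else 0].

Lemma single_linear i (a : C) u v : single i (a *: u + v) = a *: single i u + single i v.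
Proof.
by apply/ffunP => j; rewrite !ffunE; case: eqP => _ //; rewrite scaler0 addr0.
Qed.

Lemma sum_single (w : Ainfk k U) : w = \sum_i single i (w i).
Proof.
apply: Ainfk_ext => i z _; rewrite Ainfk_sumE (bigD1 i)//= ffunE eqxx big1 ?addr0// => j ji.
by rewrite ffunE eq_sym (negbTE ji).
Qed.

(** Dividing by [q 0 i] undoes the weight in [nu_sum]; as [single i w] has norm [q 0 i * normA U w],
    it also makes the functional of norm at most 1. *)
Definition nui i (w : Ainf U) : C := ((q 0 i)%:C)^-1 * nuf (single i w).

Lemma nui_linear i : scalar (nui i).
Proof.
move=> a u v; rewrite /nui single_linear linearP /= mulrDr; congr (_ + _).
by rewrite mulrCA.
Qed.

HB.instance Definition _ i := GRing.isLinear.Build C (Ainf U) C _ (nui i) (nui_linear i).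

Lemma q_neq0 i : (q 0 i)%:C != 0 :> C.
Proof. by rewrite -normc_gt0 normc_real gtr0_norm (stationary_gt0 P_pos q_stat). Qed.

Lemma nui_sum (w : Ainfk k U) : nu_sum q (fun i => nui i) w = nuf w.
Proof.
rewrite {2}(sum_single w) (raddf_sum nuf) /nu_sum; apply: eq_bigr => i _ /=.
by rewrite /nui mulrA mulfV ?mul1r ?q_neq0.
Qed.

Lemma normAk_single i (w : Ainf U) : nuN (single i w) = q 0 i * normA U w.
Proof.
rewrite /normAk (bigD1 i)//= ffunE eqxx big1 ?addr0// => j ji.
rewrite ffunE (negbTE ji); suff -> : normA U (0 : Ainf U) = 0 by rewrite mulr0.
apply/eqP; rewrite eq_le normA_ge0// andbT; apply: normA_le => // z _.
by rewrite normc0.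
Qed.

Lemma nui_le i (w : Ainf U) : normc (nui i w) <= normA U w.
Proof.
have qi := stationary_gt0 P_pos q_stat i.
rewrite /nui normcM normcV normc_real gtr0_norm// ler_pdivrMl//.
by rewrite -normAk_single; exact: nuf_le.
Qed.

(* The numbers [nui i 1] have modulus at most 1 and average 1 with positive
   weights, hence all equal 1. *)
Lemma nui1 i : nui i (Acst U_open 1) = 1.
Proof.
have [q0 q1 qP] := q_stat.
have le1 j : normc (nui j (Acst U_open 1)) <= 1.
  by apply: le_trans (nui_le j _) _; rewrite normA_cst normc1.
have re1 j : complex.Re (nui j (Acst U_open 1)) <= 1.
  by apply: le_trans (le1 j); apply: le_trans (normRe_le _); exact: ler_norm.
have S : \sum_j q 0 j * (1 - complex.Re (nui j (Acst U_open 1))) = 0.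
  have := nui_sum (cst_vec k U_open 1); rewrite nuf_cst => /(congr1 (@complex.Re R)).
  rewrite /nu_sum raddf_sum /= => E.
  under eq_bigr do rewrite mulrBr mulr1.
  rewrite sumrB q1 -[X in X - _]E; apply/eqP; rewrite subr_eq0; apply/eqP.
  apply: eq_bigr => j _; rewrite ffunE.
  by case: (nui j _) => a b /=; rewrite mul0r subr0.
have Re1 : complex.Re (nui i (Acst U_open 1)) = 1.
  move/eqP: S; rewrite psumr_eq0 => [|j _]; last by rewrite mulr_ge0// subr_ge0.
  move=> /allP/(_ i (mem_index_enum _)); rewrite mulf_eq0 gt_eqF ?(stationary_gt0 P_pos q_stat)//=.
  by rewrite subr_eq0 => /eqP.
move: (le1 i) Re1; case: (nui i _) => a b /= h a1; rewrite a1 in h *.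
have : 1 ^+ 2 + b ^+ 2 <= 1.
  have : 0 <= 1 ^+ 2 + b ^+ 2 by rewrite addr_ge0 ?sqr_ge0.
  by move=> h0; rewrite -(sqr_sqrtr h0) -[leRHS](expr1n _ 2) lerXn2r ?nnegrE ?sqrtr_ge0.
rewrite expr1n gerDl => b0; have : b ^+ 2 == 0 by rewrite eq_le b0 sqr_ge0.
by rewrite sqrf_eq0 => /eqP ->.
Qed.

Lemma opnorm_ub (phi : Ainf U -> C) w : bounded_op (normA U) normc phi -> normA U w <= 1 ->
  normc (phi w) <= opnorm (normA U) normc phi.
Proof.
move=> [c hc] w1; apply: ub_le_sup; last by exists w.
exists `|c| => _ [v /= v1 <-]; apply: le_trans (hc v) _.
apply: (@le_trans _ _ (`|c| * normA U v)).
  by rewrite ler_wpM2r ?normA_ge0// ler_norm.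
by rewrite -[leRHS]mulr1 ler_wpM2l.
Qed.

Lemma nui_norm1 i : functional_norm1 (nui i).
Proof.
have bd : bounded_op (normA U) normc (nui i).
  by exists 1 => w; rewrite mul1r; exact: nui_le.
split=> //; apply/eqP; rewrite eq_le; apply/andP; split.
  apply: ge_sup.
    by exists (normc (nui i (Acst U_open 1))), (Acst U_open 1); rewrite // /mkset normA_cst normc1.
  by move=> _ [w /= w1 <-]; apply: le_trans w1; exact: nui_le.
have := @opnorm_ub (nui i) (Acst U_open 1) bd; rewrite nui1 normc1; apply.
by rewrite normA_cst normc1.
Qed.

Lemma nu_sum_linear (mu : 'I_k -> {scalar Ainf U}) (a : C) u v :
  nu_sum q mu (a *: u + v) = a * nu_sum q mu u + nu_sum q mu v.
Proof.
rewrite /nu_sum mulr_sumr -big_split /=; apply: eq_bigr => i _.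
by rewrite !ffunE linearP /= mulrDr mulrCA.
Qed.

(** A common factor of modulus 1 preserves both the norms and the invariance, so uniqueness is up to
    such a factor, fixed by the value on the constant 1. An invariant functional takes the same
    value on [w] and on its iterates, which tend to [nuf w] times the constant 1. *)
Lemma nui_unique (mu : 'I_k -> {scalar Ainf U}) :
  (forall i, functional_norm1 (mu i)) ->
  dual_op T (nu_sum q mu) = nu_sum q mu ->
  (exists c, normc c = 1 /\ forall i w, mu i w = c * nui i w) /\
  ((forall i, mu i (Acst U_open 1) = 1) -> forall i w, mu i w = nui i w).
Proof.
move=> mu1 dmu; pose c := nu_sum q mu (cst_vec k U_open 1).
have inv w N : nu_sum q mu (iter N T w) = nu_sum q mu w.
  elim: N => // N IH; rewrite iterS -IH.
  exact: (congr1 (fun phi => phi (iter N T w)) dmu).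
have [B hB] := choice (fun i => (mu1 i).1).
have key w : nu_sum q mu w = c * nuf w.
  apply/eqP; rewrite -subr_eq0; apply/eqP/normc_lt_eps0 => e e0.
  pose K := \sum_i `|q 0 i| * `|B i| + 1.
  have K0 : 0 < K by rewrite ltr_wpDl// sumr_ge0// => i _; rewrite mulr_ge0.
  have eK : 0 < e / K by rewrite divr_gt0.
  have [N hN] := nuf_lim w eK.
  have -> : nu_sum q mu w - c * nuf w =
      nu_sum q mu ((- nuf w) *: cst_vec k U_open 1 + iter N T w).
    by rewrite nu_sum_linear inv -/c; ring.
  apply: le_trans (normc_sum _ _ _) _.
  apply: (@le_trans _ _ (\sum_i `|q 0 i| * `|B i| * (e / K))); last first.
    by rewrite -mulr_suml mulrCA -[leRHS]mulr1 ler_pM2l// ler_pdivrMr// mul1r lerDl.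
  apply: ler_sum => i _; rewrite normcM normc_real -mulrA ler_wpM2l//.
  apply: le_trans (hB i _) _; apply: (@le_trans _ _ (`|B i| * normA U
     (((- nuf w) *: cst_vec k U_open 1 + iter N T w) i))).
    by rewrite ler_wpM2r ?normA_ge0// ler_norm.
  rewrite ler_wpM2l//; apply: normA_le => // z Uz.
  rewrite Ainfk_addE Ainfk_scaleE cst_vecE// mulr1 addrC.
  exact: hN.
have muE i w : mu i w = c * nui i w.
  have := key (single i w); rewrite /nu_sum (bigD1 i)//= ffunE eqxx big1 ?addr0; last first.
    by move=> j ji; rewrite ffunE (negbTE ji) linear0 mulr0.
  move=> E; apply: (mulfI (q_neq0 i)); rewrite E /nui.
  by rewrite [RHS]mulrCA mulVKf ?q_neq0.
split; last by move=> h i w; rewrite muE; have := muE i (Acst U_open 1);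
  rewrite h nui1 mulr1 => <-; rewrite mul1r.
exists c; split=> //; pose i := Ordinal k_gt0.
have [bd op1] := mu1 i; apply/eqP; rewrite eq_le; apply/andP; split.
  have := @opnorm_ub (mu i) (Acst U_open 1) bd; rewrite op1 muE nui1 mulr1; apply.
  by rewrite normA_cst normc1.
rewrite -op1; apply: ge_sup.
  by exists (normc (mu i (Acst U_open 1))), (Acst U_open 1); rewrite // /mkset normA_cst normc1.
move=> _ [w /= w1 <-]; rewrite muE normcM -[leRHS]mulr1 ler_wpM2l ?normc_ge0//.
by apply: le_trans w1; exact: nui_le.
Qed.

(** All components tend to the same number: a limit of iterates is fixed by the operator, hence
    constant by [fixed_cst]. *)
Lemma nui_cvg (w : Ainfk k U) :
  nuN (iter N T w - cst_vec k U_open (nu_sum q (fun i => nui i) w)) @[N --> \oo] --> (0 : R).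
Proof.
apply/cvgrPdist_lt => e e0; have e2 : 0 < e / 2 by rewrite divr_gt0.
have [N0 hN0] := nuf_lim w e2; exists N0 => // N /= N0N.
rewrite sub0r normrN ger0_norm ?(normAk_ge0 U_bounded U_nonempty P_pos q_stat)//.
apply: (@le_lt_trans _ _ (e / 2)); last by rewrite ltr_pdivrMr// ltr_pMr// ltr1n.
apply: normAk_le => i z Uz; rewrite Ainfk_subE cst_vecE// nui_sum.
exact: hN0.
Qed.

End InvariantFunctional.

(** * Real dynamics and invariant measures *)

Section WithinContinuity.
Variables (R : realType) (n : nat).

Definition near_by (d : R) (y x : 'rV[R]_n) := forall i, `|y 0 i - x 0 i| < d.

Variable A : set 'rV[R]_n.

Lemma within_realP (f : 'rV[R]_n -> R) :
  {within A, continuous f} <-> forall x, A x -> forall e : R, 0 < e ->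
    exists2 d : R, 0 < d & forall y, A y -> near_by d y x -> `|f y - f x| < e.
Proof.
rewrite subspace_continuousP; split=> [cf x Ax e e0|h x Ax].
- have /(cf x Ax) : nbhs (f x) [set y | `|y - f x| < e].
    by apply/nbhs_ballP; exists e => // y; rewrite -ball_normE /= distrC.
  move=> /nbhs_rVP[d d0 hd]; exists d => // y Ay yx.
  exact: hd.
- move=> B /nbhs_ballP[e /= e0 he].
  have [d d0 hd] := h x Ax e e0.
  apply/nbhs_rVP; exists d => // y yx Ay.
  by apply: he; rewrite -ball_normE /= distrC; exact: hd.
Qed.

Lemma within_lincomb (I : Type) (r : seq I) (a : I -> R) (f : I -> 'rV[R]_n -> R) :
  (forall j, {within A, continuous (f j)}) ->
  {within A, continuous (fun x => \sum_(j <- r) a j * f j x)}.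
Proof.
move=> cf; elim: r => [|j r IH].
  apply/within_realP => x _ e e0; exists 1 => // y _ _.
  by rewrite !big_nil subrr normr0.
apply/within_realP => x cx e e0; have e2 : 0 < e / 2 by rewrite divr_gt0.
have a0 : 0 < `|a j| + 1 by rewrite ltr_wpDl.
have ea : 0 < e / 2 / (`|a j| + 1) by rewrite divr_gt0.
have [d1 d10 h1] := (within_realP _).1 (cf j) x cx _ ea.
have [d2 d20 h2] := (within_realP _).1 IH x cx _ e2.
exists (Num.min d1 d2) => [|y cy yx]; first by rewrite lt_min d10.
have m1 : Num.min d1 d2 <= d1 by rewrite ge_min lexx.
have m2 : Num.min d1 d2 <= d2 by rewrite ge_min lexx orbT.
have {}h1 := h1 y cy (fun i => lt_le_trans (yx i) m1).
have {}h2 := h2 y cy (fun i => lt_le_trans (yx i) m2).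
rewrite !big_cons opprD addrACA -mulrBr.
apply: le_lt_trans (ler_normD _ _) _; rewrite [e]splitr; apply: ler_ltD h2.
rewrite normrM; apply: (@le_trans _ _ ((`|a j| + 1) * (e / 2 / (`|a j| + 1)))).
  by apply: ler_pM => //; [rewrite lerDl|exact: ltW].
by rewrite mulrC divfK// gt_eqF.
Qed.

Hypothesis A_compact : compact A.

Lemma within_unif (f : 'rV[R]_n -> R) (e : R) : {within A, continuous f} -> 0 < e ->
  exists2 d : R, 0 < d & forall x y, A x -> A y -> near_by d y x -> `|f y - f x| < e.
Proof.
move=> /within_realP cf e0.
have [d d0 hd] : exists2 d : R, 0 < d & forall x, A x -> A x ->
    forall y, A y -> near_by d y x -> `|f y - f x| < e.
  apply: (@compact_uniform_radius R _ A (fun d x => A x ->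
    forall y, A y -> near_by d y x -> `|f y - f x| < e)) => [|r r' x rr h cx y cy yx|x cx].
  - exact: A_compact.
  - by apply: h => // i; exact: lt_le_trans (yx i) rr.
  have e2 : 0 < e / 2 by rewrite divr_gt0.
  have [d d0 hd] := cf x cx _ e2; have d2 : 0 < d / 2 by rewrite divr_gt0.
  exists (d / 2) => //; apply/nbhs_rVP; exists (d / 2) => // x' x'x cx' y cy yx'.
  have dd : d / 2 <= d by rewrite ger_pMr// invf_le1// ler1n.
  have h1 := hd x' cx' (fun i => lt_le_trans (x'x i) dd).
  have h2 : `|f y - f x| < e / 2.
    apply: hd => // i; have := yx' i; have := x'x i.
    have := ler_distD (x' 0 i) (y 0 i) (x 0 i); rewrite [d]splitr; lra.
  have := ler_distD (f x) (f y) (f x'); rewrite (distrC (f x)).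
  by rewrite [e]splitr; lra.
by exists d => // x y cx; exact: hd.
Qed.

Lemma within_bounded (f : 'rV[R]_n -> R) : {within A, continuous f} ->
  exists B : R, forall x, A x -> `|f x| <= B.
Proof.
move=> /within_realP cf.
have [r r0 hr] : exists2 r : R, 0 < r & forall x, A x -> A x -> `|f x| * r <= 1.
  apply: (@compact_uniform_radius R _ A (fun r x => A x -> `|f x| * r <= 1))
    => [|r r' x rr h /h|x cx].
  - exact: A_compact.
  - by apply: le_trans; rewrite ler_wpM2l.
  have [d d0 hd] := cf x cx _ ltr01; have K0 : 0 < `|f x| + 1 by rewrite ltr_wpDl.
  exists (`|f x| + 1)^-1; first by rewrite invr_gt0.
  apply/nbhs_rVP; exists d => // y yx cy; rewrite ler_pdivrMr// mul1r.
  by have := hd y cy yx; have := lerB_dist (f y) (f x); lra.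
by exists r^-1 => x cx; rewrite -[leRHS]mul1r ler_pdivlMr//; exact: hr.
Qed.

End WithinContinuity.

Section RealDynamics.
Variables (R : realType) (n k : nat) (M : 'I_k -> 'M[R]_(1 + n)).
Hypothesis k_gt0 : (0 < k)%N.
Hypothesis M_pos : forall i, positive_mx (M i).
Local Notation C := R[i].
Variable U : set 'rV[C]_n.
Hypothesis U_bounded : bounded_set U.
Hypothesis U_open : open U.
Hypothesis U_nonempty : U !=set0.
Hypothesis U_pos : forall z, U z -> forall j, 0 < complex.Re (z 0 j).
Hypothesis MU_sub : forall i, closure [set hat (cmx (M i)) z | z in U] `<=` U.
Variable V : set 'rV[R]_n.
Hypothesis V_def : V = [set remx z | z in U].
Hypothesis V_pos : forall x, V x -> forall j, 0 < x 0 j.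
Hypothesis V_sub : forall x, V x -> U (cmx x).
Hypothesis MV_sub : forall i, closure [set hat (M i) x | x in V] `<=` V.

Local Notation cV := (closure V).

Lemma V_nonempty : V !=set0.
Proof. by have [z Uz] := U_nonempty; exists (remx z); rewrite V_def; exists z. Qed.

Lemma closureP x : cV x <-> forall d : R, 0 < d -> exists2 y, V y & near_by d y x.
Proof.
split=> [cx d d0|h B /nbhs_rVP[d d0 hd]].
  have [|y [Vy yx]] := cx [set y | near_by d y x]; last by exists y.
  by apply/nbhs_rVP; exists d.
by have [y Vy yx] := h d d0; exists y; split=> //; exact: hd.
Qed.

Lemma closure_V_ge0 x : cV x -> forall i, 0 <= x 0 i.
Proof.
move=> /closureP cx i; rewrite leNgt; apply/negP => h.
have [|y Vy yx] := cx (- x 0 i); first by rewrite oppr_gt0.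
have := yx i; have := V_pos Vy i; have := ler_norm (y 0 i - x 0 i); lra.
Qed.

Lemma cmxE (x : 'rV[R]_n) i : cmx x 0 i = (x 0 i)%:C.
Proof. by rewrite mxE. Qed.

(** Through this identity the real maps inherit continuity and contraction from the complex ones. *)
Lemma hat_cmx j (x : 'rV[R]_n) : hatc M j (cmx x) = cmx (hat (M j) x).
Proof.
have E (A : 'M[R]_(1 + n)) l : (cmx A *m affine (cmx x)) l 0 = ((A *m affine x) l 0)%:C.
  rewrite !mxE rmorph_sum; apply: eq_bigr => m _; rewrite !mxE rmorphM /=; congr (_ * _).
  case: (fintype.split m) => m'; last by rewrite !mxE.
  by rewrite !mxE; case: eqP.
apply/rowP => i; rewrite /hatc /hat [LHS]mxE !E cmxE.
have -> : hat (M j) x 0 i =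
    (M j *m affine x) (rshift 1 i) 0 / (M j *m affine x) (lshift n 0) 0 by rewrite mxE.
by rewrite (rmorphM (real_complex R)) (fmorphV (real_complex R)).
Qed.

Lemma hat_near j x (e : R) : cV x -> 0 < e ->
  exists2 d : R, 0 < d & forall y, near_by d y x -> near_by e (hat (M j) y) (hat (M j) x).
Proof.
move=> cx e0.
have [|d d0 hd] := @hatc_continuous R n k M M_pos j (cmx x) e _ e0.
  by move=> i; rewrite cmxE /=; exact: closure_V_ge0.
exists d => // y yx i; have := hd (cmx y) _ i; rewrite !hat_cmx !cmxE -rmorphB normc_real.
by apply=> l; rewrite !cmxE -rmorphB normc_real; exact: yx.
Qed.

Lemma hat_closure_V j x : cV x -> V (hat (M j) x).
Proof.
move=> cx; apply: (@MV_sub j (hat (M j) x)) => B /nbhs_rVP[e e0 he].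
have [d d0 hd] := hat_near j cx e0.
have [y Vy yx] := (closureP x).1 cx d d0.
by exists (hat (M j) y); split; [exists y|apply/he/hd].
Qed.

Lemma hat_closure j x : cV x -> cV (hat (M j) x).
Proof. by move=> /(hat_closure_V j) h; exact: subset_closure. Qed.

Local Notation orbV := (orb (fun j => hat (M j))).

Lemma orb_cmx s x : act M s (cmx x) = cmx (orbV s x).
Proof. by elim: s x => // j s IH x; rewrite act_cons hat_cmx IH. Qed.

Lemma orbV_diam (e : R) : 0 < e -> exists N0, forall s, (N0 <= size s)%N ->
  forall x y, cV x -> cV y -> near_by e (orbV s x) (orbV s y).
Proof.
move=> e0; have [N0 hN0] := act_diam M_pos U_open U_bounded U_pos MU_sub e0.
(* The first letter sends the closure of [V] into [V], hence into [U], where [act_diam] applies. *)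
exists N0.+1 => -[//|j s] Ns x y cx cy i /=.
have := hN0 s Ns _ _ (V_sub (@hat_closure_V j x cx)) (V_sub (@hat_closure_V j y cy)) i.
by rewrite !orb_cmx !cmxE -rmorphB normc_real.
Qed.

Lemma compact_closure_V : compact cV.
Proof.
have [B B0 hB] := bounded_rVcomplexP U_bounded.
apply: (@subclosed_compact _ _ [set x : 'rV[R]_n | forall i, `[- B, B]%classic (x 0 i)]).
- exact: closed_closure.
- by apply: (rV_compact (fun=> @segment_compact R (- B) B)).
move=> x /closureP cx i /=; rewrite in_itv /= -ler_norml leNgt; apply/negP => h.
have [|y Vy yx] := cx (`|x 0 i| - B); first by rewrite subr_gt0.
have [z Uz zy] : exists2 z, U z & remx z = y by move: Vy; rewrite V_def => -[z]; exists z.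
have : `|y 0 i| <= B by rewrite -zy mxE; apply: le_trans (normRe_le _) (hB _ Uz _).
have := yx i; have := lerB_dist (x 0 i) (y 0 i); rewrite distrC; lra.
Qed.

Variables (P : 'M[R]_k) (q : 'rV[R]_k).
Hypothesis P_stoch : stochastic P.
Hypothesis P_pos : positive_mx P.
Hypothesis q_stat : stationary P q.

Local Notation MV := (transfer P (fun j => hat (M j))).

Lemma within_comp_hat j (f : 'rV[R]_n -> R) : {within cV, continuous f} ->
  {within cV, continuous (fun x => f (hat (M j) x))}.
Proof.
move=> /within_realP cf; apply/within_realP => x cx e e0.
have [d d0 hd] := cf _ (@hat_closure j x cx) e e0.
have [d' d'0 hd'] := hat_near j cx d0.
by exists d' => // y cy yx; apply: hd; [exact: hat_closure|exact: hd'].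
Qed.

(** Real functions are complexified so that the lemmas on [markov_op] apply to them. *)
Definition emb (f : 'I_k -> 'rV[R]_n -> R) : 'I_k -> 'rV[R]_n -> C := fun i x => (f i x)%:C.

Lemma emb_iter N f : emb (iter N MV f) = iter N (markov_op P (fun j => hat (M j))) (emb f).
Proof.
elim: N => // N IH; rewrite !iterS -IH; apply/funext => i; apply/funext => x.
rewrite /emb /transfer /markov_op rmorph_sum; apply: eq_bigr => j _.
by rewrite rmorphM.
Qed.

(** Uniform continuity of [f] and [orbV_diam] make the spread within an index small; [osc_decay]
    then deals with the spread between indices. *)
Lemma real_osc_small f (e : R) : Ck cV f -> 0 < e -> exists N0, forall N, (N0 <= N)%N ->
  forall i j x y, cV x -> cV y -> `|iter N MV f i x - iter N MV f j y| <= e.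
Proof.
move=> cf e0; have fX j x : cV x -> cV (hat (M j) x) by exact: hat_closure.
have [B hB] := choice (fun i => within_bounded compact_closure_V (cf i)).
pose O0 := 2 * \sum_i `|B i|.
have Bi i x : cV x -> `|f i x| <= \sum_i `|B i|.
  move=> cx; apply: le_trans (hB i x cx) _; apply: le_trans (ler_norm _) _.
  by rewrite (bigD1 i)//= lerDl sumr_ge0.
have wO : osc_le cV (emb f) O0.
  move=> i j x y cx cy; rewrite /emb -rmorphB normc_real.
  apply: le_trans (ler_normB _ _) _; rewrite /O0 mulr2n mulrDl mul1r.
  by apply: lerD; exact: Bi.
have wS (e' : R) : 0 < e' -> exists N0, forall N, (N0 <= N)%N ->
    sosc_le cV (iter N (markov_op P (fun j => hat (M j))) (emb f)) e'.
  move=> e'0.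
  have H i : exists d : R, 0 < d /\ forall x y, cV x -> cV y -> near_by d y x -> `|f i y - f i x| < e'.
    by have [d d0 hd] := within_unif compact_closure_V (cf i) e'0; exists d.
  have [d hd] := choice H; have [d0 d00 hd0] := fin_lower_bound (fun i => (hd i).1).
  have [N0 hN0] := orbV_diam d00; exists N0 => N N0N i x y cx cy.
  apply: (markov_sosc_iter P_stoch fX) => // s l sN.
  rewrite /emb -rmorphB normc_real ltW//; apply: (hd l).2; try exact: (orb_X fX).
  move=> i'; apply: lt_le_trans (hd0 l); apply: hN0 => //.
  by rewrite sN.
have [N0 hN0] := osc_decay P_stoch fX k_gt0 P_pos wO wS e0.
exists N0 => N N0N i j x y cx cy; have := hN0 N N0N i j x y cx cy.
by rewrite -emb_iter /emb -rmorphB normc_real.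
Qed.

End RealDynamics.

(** * Paths of a Markov chain coded by points of an interval *)

Section Coding.
Variables (R : realType) (k : nat) (p : 'I_k -> 'I_k -> R).
Hypothesis p_ge0 : forall a b, 0 <= p a b.
Hypothesis p_sum : forall a, \sum_b p a b = 1.

Definition cumul a m : R := \sum_(b < k | (b < m)%N) p a b.

Lemma cumul0 a : cumul a 0 = 0.
Proof. by rewrite /cumul big_pred0. Qed.

Lemma cumul_full a : cumul a k = 1.
Proof. by rewrite /cumul -[RHS](p_sum a); apply: eq_bigl => b; rewrite ltn_ord. Qed.

Lemma cumulS a (b : 'I_k) : cumul a b.+1 = cumul a b + p a b.
Proof.
rewrite /cumul (bigD1 b)//= addrC; congr (_ + _); apply: eq_bigl => c.
by rewrite ltnS ltn_neqAle andbC.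
Qed.

Lemma cumul_le a m m' : (m <= m')%N -> cumul a m <= cumul a m'.
Proof.
move=> mm'; rewrite /cumul [leRHS](bigID (fun b : 'I_k => (b < m)%N))/=.
rewrite [X in _ <= X + _](eq_bigl (fun b : 'I_k => (b < m)%N)); last first.
  move=> b /=; have [bm|] := boolP (b < m)%N; last by rewrite andbF.
  by rewrite (leq_trans bm mm').
by rewrite lerDl sumr_ge0.
Qed.

Lemma cumul_ge0 a m : 0 <= cumul a m.
Proof. by rewrite -(cumul0 a) cumul_le. Qed.

Lemma cumul_le1 a (b : 'I_k) : cumul a b + p a b <= 1.
Proof. by rewrite -cumulS -(cumul_full a) cumul_le. Qed.

(* [l, l + len[ is cut into consecutive pieces of lengths len * p a b. *)
Definition piece a (l len : R) (b : 'I_k) : set R :=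
  `[l + len * cumul a b, l + len * cumul a b + len * p a b[%classic.

Lemma piece_inj a l len b b' u : 0 <= len ->
  piece a l len b u -> piece a l len b' u -> b = b'.
Proof.
move=> len0; rewrite /piece /= !in_itv /= => /andP[lu uh] /andP[lu' uh'].
have key (c d : 'I_k) : (c < d)%N -> u < l + len * cumul a c + len * p a c ->
    l + len * cumul a d <= u -> False.
  move=> cd h1 h2; have := cumul_le a cd; rewrite cumulS.
  by move=> /(ler_wpM2l len0); rewrite mulrDr; lra.
apply/val_inj; case: (ltngtP b b') => //= bb'.
- by case: (key _ _ bb' uh lu').
- by case: (key _ _ bb' uh' lu).
Qed.

Lemma piece_sub a l len b : 0 <= len -> piece a l len b `<=` `[l, l + len[%classic.
Proof.
move=> len0 u; rewrite /piece /= !in_itv /= => /andP[lu uh]; apply/andP; split.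
  by apply: le_trans lu; rewrite lerDl mulr_ge0// cumul_ge0.
apply: lt_le_trans uh _; rewrite -addrA lerD2l -mulrDr -[leRHS]mulr1.
by rewrite ler_wpM2l// cumul_le1.
Qed.

Lemma cumul_piece a l len u m : (m <= k)%N -> l <= u -> u < l + len * cumul a m ->
  exists b : 'I_k, piece a l len b u.
Proof.
elim: m => [|m IH] mk lu; first by rewrite cumul0 mulr0 addr0 ltNge lu.
rewrite (cumulS a (Ordinal mk)) mulrDr addrA => uh.
case: (ltP u (l + len * cumul a m)) => [|hu]; first exact/IH/lu/ltnW.
by exists (Ordinal mk); rewrite /piece /= in_itv /= hu.
Qed.

Lemma piece_cover a l len : 0 <= len -> `[l, l + len[%classic = \bigcup_b piece a l len b.
Proof.
move=> len0; apply/seteqP; split=> [u|u [b _]]; last exact: piece_sub.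
rewrite /= in_itv /= => /andP[lu uh].
have [|b hb] := @cumul_piece a l len u k (leqnn k) lu; last by exists b.
by rewrite cumul_full mulr1.
Qed.

Variables (T : Type) (f : 'I_k -> T -> T) (v0 : T).

(** The default [a], taken when [u] lies in no piece, lets [coding_in] and [coding_prefix] hold for
    every real [u]. *)
Definition digit a l len u : 'I_k := odflt a [pick b | `[< piece a l len b u >]].

Lemma digitE a l len b u : 0 <= len -> piece a l len b u -> digit a l len u = b.
Proof.
move=> len0 ub; rewrite /digit; case: pickP => [b' /asboolP|/(_ b)]; last by rewrite asboolT.
by move=> /piece_inj - /(_ _ len0 ub) /=.
Qed.

(* f_a f_b f_c ... v0, where b, c, ... are the successive digits of u. *)
Fixpoint coding N a l len u : T :=
  f a (if N is N'.+1 then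
         let b := digit a l len u in
         coding N' b (l + len * cumul a b) (len * p a b) u
       else v0).

Lemma coding_piece N a l len b u : 0 <= len -> piece a l len b u ->
  coding N.+1 a l len u = f a (coding N b (l + len * cumul a b) (len * p a b) u).
Proof. by move=> len0 ub /=; rewrite (digitE len0 ub). Qed.

Lemma coding_in (X : set T) : (forall j x, X x -> X (f j x)) -> X v0 ->
  forall N a l len u, X (coding N a l len u).
Proof. by move=> fX Xv0; elim=> [|N IH] a l len u /=; apply: fX. Qed.

(** A deeper coding has the same outermost maps and differs only in the innermost point, so
    contraction along words makes the codings of a given [u] a Cauchy sequence. *)
Lemma coding_prefix (X : set T) : (forall j x, X x -> X (f j x)) -> X v0 ->
  forall N N' a l len u, (N <= N')%N -> exists s x, [/\ size s = N.+1, X x,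
    coding N a l len u = orb f s v0 & coding N' a l len u = orb f s x].
Proof.
move=> fX Xv0; elim=> [|N IH] [|N'] a l len u //= NN'.
- by exists [:: a], v0; split.
- by exists [:: a]; eexists; split=> //; exact: coding_in.
have [s [x [ss Xx e1 e2]]] := IH N' (digit a l len u) (l + len * cumul a (digit a l len u))
  (len * p a (digit a l len u)) u NN'.
(* The outermost map is the last one that [orb] applies. *)
exists (rcons s a), x; split=> //; first by rewrite size_rcons ss.
- by rewrite e1 /orb foldl_rcons.
- by rewrite e2 /orb foldl_rcons.
Qed.

(** [A] can be any set because a coding of finite depth is constant on each of finitely many
    half-open intervals. *)
Lemma measurable_coding N (A : set T) a l len : 0 <= len ->
  measurable (`[l, l + len[%classic `&` [set u | A (coding N a l len u)]).
Proof.
elim: N A a l len => [|N IH] A a l len len0.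
  have [Ab|nAb] := pselect (A (f a v0)).
    have -> : [set u | A (coding 0 a l len u)] = setT by apply/seteqP; split.
    by rewrite setIT.
  have -> : [set u | A (coding 0 a l len u)] = set0 by apply/seteqP; split.
  by rewrite setI0.
rewrite (piece_cover a l len0) setI_bigcupl.
apply: fin_bigcup_measurable => [|b _]; first exact: finite_finset.
have -> : piece a l len b `&` [set u | A (coding N.+1 a l len u)] =
   `[l + len * cumul a b, l + len * cumul a b + len * p a b[%classic `&`
   [set u | (A \o f a) (coding N b (l + len * cumul a b) (len * p a b) u)].
  apply/seteqP; split=> u [ub h]; split=> //; move: h; rewrite /mkset.
    by rewrite (coding_piece N len0 ub).
  by rewrite (coding_piece N len0 ub).
by apply: IH; rewrite mulr_ge0.
Qed.

(** The expectation of [g] at the coding of depth [N] for the chain started at [a]. Unfolding it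
    once is the invariance relation that survives in the limit. *)
Fixpoint coding_mean N a (g : T -> R) : R :=
  if N is N'.+1 then \sum_b p a b * coding_mean N' b (g \o f a) else g (f a v0).

Lemma measurable_coding_comp N (g : T -> R) a l len : 0 <= len ->
  measurable_fun (`[l, l + len[%classic : set (g_sigma_algebraType R.-ocitv.-measurable))
    (fun u => g (coding N a l len u)).
Proof. by move=> len0 mD Y mY; exact: (measurable_coding N (g @^-1` Y)). Qed.

Variable Q : probability (g_sigma_algebraType R.-ocitv.-measurable) R.
Hypothesis Q_itv : forall x y, 0 <= x -> x <= y -> y <= 1 -> Q `[x, y[%classic = (y - x)%:E.

Lemma integrable_coding N (g : T -> R) (B : R) a l len : (forall t, `|g t| <= B) -> 0 <= len ->
  Q.-integrable `[l, l + len[%classic (EFin \o (fun u => g (coding N a l len u))).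
Proof.
move=> gB len0; apply: measurable_bounded_integrable.
- exact: measurable_itv.
- exact: le_lt_trans (probability_le1 _ _) (ltry _).
- exact: measurable_coding_comp.
- by exists B; split=> [|x /ltW Bx u _]; [exact: num_real|exact: le_trans (gB _) Bx].
Qed.

Lemma integral_coding N (g : T -> R) (B : R) a l len : (forall t, `|g t| <= B) ->
  0 <= l -> 0 <= len -> l + len <= 1 ->
  (\int[Q]_(u in `[l, (l + len)%R[) g (coding N a l len u))%R = len * coding_mean N a g.
Proof.
elim: N g a l len => [|N IH] g a l len gB l0 len0 len1.
  have -> : (\int[Q]_(u in `[l, (l + len)%R[) g (coding 0 a l len u))%R =
      g (f a v0) * fine (Q `[l, (l + len)[%classic).
    rewrite -(@Rintegral_cst _ _ _ Q (`[l, (l + len)[%classic) (measurable_itv _) (g (f a v0))).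
    exact: eq_Rintegral.
  by rewrite Q_itv ?lerDl// addrAC subrr add0r mulrC.
(* Inner induction on the number of pieces, adding one piece to the domain of integration at a
   time. *)
have H m : (m <= k)%N ->
    (\int[Q]_(u in `[l, (l + len * cumul a m)%R[) g (coding N.+1 a l len u))%R =
    \sum_(b < k | (b < m)%N) len * (p a b * coding_mean N b (g \o f a)).
  elim: m => [|m IHm] mk.
    by rewrite cumul0 mulr0 addr0 set_itvco0 Rintegral_set0 big_pred0.
  pose b := Ordinal mk.
  have c1 : cumul a m.+1 = cumul a m + p a b by exact: (cumulS a b).
  have ls : l <= l + len * cumul a m by rewrite lerDl mulr_ge0// cumul_ge0.
  have es : l + len * cumul a m.+1 = l + len * cumul a m + len * p a b.
    by rewrite c1 mulrDr addrA.
  have se : l + len * cumul a m <= l + len * cumul a m.+1 by rewrite es lerDl mulr_ge0.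
  have el : l + len * cumul a m.+1 <= l + len.
    by rewrite lerD2l -[leRHS]mulr1 ler_wpM2l// -(cumul_full a) cumul_le.
  rewrite (@itv_bndbnd_setU _ _ _ (BLeft (l + len * cumul a m)))//.
  rewrite Rintegral_setU; last 4 first.
  - exact: measurable_itv.
  - exact: measurable_itv.
  - rewrite -itv_bndbnd_setU//; apply: integrableS (integrable_coding N.+1 a l gB len0).
    + exact: measurable_itv.
    + exact: measurable_itv.
    + by apply: subset_itvl; rewrite bnd_simp.
  - apply/disj_setPS => u [] /=; rewrite !in_itv /= => /andP[_ h1] /andP[h2 _].
    by move: h1; rewrite ltNge h2.
  rewrite IHm; last exact: ltnW.
  rewrite [RHS](bigD1 b)//= [RHS]addrC; congr (_ + _).
    by apply: eq_bigl => c; rewrite ltnS [RHS]andbC ltn_neqAle.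
  rewrite mulrA -(IH _ _ (l + len * cumul a m)); first last.
  - by rewrite -es (le_trans el).
  - by rewrite mulr_ge0.
  - exact: le_trans ls.
  - by move=> t /=; exact: gB.
  rewrite es; apply: eq_Rintegral => u; rewrite inE => ub.
  by rewrite /= (@digitE a l len b u).
have := H k (leqnn k); rewrite cumul_full mulr1 => ->.
by rewrite mulr_sumr; apply: eq_bigl => b; rewrite ltn_ord.
Qed.

End Coding.

(** * Borel probabilities on a compact set and integrals of continuous functions *)

Section BorelRowVectors.
Variables (R : realType) (n : nat).
Local Notation B := (borel_rV R n).

Lemma measurable_open_rV (O : set 'rV[R]_n) : open O -> measurable (O : set B).
Proof. exact: sub_sigma_algebra. Qed.

Lemma measurable_closed_rV (F : set 'rV[R]_n) : closed F -> measurable (F : set B).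
Proof.
move=> cF; rewrite -(setCK F); apply: measurableC.
by apply: measurable_open_rV; exact: closed_openC.
Qed.

Lemma within_measurable (A : set 'rV[R]_n) (f : 'rV[R]_n -> R) : closed A ->
  {within A, continuous f} ->
  measurable_fun (A : set B) f.
Proof.
move=> A_closed /within_realP cf; apply: (measurability _ (measurable_realfun.RGenOInfty.measurableE R)).
move=> _ [_ [c ->] <-].
(* Continuity is only relative to [A], so the preimage itself need not be open; [W] is an open set
   with the same trace on [A]. *)
pose W := [set z | exists2 d : R, 0 < d & forall y, A y -> near_by d y z -> c < f y].
have -> : A `&` f @^-1` `]c, +oo[ = A `&` W.
  apply/seteqP; split=> z [Az] /=; rewrite in_itv /= andbT => h; split=> //.
    have [|d d0 hd] := cf z Az (f z - c); first by rewrite subr_gt0.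
    exists d => // y Ay yz; have := hd y Ay yz; have := ler_norm (f z - f y).
    by rewrite distrC; lra.
  case: h => d d0; apply => // i; by rewrite subrr normr0.
apply: measurableI; first exact: measurable_closed_rV.
apply: measurable_open_rV; rewrite openE => z [d d0 hd].
have d2 : 0 < d / 2 by rewrite divr_gt0.
apply/nbhs_rVP; exists (d / 2) => // y yz; exists (d / 2) => // x Ax xy.
apply: hd => // i; have := xy i; have := yz i.
by have := ler_distD (y 0 i) (x 0 i) (z 0 i); rewrite [d]splitr; lra.
Qed.

End BorelRowVectors.

Section Depth.
Variables (R : realType) (n : nat).
Variable O : set 'rV[R]_n.

(* Truncated distance to the complement of O. *)
Definition depth_set x :=
  [set d : R | 0 <= d <= 1 /\ (0 < d -> forall y, near_by d y x -> O y)].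
Definition depth x := sup (depth_set x).

(** The guard [0 < d] puts 0 into the set at every [x], inside [O] or not, so the supremum is never
    over an empty set. *)
Lemma depth_has_sup x : has_sup (depth_set x).
Proof.
split; first by exists 0; split; rewrite ?lexx ?ler01// ltxx.
by exists 1 => d [/andP[]].
Qed.

Lemma depth_ge0 x : 0 <= depth x.
Proof. by apply: sup_upper_bound; [exact: depth_has_sup|split; rewrite ?lexx ?ler01// ltxx]. Qed.

Lemma depth_lip x y (d : R) : 0 <= d -> near_by d y x -> depth x <= depth y + d.
Proof.
move=> d0 yx; apply: ge_sup => [|e [/andP[e0 e1] he]].
  by have [] := depth_has_sup x.
case: (leP e d) => [ed|de].
  by apply: le_trans ed _; rewrite lerDr depth_ge0.
rewrite -lerBlDr; apply: sup_upper_bound; first exact: depth_has_sup.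
split; first by apply/andP; split; lra.
move=> _ z zy; apply: he => [|i]; first exact: le_lt_trans de.
have := zy i; have := yx i; have := ler_distD (y 0 i) (z 0 i) (x 0 i); lra.
Qed.

Lemma depth_gt0 x : open O -> O x <-> 0 < depth x.
Proof.
move=> oO; split=> [|/sup_gt - /(_ (proj1 (depth_has_sup x)))[d [_ hd] d0]]; last first.
  by apply: (hd d0) => i; rewrite subrr normr0.
move: oO; rewrite openE => oO /oO /nbhs_rVP[d d0 hd].
have m0 : 0 < Num.min d 1 by rewrite lt_min d0 ltr01.
apply: (lt_le_trans m0); apply: sup_upper_bound; first exact: depth_has_sup.
split; first by rewrite (ltW m0) ge_min lexx orbT.
by move=> _ y yx; apply: hd => i; apply: lt_le_trans (yx i) _; rewrite ge_min lexx.
Qed.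

Lemma within_depth (A : set 'rV[R]_n) : {within A, continuous depth}.
Proof.
apply/within_realP => x _ e e0; have e2 : 0 < e / 2 by rewrite divr_gt0.
exists (e / 2) => // y _ yx; have h1 := depth_lip (ltW e2) yx.
have h2 : depth y <= depth x + e / 2.
  by apply: depth_lip; [exact: ltW|move=> i; rewrite distrC; exact: yx].
by rewrite ltr_norml; apply/andP; split; lra.
Qed.

(** A continuous function that increases with [m] to the indicator of [O] when [O] is open. *)
Definition bump m x := Num.min 1 (m.+1%:R * depth x).

Lemma bump_le1 m x : bump m x <= 1.
Proof. by rewrite /bump ge_min lexx. Qed.

Lemma bump_ge0 m x : 0 <= bump m x.
Proof. by rewrite /bump le_min ler01 mulr_ge0// depth_ge0. Qed.

Lemma within_bump (A : set 'rV[R]_n) m : {within A, continuous (bump m)}.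
Proof.
apply/within_realP => x Ax e e0; have m0 : 0 < m.+1%:R :> R by [].
have em : 0 < e / m.+1%:R by rewrite divr_gt0.
have [d d0 hd] := (within_realP _ _).1 (@within_depth A) x Ax _ em.
exists d => // y Ay yx; have := hd y Ay yx; rewrite ltr_pdivlMr// mulrC.
rewrite -{1}(gtr0_norm m0) -normrM mulrBr /bump; set a := _ * _; set b := _ * _.
rewrite !ltr_norml => /andP[h1 h2]; rewrite /Num.min.
by case: (ltP 1 a) => ha; case: (ltP 1 b) => hb; apply/andP; split; lra.
Qed.

End Depth.

Section MeasuresOnCompact.
Variables (R : realType) (n : nat) (A : set 'rV[R]_n).
Hypothesis A_compact : compact A.
Hypothesis A_closed : closed A.
Local Notation B := (borel_rV R n).

Lemma within_cst (c : R) : {within A, continuous (fun=> c)}.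
Proof. by apply/within_realP => x _ e e0; exists 1 => // y _ _; rewrite subrr normr0. Qed.

Lemma within_integrable (mu : probability B R) (f : 'rV[R]_n -> R) :
  {within A, continuous f} -> mu.-integrable A (EFin \o f).
Proof.
move=> cf; have [K hK] := within_bounded A_compact cf.
apply: measurable_bounded_integrable; first exact: measurable_closed_rV.
- apply: le_lt_trans (probability_le1 _ _) (ltry _).
  exact: measurable_closed_rV.
- exact: within_measurable A_closed cf.
- by exists K; split=> [|x /ltW Kx u Au]; [exact: num_real|exact: le_trans (hK u Au) Kx].
Qed.

Lemma integral_close (mu : probability B R) (f : 'rV[R]_n -> R) (c e : R) : mu A = 1%E ->
  {within A, continuous f} -> (forall x, A x -> `|f x - c| <= e) ->
  `|(\int[mu]_(x in A) f x)%R - c| <= e.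
Proof.
move=> muA cf h; have mA : measurable (A : set B) by exact: measurable_closed_rV.
have If := within_integrable mu cf.
have Ic (b : R) := within_integrable mu (@within_cst b).
have E b : (\int[mu]_(x in A) b)%R = b
  by rewrite (Rintegral_cst mu mA) [X in b * fine X](muA : _ = _) mulr1.
rewrite ler_norml; apply/andP; split.
  rewrite lerBrDr -(E (- e + c)); apply: le_Rintegral => //.
  by move=> x /h; rewrite ler_norml lerBrDr => /andP[].
rewrite lerBlDr -(E (e + c)); apply: le_Rintegral => //.
by move=> x /h; rewrite ler_norml lerBlDr => /andP[].
Qed.

Lemma integral_lincomb (mu : probability B R) (I : Type) (r : seq I) (a : I -> R)
    (f : I -> 'rV[R]_n -> R) : (forall j, {within A, continuous (f j)}) ->
  (\int[mu]_(x in A) (\sum_(j <- r) a j * f j x))%R =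
  \sum_(j <- r) a j * (\int[mu]_(x in A) f j x)%R.
Proof.
move=> cf; have mA : measurable (A : set B) by exact: measurable_closed_rV.
elim: r => [|j r IH].
  under eq_Rintegral do rewrite big_nil.
  by rewrite (Rintegral_cst mu mA) mul0r big_nil.
rewrite big_cons -IH -RintegralZl//; last exact: within_integrable.
rewrite -RintegralD//; last 2 first.
- have := @within_lincomb _ _ A _ [:: j] a _ cf; under eq_fun do rewrite big_seq1.
  exact: within_integrable.
- exact/within_integrable/within_lincomb.
by apply: eq_Rintegral => x _; rewrite big_cons.
Qed.

Lemma Rintegral_split (mu : probability B R) (f : 'rV[R]_n -> R) (K : set B) :
  {within A, continuous f} -> measurable K ->
  (\int[mu]_(x in A) f x)%R =
  (\int[mu]_(x in (A : set B) `&` K) f x + \int[mu]_(x in (A : set B) `\` K) f x)%R.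
Proof.
move=> cf mK; have mA : measurable (A : set B) by exact: measurable_closed_rV.
rewrite -Rintegral_setU.
- by rewrite setUIDK.
- exact: measurableI.
- exact: measurableD.
- by rewrite setUIDK; exact: within_integrable.
by apply/disj_setPS => x [[_ ?] []].
Qed.

Definition depth_ge (O : set 'rV[R]_n) m : set B := depth O @^-1` `[m.+1%:R^-1, +oo[%classic.

Lemma measurable_depth_ge O m : measurable (depth_ge O m).
Proof.
rewrite /depth_ge -[X in measurable X]setTI.
by apply: (@within_measurable R n setT) => //; exact: within_depth.
Qed.

Lemma depth_geP O m x : depth_ge O m x -> bump O m x = 1.
Proof.
rewrite /depth_ge /= in_itv /= andbT => h; apply/eqP; rewrite /bump minEle ifT//.
by rewrite mulrC -ler_pdivrMr// mul1r.
Qed.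

Lemma measure_depth_ge (mu : probability B R) O m :
  fine (mu ((A : set B) `&` depth_ge O m)) <= (\int[mu]_(x in A) bump O m x)%R.
Proof.
have mA : measurable (A : set B) by exact: measurable_closed_rV.
have mK := measurable_depth_ge O m.
rewrite (Rintegral_split mu (@within_bump R n O A m) mK).
apply: (@le_trans _ _ (\int[mu]_(x in (A : set B) `&` depth_ge O m) bump O m x)%R); last first.
  by rewrite lerDl; apply: Rintegral_ge0 => x _; exact: bump_ge0.
apply: (@le_trans _ _ (\int[mu]_(x in (A : set B) `&` depth_ge O m) 1)%R).
  by rewrite (Rintegral_cst mu (measurableI _ _ mA mK)) mul1r.
rewrite le_eqVlt; apply/orP; left; apply/eqP.
by apply: eq_Rintegral => x; rewrite inE => -[_ /depth_geP ->].
Qed.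

Lemma integral_bump_le (mu : probability B R) (O : set 'rV[R]_n) m : open O ->
  (\int[mu]_(x in A) bump O m x)%R <= fine (mu ((A : set B) `&` O)).
Proof.
move=> oO; have mA : measurable (A : set B) by exact: measurable_closed_rV.
have mO := measurable_open_rV oO; have mAO : measurable ((A : set B) `&` O) by exact: measurableI.
rewrite (Rintegral_split mu (@within_bump R n O A m) mO).
rewrite [X in _ + X](_ : _ = 0) ?addr0; last first.
  transitivity (\int[mu]_(x in (A : set B) `\` O) 0)%R; last first.
    by rewrite (Rintegral_cst mu (measurableD mA mO)) mul0r.
  apply: eq_Rintegral => x; rewrite inE => -[_ nO].
  have d0 : depth O x = 0.
    apply/eqP; rewrite eq_le depth_ge0 andbT leNgt; apply/negP => /(depth_gt0 _ oO).2.
    exact: nO.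
  by rewrite /bump d0 mulr0; apply/min_idPr.
apply: (@le_trans _ _ (\int[mu]_(x in (A : set B) `&` O) 1)%R); last first.
  by rewrite (Rintegral_cst mu mAO) mul1r.
have Ic (f : 'rV[R]_n -> R) : {within A, continuous f} ->
    mu.-integrable ((A : set B) `&` O) (EFin \o f).
  by move=> cf; apply: integrableS (within_integrable mu cf).
apply: le_Rintegral => //; first exact/Ic/within_bump.
  exact/Ic/within_cst.
by move=> x _; exact: bump_le1.
Qed.

(** The integral of [bump O m] lies above the [mu]-measure of the set where the depth is at least
    1/(m+1) and, being the same for [nu], below the [nu]-measure of [O]. These sets increase to [O],
    and continuity from below concludes. *)
Lemma probability_open_le (mu nu : probability B R) (O : set 'rV[R]_n) :
  (forall f, {within A, continuous f} ->
     (\int[mu]_(x in A) f x)%R = (\int[nu]_(x in A) f x)%R) ->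
  open O -> (mu ((A : set B) `&` O) <= nu ((A : set B) `&` O))%E.
Proof.
move=> eq_int oO; have mA : measurable (A : set B) by exact: measurable_closed_rV.
have mO := measurable_open_rV oO.
have mK m : measurable ((A : set B) `&` depth_ge O m).
  exact: measurableI (measurable_depth_ge O m).
have U : \bigcup_m ((A : set B) `&` depth_ge O m) = (A : set B) `&` O.
  apply/seteqP; split=> [x [m _ [Ax]]|x [Ax Ox]].
    rewrite /depth_ge /= in_itv /= andbT => h; split=> //; apply/depth_gt0 => //.
    by apply: lt_le_trans h; rewrite invr_gt0.
  have d0 := (depth_gt0 x oO).1 Ox.
  have [m hm] := ltr_add_invr d0; exists m => //; split=> //.
  by rewrite /depth_ge /= in_itv /= andbT; rewrite add0r in hm; exact: ltW.
have cv := @nondecreasing_cvg_mu _ _ _ mu (fun m => (A : set B) `&` depth_ge O m) mK.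
rewrite U in cv; have {}cv := cv (measurableI _ _ mA mO).
have {}cv : (mu \o (fun m => (A : set B) `&` depth_ge O m)) @ \oo --> mu ((A : set B) `&` O).
  apply: cv => m m' mm'; apply/subsetPset => x [Ax h]; split=> //; move: h.
  rewrite /depth_ge /= !in_itv /= !andbT; apply: le_trans.
  by rewrite lef_pV2 ?posrE// ler_nat ltnS.
rewrite -(cvg_lim _ cv)//; apply: lime_le; first exact: cvgP cv.
apply: nearW => m /=.
rewrite -(@fineK _ (mu _)) ?fin_num_measure// -[leRHS]fineK ?fin_num_measure//.
  rewrite lee_fin; apply: le_trans (measure_depth_ge mu O m) _.
  by rewrite eq_int; [exact: integral_bump_le|exact: within_bump].
exact: measurableI.
Qed.

Lemma probability_eq (mu nu : probability B R) : mu A = 1%E -> nu A = 1%E ->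
  (forall f, {within A, continuous f} ->
     (\int[mu]_(x in A) f x)%R = (\int[nu]_(x in A) f x)%R) ->
  forall E : set B, measurable E -> mu E = nu E.
Proof.
move=> muA nuA eq_int; have mA : measurable (A : set B) by exact: measurable_closed_rV.
(* Full mass on [A] reduces every measure to its trace on [A], where integrals give information. *)
have full (la : probability B R) (E : set B) : la A = 1%E -> measurable E ->
    la E = la ((A : set B) `&` E).
  move=> laA mE; have := measureDI la mE mA; rewrite setIC => ->.
  rewrite [X in (X + _)%E](_ : _ = 0%E) ?add0e//; apply/eqP; rewrite -measure_le0.
  have -> : (0 = la (~` (A : set B)))%E.
    by rewrite probability_setC// laA subee.
  by apply: le_measure; rewrite ?inE; [exact: measurableD|exact: measurableC|move=> x []].
move=> E mE.
apply: (@measure_unique _ _ _ (@open 'rV[R]_n : set (set B)) (fun=> setT) erefl _ _ _ mu nu _ _ E mE).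
- by move=> O O' oO oO'; exact: openI.
- by move=> _; exact: openT.
- by rewrite bigcup_const//; exists 0%N.
- move=> O oO; have mO := measurable_open_rV oO.
  apply: (etrans (full mu O muA mO) (etrans _ (esym (full nu O nuA mO)))).
  apply/eqP; rewrite eq_le; apply/andP; split.
    exact: (probability_open_le eq_int oO).
  exact: (probability_open_le (fun f cf => esym (eq_int f cf)) oO).
by move=> _; apply: (le_lt_trans (probability_le1 mu measurableT)); exact: ltry.
Qed.

End MeasuresOnCompact.

Lemma uniform_prob_itv (R : realType) (x y : R) : 0 <= x -> x <= y -> y <= 1 ->
  uniform_prob (@ltr01 R) `[x, y[%classic = (y - x)%:E.
Proof.
move=> x0 xy y1; rewrite /uniform_prob (eq_integral (fun=> 1%E)) => [|u]; last first.
  rewrite inE /= in_itv /= => /andP[xu uy].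
  by rewrite /uniform_pdf subr0 invr1 (le_trans x0 xu) (ltW (lt_le_trans uy y1)).
rewrite integral_cst//= mul1e lebesgue_measure_itv /= lte_fin.
by case: ltP => // yx; rewrite (le_anti (introT andP (conj xy yx))) subrr.
Qed.

Lemma eq_of_dist_le (R : realType) (x y : R) :
  (forall e : R, 0 < e -> `|x - y| <= 2 * e) -> x = y.
Proof.
move=> h; apply/eqP; rewrite -subr_eq0 -normr_le0 leNgt; apply/negP => d0.
have e0 : 0 < `|x - y| / 4 by rewrite divr_gt0.
by have := h _ e0; lra.
Qed.

(** * Existence, uniqueness and attraction of the invariant measures *)

Section InvariantMeasures.
Variables (R : realType) (n k : nat) (A : set 'rV[R]_n).
Hypothesis A_compact : compact A.
Hypothesis A_closed : closed A.
Variable v0 : 'rV[R]_n.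
Hypothesis v0A : A v0.
Variable F : 'I_k -> 'rV[R]_n -> 'rV[R]_n.
Hypothesis F_sub : forall j x, A x -> A (F j x).
Hypothesis F_within : forall j (f : 'rV[R]_n -> R),
  {within A, continuous f} -> {within A, continuous (f \o F j)}.
Hypothesis F_diam : forall e : R, 0 < e -> exists N0, forall s, (N0 <= size s)%N ->
  forall x y, A x -> A y -> near_by e (orb F s x) (orb F s y).
Local Notation B := (borel_rV R n).

Section Coded.
Variables (p : 'I_k -> 'I_k -> R).
Hypothesis p_ge0 : forall a b, 0 <= p a b.
Hypothesis p_sum : forall a, \sum_b p a b = 1.
Local Notation xi N a u := (coding p F v0 N a 0 1 u).
Local Notation cmean := (coding_mean p F v0).

Lemma coding_A N a l len u : A (coding p F v0 N a l len u).
Proof. exact: (coding_in p F_sub v0A). Qed.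

Lemma coding_cauchy (e : R) : 0 < e -> exists N0, forall N N', (N0 <= N)%N -> (N <= N')%N ->
  forall a u, near_by e (xi N' a u) (xi N a u).
Proof.
move=> /F_diam[N0 hN0]; exists N0 => N N' N0N NN' a u.
have [s [x [ss Ax -> ->]]] := coding_prefix p F_sub v0A a 0 1 u NN'.
by apply: hN0 => //; rewrite ss ltnW.
Qed.

Lemma coding_limit : exists X : 'I_k -> R -> 'rV[R]_n, (forall a u, A (X a u)) /\
  forall e : R, 0 < e -> exists N0, forall N, (N0 <= N)%N ->
    forall a u, near_by e (xi N a u) (X a u).
Proof.
(* The limit is obtained as a cluster point in the compact [A], which places it in [A]; the Cauchy
   property then makes it a uniform limit. *)
have H (au : 'I_k * R) : exists x, A x /\ cluster ((fun N => xi N au.1 au.2) @ \oo) x.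
  have [|x [Ax cx]] :=
      A_compact (fmap_proper_filter (fun N => xi N au.1 au.2) (F := \oo) _).
    by exists 0%N => // N _; exact: coding_A.
  by exists x.
have [X hX] := choice H; exists (fun a u => X (a, u)); split=> [a u|e e0].
  exact: (hX (a, u)).1.
have e2 : 0 < e / 2 by rewrite divr_gt0.
have [N0 hN0] := coding_cauchy e2; exists N0 => N N0N a u i.
have [||y [[N' NN' <-] yx]] := (hX (a, u)).2 [set xi N' a u | N' in [set N' | (N <= N')%N]]
    [set y | near_by (e / 2) y (X (a, u))].
- by exists N => // N' /= NN'; exists N'.
- by apply/nbhs_rVP; exists (e / 2).
have := yx i; have := hN0 N N' N0N NN' a u i; rewrite distrC.
have := ler_distD (xi N' a u 0 i) (xi N a u 0 i) (X (a, u) 0 i).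
by rewrite [e]splitr; lra.
Qed.

Lemma coding_mean_eq N a g h : (forall x, A x -> g x = h x) -> cmean N a g = cmean N a h.
Proof.
elim: N a g h => [|N IH] a g h gh /=; first exact/gh/F_sub.
apply: eq_bigr => b _; congr (_ * _); apply: IH => x Ax /=; exact/gh/F_sub.
Qed.

Local Notation Rm := (g_sigma_algebraType R.-ocitv.-measurable).
Local Notation Q := (uniform_prob (@ltr01 R)).
Local Notation D := (`[0, 1[%classic : set Rm).

(** The limit lies in an open [W] exactly when, for some [m], the coding of precision 1/(m+1) has
    its whole box of that size in [W]. This is a countable union of sets covered by
    [measurable_coding]. *)
Lemma measurable_limit a (X : R -> 'rV[R]_n) :
  (forall e : R, 0 < e -> exists N0, forall N, (N0 <= N)%N ->
    forall u, near_by e (xi N a u) (X u)) ->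
  measurable_fun setT (fun u : Rm => (if 0 <= u < 1 then X u else v0) : B).
Proof.
move=> hX; apply: (@measurability _ _ Rm B setT _ (@open 'rV[R]_n)) => //.
move=> _ [W oW <-]; rewrite setTI.
have m0 (m : nat) : 0 < m.+1%:R^-1 :> R by rewrite invr_gt0.
have [N hN] := choice (fun m => hX _ (m0 m)).
pose box m := [set y : 'rV[R]_n | forall z, near_by m.+1%:R^-1 y z -> W z].
have mD : measurable D by exact: measurable_itv.
have -> : (fun u : Rm => if 0 <= u < 1 then X u else v0) @^-1` W =
    \bigcup_m (D `&` [set u | box m (xi (N m) a u)]) `|` (~` D `&` [set u | W v0]).
  apply/seteqP; split=> u.
    rewrite /preimage /=; case: ifPn => hu Ou; last first.
      by right; split=> //= ; rewrite in_itv /=; exact/negP.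
    left; move: oW; rewrite openE => /(_ _ Ou) /nbhs_rVP[d d0 hd].
    have [|m hm] := @ltr_add_invr R 0 (d / 2); first by rewrite divr_gt0.
    rewrite add0r in hm; exists m => //; split; first by rewrite /= in_itv.
    move=> z hz; apply: hd => i; have := hN m (N m) (leqnn _) u i; have := hz i.
    have := ler_distD (xi (N m) a u 0 i) (z 0 i) (X u 0 i); rewrite (distrC (z 0 i) (xi _ a u 0 i)).
    by rewrite [d]splitr; move: (_^-1) hm => t hm; lra.
  case=> [[m _ [Du hb]]|[nDu Ov]]; rewrite /preimage /=.
    rewrite /= in_itv /= in Du; rewrite Du; apply: hb.
    exact: hN.
  by case: ifPn => // hu; case: nDu; rewrite /= in_itv.
apply: measurableU.
  apply: bigcupT_measurable => m.
  by have := @measurable_coding R k p p_ge0 p_sum _ F v0 (N m) (box m) a 0 1 ler01; rewrite add0r.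
have [Ov|nOv] := pselect (W v0).
  rewrite (_ : [set u | W v0] = setT) ?setIT; first exact: measurableC.
  by apply/seteqP; split.
rewrite (_ : [set u | W v0] = set0) ?setI0//.
by apply/seteqP; split.
Qed.

(** The measure is the law of the limit point under the uniform law. The estimate by [coding_mean]
    gives access to its integrals through finite recursions. *)
Lemma limit_measure a : exists nu : probability B R, nu A = 1%E /\
  forall f : 'rV[R]_n -> R, {within A, continuous f} -> forall e : R, 0 < e ->
  exists N0, forall N, (N0 <= N)%N ->
    `|(\int[nu]_(x in A) f x)%R - cmean N a (f \_ A)| <= e.
Proof.
have [X [XA hX]] := coding_limit.
have hXa (e : R) : 0 < e -> exists N0, forall N, (N0 <= N)%N ->
    forall u, near_by e (xi N a u) (X a u).
  by move=> /hX[N0 hN0]; exists N0 => N N0N u; exact: hN0.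
pose Y (u : Rm) : B := if 0 <= u < 1 then X a u else v0.
have mY : measurable_fun setT Y := measurable_limit hXa.
have YA u : A (Y u) by rewrite /Y; case: ifP.
pose Ym : {mfun Rm >-> B} := HB.pack Y (isMeasurableFun.Build _ _ Rm B Y mY).
have mA : measurable (A : set B) by exact: measurable_closed_rV.
have mD : measurable D by exact: measurable_itv.
have QD : Q D = 1%E by rewrite uniform_prob_itv// subr0.
have QDC : Q (~` D) = 0%E by rewrite probability_setC// [X in (1 - X)%E](QD : _ = _) subee.
exists (distribution Q Ym); split.
  have YT : Y @^-1` A = setT by apply/seteqP; split=> // u _; exact: YA.
  by rewrite /= /distribution /pushforward -[1%E](probability_setT Q) -YT.
(* [f] is controlled on [A] only; extended by 0 it has the global bound that [integral_coding] asks
   for, and all codings and their limits lie in [A]. *)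
move=> f cf e e0; set h := f \_ A.
have [K hK] := within_bounded A_compact cf.
have hE x : A x -> h x = f x by move=> Ax; rewrite /h patchE ifT// inE.
have hb x : `|h x| <= `|K|.
  rewrite /h patchE; case: ifPn => [|_]; last by rewrite normr0.
  by rewrite inE => /hK /le_trans; apply; exact: ler_norm.
have mh : measurable_fun setT (h : B -> R).
  exact: ((@measurable_restrictT _ _ B R A f mA).1 (within_measurable A_closed cf)).
have Ih (E : set Rm) : measurable E -> Q.-integrable E (EFin \o (h \o Y)).
  move=> mE; apply: measurable_bounded_integrable => //.
  - exact: le_lt_trans (probability_le1 _ mE) (ltry _).
  - by apply: measurable_funTS; exact: measurableT_comp mh mY.
  - by exists `|K|; split=> [|x /ltW Kx u _]; [exact: num_real|exact: le_trans (hb _) Kx].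
have -> : (\int[distribution Q Ym]_(x in A) f x)%R = (\int[Q]_(u in D) h (Y u))%R.
  rewrite Rintegral_mkcond /Rintegral.
  rewrite (@integral_distribution _ _ _ _ _ Q Ym (EFin \o h)).
  - rewrite -/(Rintegral Q setT (h \o Y)) -(setUv D) Rintegral_setU//.
    + rewrite [X in _ + X](_ : _ = 0) ?addr0//.
      transitivity (\int[Q]_(u in ~` D) h v0)%R.
        apply: eq_Rintegral => u; rewrite inE /= in_itv /= => /negP nu.
        by rewrite /Y ifN.
      rewrite (Rintegral_cst Q (measurableC mD)).
      by rewrite [X in _ * fine X](QDC : _ = _) mulr0.
    + exact: measurableC.
    + by rewrite setUv; exact: Ih.
    + by apply/disj_setPS => u [].
  - exact: (measurable_realfun.measurable_EFinP _ _).2 mh.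
  - exact: Ih.
have [d d0 hd] := within_unif A_compact cf e0.
have [N0 hN0] := hXa d d0; exists N0 => N N0N.
have Ix : Q.-integrable D (EFin \o (fun u => h (xi N a u))).
  have := @integrable_coding R k p p_ge0 p_sum _ F v0 Q N h `|K| a 0 1 hb ler01.
  by rewrite add0r.
have := @integral_coding R k p p_ge0 p_sum _ F v0 Q (@uniform_prob_itv R) N h `|K| a 0 1 hb.
rewrite add0r mul1r => /(_ (lexx _) ler01 (lexx _)) <-.
rewrite -RintegralB//; last exact: Ih.
apply: le_trans (le_normr_Rintegral mD _) _.
  by have := integrableB mD (Ih D mD) Ix.
have -> : e = (\int[Q]_(u in D) e)%R.
  by rewrite (Rintegral_cst Q mD) [X in _ * fine X](QD : _ = _) mulr1.
apply: le_Rintegral => //.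
- have := integrableB mD (Ih D mD) Ix.
  by move=> /integrable_norm.
- apply: measurable_bounded_integrable => //.
  + exact: le_lt_trans (probability_le1 _ mD) (ltry _).
  + by exists `|e|; split=> [|x /ltW ex u _]; [exact: num_real|exact: le_trans ex].
move=> u Du; rewrite !hE; [|exact: coding_A|exact: YA].
apply/ltW; rewrite distrC; apply: hd; [exact: YA|exact: coding_A|].
move: Du; rewrite /= in_itv /= => Du; rewrite /Y Du.
exact: hN0.
Qed.

End Coded.

Variables (P : 'M[R]_k) (q : 'rV[R]_k).
Hypothesis P_stoch : stochastic P.
Hypothesis P_pos : positive_mx P.
Hypothesis q_stat : stationary P q.

Local Notation MV := (transfer P F).

(** Invariance amounts to writing each nu_a as the average, with weights [p a b] of the reversed
    chain, of the images of nu_b under [F a]. The limit laws satisfy this because a coding starts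
    with [F a] followed by a coding from [b]. *)
Lemma invariant_measures : exists nu : 'I_k -> probability B R, prob_on A nu /\
  forall f, Ck A f -> int_sum q A nu (MV f) = int_sum q A nu f.
Proof.
have [q_ge0 q_sum qP] := q_stat; have q_gt0 i := stationary_gt0 P_pos q_stat i.
(* The transition probabilities of the time-reversed chain. *)
pose p a b := q 0 b * P b a / q 0 a.
have p_ge0 a b : 0 <= p a b by rewrite !mulr_ge0 ?invr_ge0// ltW.
have p_sum a : \sum_b p a b = 1.
  have : (q *m P) 0 a / q 0 a = 1 by rewrite qP divff// gt_eqF.
  by rewrite mxE mulr_suml.
have [nu hnu] := choice (limit_measure p_ge0 p_sum).
exists nu; split=> [i|f cf]; first exact: (hnu i).1.
(* This is the recursion of [coding_mean] in the limit: depth [N.+1] from [a] on the left, depth [N]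
   from every [b] on the right. *)
have step a (g : 'rV[R]_n -> R) : {within A, continuous g} ->
    (\int[nu a]_(x in A) g x)%R = \sum_b p a b * (\int[nu b]_(x in A) g (F a x))%R.
  move=> cg; apply: eq_of_dist_le => e e0.
  have [N1 hN1] := (hnu a).2 _ cg _ e0.
  have [N2 hN2] := choice (fun b => (hnu b).2 _ (@F_within a g cg) _ e0).
  pose N := (N1 + \max_b N2 b)%N.
  have h1 := hN1 N.+1 (leqW (leq_addr _ _)).
  have h2 : `|coding_mean p F v0 N.+1 a (g \_ A) -
      \sum_b p a b * (\int[nu b]_(x in A) g (F a x))%R| <= e.
    rewrite /= -sumrB; apply: le_trans (ler_norm_sum _ _ _) _.
    rewrite -[leRHS]mul1r -(p_sum a) mulr_suml; apply: ler_sum => b _.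
    rewrite -mulrBr normrM (ger0_norm (p_ge0 _ _)) ler_wpM2l// distrC.
    rewrite (coding_mean_eq p N b (h := (g \o F a) \_ A)); last first.
      by move=> x Ax; rewrite /= !patchE !ifT// inE//; exact: F_sub.
    by apply: hN2; rewrite (leq_trans (leq_bigmax b))// leq_addl.
  have := ler_distD (coding_mean p F v0 N.+1 a (g \_ A)) (\int[nu a]_(x in A) g x)%R
    (\sum_b p a b * (\int[nu b]_(x in A) g (F a x))%R).
  by move: h1 h2; lra.
transitivity (\sum_i \sum_j q 0 i * P i j * (\int[nu i]_(x in A) f j (F j x))%R).
  apply: eq_bigr => i _.
  rewrite (integral_lincomb A_compact A_closed (nu i) (index_enum 'I_k) (fun j => P i j)
    (f := fun j x => f j (F j x))); last by move=> j; exact: (@F_within j (f j) (cf j)).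
  by rewrite mulr_sumr; apply: eq_bigr => j _; rewrite mulrA.
(* Time reversal: q_j p_ji = q_i P_ij. *)
rewrite exchange_big; apply: eq_bigr => j _; rewrite (step j _ (cf j)).
rewrite mulr_sumr; apply: eq_bigr => i _; rewrite mulrA; congr (_ * _).
by rewrite /p [RHS]mulrC divfK// gt_eqF.
Qed.

Hypothesis MV_osc : forall f (e : R), Ck A f -> 0 < e -> exists N0, forall N, (N0 <= N)%N ->
  forall i j x y, A x -> A y -> `|iter N MV f i x - iter N MV f j y| <= e.

Lemma transfer_within f : Ck A f -> Ck A (MV f).
Proof. by move=> cf i; apply: within_lincomb => j; exact: (@F_within j (f j) (cf j)). Qed.

Lemma iter_transfer_within N f : Ck A f -> Ck A (iter N MV f).
Proof. by move=> cf; elim: N => // N IH; rewrite iterS; exact: transfer_within. Qed.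

Lemma int_sum_close mu f (c e : R) : prob_on A mu -> Ck A f ->
  (forall i x, A x -> `|f i x - c| <= e) -> `|int_sum q A mu f - c| <= e.
Proof.
have [q_ge0 q_sum _] := q_stat; move=> muA cf h.
rewrite -[X in _ - X]mul1r -q_sum mulr_suml /int_sum -sumrB.
apply: le_trans (ler_norm_sum _ _ _) _.
rewrite -[leRHS]mul1r -q_sum mulr_suml; apply: ler_sum => i _.
rewrite -mulrBr normrM (ger0_norm (q_ge0 _)) ler_wpM2l//.
by apply: integral_close => //; exact: h.
Qed.

Lemma int_sum_iter mu f N :
  (forall f, Ck A f -> int_sum q A mu (MV f) = int_sum q A mu f) ->
  Ck A f -> int_sum q A mu (iter N MV f) = int_sum q A mu f.
Proof.
by move=> inv cf; elim: N => // N IH; rewrite iterS inv//; exact: iter_transfer_within.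
Qed.

(** The iterates become almost constant, and invariance identifies the constant as the integral of
    [f]. Convergence and uniqueness both follow, since the iterates do not depend on [mu]. *)
Lemma iter_close mu f (e : R) : prob_on A mu ->
  (forall f, Ck A f -> int_sum q A mu (MV f) = int_sum q A mu f) ->
  Ck A f -> 0 < e -> exists N0, forall N, (N0 <= N)%N ->
  forall i x, A x -> `|iter N MV f i x - int_sum q A mu f| <= e.
Proof.
move=> muA inv cf e0; have [N0 hN0] := MV_osc cf e0; exists N0 => N N0N i x Ax.
rewrite -(int_sum_iter N inv cf) distrC; apply: int_sum_close => //.
  exact: iter_transfer_within.
by move=> j y Ay; exact: hN0.
Qed.

Lemma invariant_measures_cvg mu f : prob_on A mu ->
  (forall f, Ck A f -> int_sum q A mu (MV f) = int_sum q A mu f) -> Ck A f ->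
  normCk q A (fun i x => iter N MV f i x - int_sum q A mu f) @[N --> \oo] --> (0 : R).
Proof.
have [q_ge0 q_sum _] := q_stat; move=> muA inv cf; apply/cvgrPdist_le => e e0.
have [N0 hN0] := iter_close muA inv cf e0; exists N0 => // N N0N /=.
have hs i : 0 <= sup [set `|iter N MV f i x - int_sum q A mu f| | x in A] <= e.
  have hA : [set `|iter N MV f i x - int_sum q A mu f| | x in A] !=set0.
    by exists `|iter N MV f i v0 - int_sum q A mu f|; exists v0.
  have hu : ubound [set `|iter N MV f i x - int_sum q A mu f| | x in A] e.
    by move=> _ [x Ax <-]; exact: hN0.
  apply/andP; split; last exact: ge_sup.
  apply: (@le_trans _ _ `|iter N MV f i v0 - int_sum q A mu f|) => //.
  by apply: sup_upper_bound; [split=> //; exists e|exists v0].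
rewrite sub0r normrN ger0_norm; last first.
  by apply: sumr_ge0 => i _; rewrite mulr_ge0//; case/andP: (hs i).
rewrite -[leRHS]mul1r -q_sum mulr_suml; apply: ler_sum => i _.
by rewrite ler_wpM2l//; case/andP: (hs i).
Qed.

Lemma invariant_measures_unique mu nu : prob_on A mu -> prob_on A nu ->
  (forall f, Ck A f -> int_sum q A mu (MV f) = int_sum q A mu f) ->
  (forall f, Ck A f -> int_sum q A nu (MV f) = int_sum q A nu f) ->
  forall i (E : set B), measurable E -> mu i E = nu i E.
Proof.
move=> muA nuA mu_inv nu_inv i; have q0 := stationary_gt0 P_pos q_stat i.
have eq_sum f : Ck A f -> int_sum q A mu f = int_sum q A nu f.
  move=> cf; apply: eq_of_dist_le => e e0.
  have [N1 hN1] := iter_close muA mu_inv cf e0.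
  have [N2 hN2] := iter_close nuA nu_inv cf e0.
  have := hN1 (N1 + N2)%N (leq_addr _ _) i v0 v0A.
  have := hN2 (N1 + N2)%N (leq_addl _ _) i v0 v0A.
  have := ler_distD (iter (N1 + N2) MV f i v0) (int_sum q A mu f) (int_sum q A nu f).
  by rewrite (distrC (int_sum q A mu f) (iter _ _ _ _ _)); lra.
apply: (probability_eq A_compact A_closed (muA i) (nuA i)) => h ch.
(* Placing [h] in the slot [i] and 0 elsewhere isolates the measure of index [i], whose weight is
   positive. *)
have cf : Ck A (fun j => if j == i then h else fun=> 0).
  by move=> j; case: eqP => // _; exact: within_cst.
have mA : measurable (A : set B) by exact: measurable_closed_rV.
have E la : int_sum q A la (fun j => if j == i then h else fun=> 0) =
    q 0 i * (\int[la i]_(x in A) h x)%R.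
  rewrite /int_sum (bigD1 i)//= eqxx big1 ?addr0// => j /negPf ->.
  by rewrite (Rintegral_cst (la j) mA) mul0r mulr0.
by have := eq_sum _ cf; rewrite !E => /(mulfI (lt0r_neq0 q0)).
Qed.

End InvariantMeasures.

Theorem theorem3p2 (R : realType) (n k : nat) (hn : (0 < n)%N) (hk : (0 < k)%N)
    (M : 'I_k -> 'M[R]_(1 + n))
    (M_unit : forall i, M i \in unitmx) (M_pos : forall i, positive_mx (M i))
    (P : 'M[R]_k) (P_stoch : stochastic P) (P_pos : positive_mx P)
    (q : 'rV[R]_k) (q_stat : stationary P q)
    (U : set 'rV[R[i]]_n)
    (U_open : open U) (U_bounded : bounded_set U) (U_nonempty : U !=set0)
    (U_connected : connected U)
    (U_pos : forall z, U z -> forall j, 0 < complex.Re (z 0 j))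
    (V : set 'rV[R]_n) (V_def : V = [set remx z | z in U])
    (V_connected : connected V) (V_open : open V)
    (V_pos : forall x, V x -> forall j, 0 < x 0 j)
    (V_sub : forall x, V x -> U (cmx x))
    (MU_sub : forall i, closure [set hat (cmx (M i)) z | z in U] `<=` U)
    (MU_analytic : forall i, analytic_map_on U (hat (cmx (M i))))
    (MV_sub : forall i, closure [set hat (M i) x | x in V] `<=` V)
    (MV_analytic : forall i, analytic_map_on V (hat (M i))) :
  (exists T : {linear Ainfk k U -> Ainfk k U},
    (forall (w : Ainfk k U) i z, U z ->
      T w i z = transfer (cmx P) 
        (fun j => hat (cmx (M j))) (fun j => Ainf_val (w j)) i z) /\
    (* (a) *)
    (bounded_op (normAk q U) (normAk q U) T /\
      opnorm (normAk q U) (normAk q U) T = 1) /\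
    (* (b) *)
    (eigenfunction T 1 (cst_vec k U_open 1) /\
      forall w, eigenfunction T 1 w -> exists c, w = c *: cst_vec k U_open 1) /\
    (* (c) *)
    (isolated (spectrum (normAk q U) T) 1 /\
      algebraic_multiplicity T 1 1 /\
      exists F : set R[i],
        [/\ closed F, F `<=` [set l | normc l < 1] &
            spectrum (normAk q U) T `\ 1 `<=` F]) /\
    (* (d) and (e) *)
    exists nu : 'I_k -> {scalar Ainf U},
      [/\ (forall i, functional_norm1 (nu i)),
          (forall i, nu i (Acst U_open 1) = 1),
          dual_op T (nu_sum q nu) = nu_sum q nu,
          (forall mu : 'I_k -> {scalar Ainf U},
            (forall i, functional_norm1 (mu i)) ->
            dual_op T (nu_sum q mu) = nu_sum q mu ->
            (exists c, normc c = 1 /\ forall i w, mu i w = c * nu i w) /\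
            ((forall i, mu i (Acst U_open 1) = 1) ->
             forall i w, mu i w = nu i w)) &
          (forall w : Ainfk k U,
            normAk q U (iter N T w - cst_vec k U_open (nu_sum q nu w))
              @[N --> \oo] --> (0 : R))]) /\
  (let MV := transfer P (fun j => hat (M j)) in
   (forall f, Ck (closure V) f -> Ck (closure V) (MV f)) /\
   (* (f) and (g) *)
   exists nu : 'I_k -> probability (borel_rV R n) R,
     [/\ prob_on (closure V) nu,
         (forall f, Ck (closure V) f ->
           int_sum q (closure V) nu (MV f) = int_sum q (closure V) nu f),
         (forall mu : 'I_k -> probability (borel_rV R n) R,
           prob_on (closure V) mu ->
           (forall f, Ck (closure V) f ->
             int_sum q (closure V) mu (MV f) = int_sum q (closure V) mu f) ->
           forall i (A : set (borel_rV R n)), measurable A -> mu i A = nu i A) &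
         (forall f, Ck (closure V) f ->
           normCk q (closure V)
               (fun i x => iter N MV f i x - int_sum q (closure V) nu f)
             @[N --> \oo] --> (0 : R))]).
Proof.
split.
  pose T := transferA M_pos U_open U_pos MU_sub P.
  pose nu i : {scalar Ainf U} :=
    nui hk M_pos U_open U_bounded U_nonempty U_pos MU_sub P_stoch P_pos q_stat i.
  have inv : dual_op T (nu_sum q nu) = nu_sum q nu.
    by apply/funext => w; rewrite /dual_op /= !nui_sum nuf_T.
  exists T; split.
    move=> w i z Uz; rewrite transferAE// /markov_op /transfer.
    by apply: eq_bigr => j _; rewrite mxE.
  split; first by split; [exact: (transfer_bounded M_pos U_open U_bounded U_nonempty U_pos MU_sub P_stoch q_stat)
      |exact: (transfer_opnorm M_pos U_open U_bounded U_nonempty U_pos MU_sub P_stoch q_stat)].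
  split.
    split; first exact: (eigenvector1 hk M_pos U_open U_nonempty U_pos MU_sub P_stoch).
    by move=> w; exact: (eigenvector1_unique hk U_bounded U_nonempty P_stoch P_pos q_stat).
  split.
    split.
      exact: (spectrum_isolated hk M_pos U_open U_bounded U_nonempty U_pos MU_sub P_stoch P_pos q_stat).
    split.
      exact: (multiplicity1 hk M_pos U_open U_bounded U_nonempty U_pos MU_sub P_stoch P_pos q_stat).
    exact: (spectrum_gap hk M_pos U_open U_bounded U_nonempty U_pos MU_sub P_stoch P_pos q_stat).
  exists nu; split.
  - by move=> i; exact: nui_norm1.
  - by move=> i; exact: nui1.
  - exact: inv.
  - by move=> mu mu1 muT; exact: nui_unique.
  - exact: (nui_cvg hk M_pos U_open U_bounded U_nonempty U_pos MU_sub P_stoch P_pos q_stat).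
have cV := compact_closure_V U_bounded V_def.
have clV : closed (closure V) by exact: closed_closure.
have [v0 /(@subset_closure _ V) v0V] := V_nonempty U_nonempty V_def.
have Fs j x : closure V x -> closure V (hat (M j) x) by exact: hat_closure.
have Fw j (f : 'rV[R]_n -> R) : {within closure V, continuous f} ->
  {within closure V, continuous (f \o hat (M j))} by exact: within_comp_hat.
have osc f (e : R) := @real_osc_small R n k M hk M_pos U U_bounded U_open U_pos MU_sub V V_def
  V_pos V_sub MV_sub P P_stoch P_pos f e.
split; first by move=> f; exact: transfer_within.
have [|nu [nuV nu_inv]] := invariant_measures cV clV v0V Fs Fw _ P_pos q_stat.
  by move=> e; exact: (orbV_diam M_pos U_bounded U_open U_pos MU_sub V_pos V_sub MV_sub).
exists nu; split=> //.
- by move=> mu muV mu_inv; exact: (invariant_measures_unique cV clV v0V Fw P_pos q_stat osc).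
- by move=> f cf; exact: (invariant_measures_cvg cV clV v0V Fw q_stat osc).
Qed.
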